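(* Let $d\ge 1$ and $D=2d$. (1) Every T-diagram $X$ (with $2d+4$ points) has a characteristic tree. It is unique up to simultaneous reversal of the cyclic orders at all vertices: if $(G,\varphi)$ and $(G',\varphi')$ are two characteristic trees of $X$, then there is a graph isomorphism $\psi:G\to G'$ with $\psi\circ\varphi=\varphi'$ which either preserves the cyclic order of edges at every degree-3 vertex or reverses it at every degree-3 vertex. (2) If $D\ge 4$, then for every 3-tree $G$ with $D+4$ vertices there exists a T-diagram $X$ for which $G$ is a characteristic tree (for a suitable bijection $\varphi$), and such a T-diagram is unique up to combinatorial equivalence of planar diagrams.
   Context: A convex polytope in $\mathbb{R}^{2d}$ is neighborly if every $d$ of its vertices form the vertex set of a face. Gale diagrams: let $X^*=\{x_1,\dots,x_N\}\subset\mathbb{R}^D$ affinely span $\mathbb{R}^D$. The space of affine dependencies $\{\lambda\in\mathbb{R}^N:\sum\lambda_i x_i=0,\sum\lambda_i=0\}$ has dimension $N-D-1$; writing a basis of it as the rows of an $(N-D-1)\times N$ matrix, its columns $\bar x_1,\dots,\bar x_N\in\mathbb{R}^{N-D-1}$ form the vector Gale diagram (assumed nonzero, as is the case when $X^*$ is the vertex set of a polytope). An affine Gale diagram $X$ is obtained by choosing an affine hyperplane $e\subset\mathbb{R}^{N-D-1}$ not through $0$ and not parallel to any $\bar x_i$ and taking the intersection point of the line $\mathbb{R}\bar x_i$ with $e$, colored black if it is a positive multiple of $\bar x_i$ and white otherwise; $A^*$ denotes the point of $X^*$ corresponding to $A\in X$. For $N=D+4$ this is a set of colored points in a plane. A T-diagram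 is an affine Gale diagram $X$ of the vertex set of a neighborly polytope in $\mathbb{R}^{2d}$ with $2d+4$ vertices such that $X$ has exactly $d+3$ black points and they are in convex position (hence $d+1$ white points); such a polytope is a T-polytope. The boundary of the convex $(d+3)$-gon of black points gives an (unoriented) cyclic order on the black points. A 3-tree is a finite tree all of whose vertices have degree 1 or 3, together with a cyclic order on the three edges at each degree-3 vertex. This induces a cyclic order on the leaves: walking around the tree (arriving at a degree-3 vertex along edge $e$, leave along the edge following $e$ in its cyclic order), the leaves are visited in this cyclic order. A characteristic tree of a T-diagram $X$ is a 3-tree $G$ with a bijection $\varphi$ from $X$ to the vertex set of $G$ such that: (i) white points go to degree-3 vertices and black points to leaves; (ii) the unoriented cyclic order of leaves of $G$ coincides (via $\varphi$) with the unoriented cyclic order of black points along the boundary of the $(d+3)$-gon; (iii) a white point $B$ lies inside the triangle formed by black points $A_i,A_j,A_k$ if and only if there are three paths in $G$ from $\varphi(B)$ to $\varphi(A_i),\varphi(A_j),\varphi(A_k)$ that pairwise share only the vertex $\varphi(B)$. Two planar diagrams are combinatorially equivalent if there is a bijection between them preserving colors, preserving the ''lies between'' relation for collinear triples, and either preserving the orientation of every triple of points or reversing the orientation of every triple (i.e. equivalence up to mirror symmetry). *)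

(* Defs.v *)
From mathcomp Require Import all_boot all_order all_algebra.
From mathcomp Require Import boolp classical_sets cardinality reals.

Set Implicit Arguments.
Unset Strict Implicit.
Unset Printing Implicit Defensive.

Import Order.TTheory GRing.Theory Num.Theory.
Local Open Scope classical_set_scope.
Local Open Scope ring_scope.

(** * Convex polytopes *)

Definition conv_hull (R : realType) (D : nat) (A : set 'rV[R]_D) :
    set 'rV[R]_D :=
  [set p | exists (n : nat) (y : 'I_n -> 'rV[R]_D) (w : 'I_n -> R),
     [/\ forall i, A (y i), forall i, 0 <= w i, \sum_i w i = 1
       & p = \sum_i w i *: y i]].

Definition polytope (R : realType) (D : nat) (P : set 'rV[R]_D) : Prop :=
  exists2 A : set 'rV[R]_D, finite_set A & P = conv_hull A.

(* The functional [c] may be zero, so [P] itself and [set0] count as faces. *)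
Definition face (R : realType) (D : nat) (P F : set 'rV[R]_D) : Prop :=
  exists (c : 'cV[R]_D) (b : R),
    (forall p, P p -> (p *m c) 0 0 <= b) /\
    F = P `&` [set p | (p *m c) 0 0 = b].

Definition vertices (R : realType) (D : nat) (P : set 'rV[R]_D) :
    set 'rV[R]_D :=
  [set v | face P [set v]].

Definition neighborly (R : realType) (d : nat) (P : set 'rV[R]_(2 * d)) : Prop :=
  forall A : set 'rV[R]_(2 * d), A `<=` vertices P -> (A #= `I_d)%card ->
    exists2 F, face P F & vertices F = A.

(** * Gale diagrams *)

Definition affinely_spans (R : realType) (n D : nat) (x : 'I_n -> 'rV[R]_D) :
    Prop :=
  forall p, exists2 w : 'I_n -> R, \sum_i w i = 1 & p = \sum_i w i *: x i.

Definition affine_dependency (R : realType) (n D : nat)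
    (x : 'I_n -> 'rV[R]_D) (l : 'rV[R]_n) : Prop :=
  \sum_i l 0 i *: x i = 0 /\ \sum_i l 0 i = 0.

(* [row_free] and the equality of row space and dependency space say that the
   rows of [G] are a basis, which forces m = n - D - 1. *)
Definition vector_gale_diagram (R : realType) (n D m : nat)
    (x : 'I_n -> 'rV[R]_D) (G : 'M[R]_(m, n)) : Prop :=
  [/\ affinely_spans x,
      row_free G,
      forall l : 'rV[R]_n, (l <= G)%MS <-> affine_dependency x l
    & forall i, col i G != 0].

(* A family of [n] coloured points of R^m. *)
Record diagram (R : realType) (n m : nat) := Diagram {
  pt : 'I_n -> 'rV[R]_m;
  black : pred 'I_n }.

(* The hyperplane [e] of R^(m+1) is given with an affine coordinate system
   u |-> o + u *m B from R^m onto e, and the diagram lives in these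
   coordinates; [B] spans the directions of [e], so e avoids 0 iff o is not in
   the row space of [B], and a vector is parallel to [e] iff it is in it. *)
Definition affine_gale_diagram (R : realType) (n D m : nat)
    (x : 'I_n -> 'rV[R]_D) (X : diagram R n m) : Prop :=
  exists (G : 'M[R]_(m.+1, n)) (o : 'rV[R]_m.+1) (B : 'M[R]_(m, m.+1)),
    [/\ vector_gale_diagram x G,
        row_free B,
        ~~ (o <= B)%MS,
        forall i, ~~ ((col i G)^T <= B)%MS
      & forall i, exists2 t : R,
          o + pt X i *m B = t *: (col i G)^T & black X i = (0 < t)].

(** * T-diagrams *)

Definition black_points (R : realType) (n m : nat) (X : diagram R n m) :
    set 'rV[R]_m :=
  [set pt X i | i in [set i | black X i]].

Definition black_convex_position (R : realType) (n m : nat)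
    (X : diagram R n m) : Prop :=
  forall i, black X i ->
    ~ conv_hull [set pt X j | j in [set j | black X j && (j != i)]] (pt X i).

Definition T_diagram (R : realType) (d : nat) (X : diagram R (2 * d + 4) 2) :
    Prop :=
  (exists (P : set 'rV[R]_(2 * d)) (x : 'I_(2 * d + 4) -> 'rV[R]_(2 * d)),
     [/\ polytope P, neighborly P, injective x, range x = vertices P
       & affine_gale_diagram x X]) /\
  #|black X| = (d + 3)%N /\ black_convex_position X.

(* Consecutive points span edges of the polygon of black points. The relation
   is symmetric, so both directions of traversal and all starting points are
   allowed: the list represents an unoriented cyclic order. *)
Definition boundary_order (R : realType) (n : nat) (X : diagram R n 2)
    (c : seq 'I_n) : Prop :=
  [/\ uniq c, c =i black X
    & cycle (fun i j => `[< face (conv_hull (black_points X))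
                                 (conv_hull [set pt X i; pt X j]) >]) c].

Definition in_triangle (R : realType) (p a b c : 'rV[R]_2) : Prop :=
  exists s t u : R, [/\ 0 < s, 0 < t, 0 < u, s + t + u = 1
                      & p = s *: a + t *: b + u *: c].

(** * 3-trees *)

(* An edge at [v] is identified with its other end, and [succ v w] is the edge
   following [w] in the cyclic order at [v]; a cyclic order on three edges is
   a 3-cycle, i.e. an injection without fixed points. Values of [succ v w]
   for [v] not of degree 3 or [w] not adjacent to [v] are meaningless. *)
Record tree3 := Tree3 {
  vert :> finType;
  adj : rel vert;
  succ : vert -> vert -> vert;
  adj_sym : symmetric adj;
  adj_irr : irreflexive adj;
  vert_gt0 : (0 < #|vert|)%N;
  tree_connected : forall u v, connect adj u v;
  tree_acyclic : forall c : seq vert, (2 < size c)%N -> ~ ucycle adj c;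
  tree_deg : forall v, (#|adj v| == 1%N) || (#|adj v| == 3%N);
  succ_adj : forall v w, #|adj v| = 3%N -> adj v w -> adj v (succ v w);
  succ_neq : forall v w, #|adj v| = 3%N -> adj v w -> succ v w != w;
  succ_inj : forall v, #|adj v| = 3%N -> {in adj v &, injective (succ v)} }.

Definition leaf (G : tree3) (v : G) : bool := #|adj v| == 1%N.
Definition trivalent (G : tree3) (v : G) : bool := #|adj v| == 3%N.

(* The pair (u, v) stands for the edge uv traversed from u to v. *)
Definition walk_step (G : tree3) (a : G * G) : G * G :=
  (a.2, if trivalent a.2 then succ a.2 a.1 else a.1).

(* The leaves listed in the order in which the walk around the tree, started
   along some edge, visits them. *)
Definition leaf_order (G : tree3) (c : seq G) : Prop :=
  exists2 a : G * G, adj a.1 a.2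
    & c = [seq b.2 | b <- orbit (@walk_step G) a & leaf b.2].

Definition simple_path (G : tree3) (u v : G) (p : seq G) : Prop :=
  [/\ path (@adj G) u p, uniq (u :: p) & last u p = v].

(* Since [simple_path u v p] keeps [u] out of [p], disjointness of the lists
   means that the paths share [u] only. *)
Definition tripod (G : tree3) (u v1 v2 v3 : G) : Prop :=
  exists p1 p2 p3 : seq G,
    [/\ simple_path u v1 p1, simple_path u v2 p2 & simple_path u v3 p3] /\
    [/\ ~~ has (mem p1) p2, ~~ has (mem p1) p3 & ~~ has (mem p2) p3].

Definition characteristic_tree (R : realType) (n : nat) (X : diagram R n 2)
    (G : tree3) (phi : 'I_n -> G) : Prop :=
  bijective phi /\
  [/\ forall i, if black X i then leaf (phi i) else trivalent (phi i),
      exists2 c, boundary_order X c & leaf_order (map phi c)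
    & forall b i j k, ~~ black X b -> black X i -> black X j -> black X k ->
        uniq [:: i; j; k] ->
        (in_triangle (pt X b) (pt X i) (pt X j) (pt X k) <->
         tripod (phi b) (phi i) (phi j) (phi k))].

Definition graph_iso (G H : tree3) (psi : G -> H) : Prop :=
  bijective psi /\ forall u v, adj (psi u) (psi v) = adj u v.

Definition preserves_cyclic_orders (G H : tree3) (psi : G -> H) : Prop :=
  forall v w, trivalent v -> adj v w ->
    succ (psi v) (psi w) = psi (succ v w).

Definition reverses_cyclic_orders (G H : tree3) (psi : G -> H) : Prop :=
  forall v w, trivalent v -> adj v w ->
    succ (psi v) (psi (succ v w)) = psi w.

(** * Combinatorial equivalence of planar diagrams *)

Definition orientation (R : realType) (p q r : 'rV[R]_2) : R :=
  Num.sg ((q 0 0 - p 0 0) * (r 0 1 - p 0 1)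
          - (q 0 1 - p 0 1) * (r 0 0 - p 0 0)).

(* Closed segments: for distinct points this is strict betweenness, and for
   families with repetitions it also records which points coincide. *)
Definition between (R : realType) (p q r : 'rV[R]_2) : Prop :=
  conv_hull [set p; r] q.

Definition comb_equiv (R : realType) (n m : nat)
    (X : diagram R n 2) (Y : diagram R m 2) : Prop :=
  exists f : 'I_n -> 'I_m,
    [/\ bijective f,
        forall i, black Y (f i) = black X i,
        forall i j k, between (pt Y (f i)) (pt Y (f j)) (pt Y (f k)) <->
                      between (pt X i) (pt X j) (pt X k)
      & (forall i j k, orientation (pt Y (f i)) (pt Y (f j)) (pt Y (f k)) =
                       orientation (pt X i) (pt X j) (pt X k)) \/
        (forall i j k, orientation (pt Y (f i)) (pt Y (f j)) (pt Y (f k)) =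
                       - orientation (pt X i) (pt X j) (pt X k))].

(* Main.v *)
(* In the affine Gale diagram neighborliness says that for every oriented line
   more than d points are black on its left or white on its right. With d + 3 black points in convex position this forces
   general position, and as many white as black points beyond every black
   diagonal, hence exactly one white point in every black triangle. Conversely
   such configurations carry all the strictly signed affine relations that
   neighborliness asks for, and the polytope is recovered from the kernel of the
   matrix of its Gale vectors.

   By pigeonhole two consecutive ears of the polygon share their white point q.
   Their centres a, b then form a cherry: q lies in all triangles a b k, and no
   other white point separates a from b. Removing a and q leaves a smaller
   configuration, so cherries give, by induction, the characteristic tree and
   the orientation of every triple of points. Running the induction backwards,
   by splitting a black point b into two nearby points a, b with a white point
   between them, realizes every tree. *)

Require Import Defs.
From mathcomp Require Import all_boot all_order all_algebra.
From mathcomp Require Import boolp classical_sets cardinality reals.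
From mathcomp Require Import ring lra zify.

Set Implicit Arguments.
Unset Strict Implicit.
Unset Printing Implicit Defensive.

(** * Binary trees *)

(** The induction needs an invariant that survives the loss of one black and one white point, also
    below the range where polytopes make sense. [conf] is that invariant: it mentions only
    orientations and the containment of white points in black triangles, and its smallest case is a
    pair of black points without white ones. On the tree side a fixed black point [r] serves as
    root. The two black points of a cherry are always found among the others, so the root is never
    removed and a cherry becomes two sibling leaves of a binary tree. The two unoriented choices,
    the direction of the polygon and the reversal of all cyclic orders, meet in [mirror]. The
    balance beyond a diagonal comes from counting: the two sides of a line each account for more
    than d of the 2d + 4 points, so at most two lie on the line, and when two do both counts are
    exactly d + 1. The orientation of three white points is not recorded by any triangle; it is
    reached by comparing the white point of a cherry with one of its black points, from which all
    other white points are seen in the same order. *)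

(* A 3-tree is encoded by one of its leaves [r] and the binary tree hanging
   from the neighbour of [r]; [r] itself is not part of that tree, and the
   cyclic order at a node is parent, left child, right child. *)
Inductive bt (T : Type) := Leaf of T | Node of T & bt T & bt T.

Section BtBasic.
Variable T : eqType.
Implicit Types (t s L : bt T) (x y i j k a b q r u v : T).

Definition bt_root t := match t with Leaf v | Node v _ _ => v end.

Fixpoint leaves t := match t with
  | Leaf v => [:: v] | Node _ L M => leaves L ++ leaves M end.

Fixpoint nodes t := match t with
  | Leaf _ => [::] | Node v L M => v :: nodes L ++ nodes M end.

Fixpoint labels t := match t with
  | Leaf v => [:: v] | Node v L M => v :: labels L ++ labels M end.

(* The branch at the node [x] containing [i]: 1 and 2 are the two subtrees,
   0 is the side of the parent. *)
Fixpoint side t x i : nat := match t with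
  | Leaf _ => 0
  | Node v L M =>
      if x == v then (if i \in labels L then 1 else if i \in labels M then 2 else 0)
      else side L x i + side M x i
  end.

(** The combinatorial form of [tripod]: paths from [x] to three vertices can be chosen to share only
    [x] when they start into different branches. At a label that is not a node every side is 0, so
    [tri] fails there. *)
Definition tri t x i j k := uniq [:: side t x i; side t x j; side t x k].

(** With the order parent, left, right at each node, exchanging the subtrees everywhere reverses
    every cyclic order. *)
Fixpoint mirror t := match t with
  | Leaf v => Leaf v | Node v L M => Node v (mirror M) (mirror L) end.

Lemma perm_labels t : perm_eq (labels t) (leaves t ++ nodes t).
Proof.
elim: t => //= v L hL M hM; apply/permP => P /=.
move/permP: hL => /(_ P); move/permP: hM => /(_ P).
by rewrite !count_cat /= !count_cat; lia.
Qed.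

Lemma mem_labels t : labels t =i leaves t ++ nodes t.
Proof. exact/perm_mem/perm_labels. Qed.

Lemma size_leaves t : size (leaves t) = (size (nodes t)).+1.
Proof. by elim: t => //= v L hL M hM; rewrite !size_cat hL hM addnS. Qed.

Lemma bt_root_labels t : bt_root t \in labels t.
Proof. by case: t => * /=; rewrite mem_head. Qed.

Lemma leaves_neq0 t : leaves t != [::].
Proof. by rewrite -size_eq0 size_leaves. Qed.

Lemma side_notin t x i : x \notin nodes t -> side t x i = 0.
Proof.
elim: t => //= v L hL M hM; rewrite inE mem_cat !negb_or => /and3P[/negbTE-> h1 h2].
by rewrite hL // hM.
Qed.

Lemma side_out t x i : i \notin labels t -> side t x i = 0.
Proof.
elim: t => //= v L hL M hM; rewrite inE mem_cat !negb_or => /and3P[_ h1 h2].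
by rewrite (negbTE h1) (negbTE h2) hL // hM // if_same.
Qed.

Lemma leaves_mirror t : leaves (mirror t) = rev (leaves t).
Proof. by elim: t => //= v L -> M ->; rewrite rev_cat. Qed.

Lemma perm_labels_mirror t : perm_eq (labels (mirror t)) (labels t).
Proof.
elim: t => //= v L hL M hM; rewrite perm_cons perm_catC.
exact: perm_cat.
Qed.

Lemma nodes_mirror t : nodes (mirror t) =i nodes t.
Proof. by elim: t => //= v L hL M hM x; rewrite !inE !mem_cat hL hM [(x \in nodes M) || _]orbC. Qed.

Lemma uniq_labelsP v L M : uniq (labels (Node v L M)) ->
  [/\ uniq (labels L), uniq (labels M), v \notin labels L, v \notin labels M
    & forall x, x \in labels L -> x \notin labels M].
Proof.
rewrite /= mem_cat negb_or cat_uniq => /andP[/andP[h1 h2] /and3P[h3 /hasPn d h4]].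
by split=> // x xL; apply/negP => /d /=; rewrite xL.
Qed.

Lemma nodes_sub t x : x \in nodes t -> x \in labels t.
Proof. by rewrite mem_labels mem_cat => ->; rewrite orbT. Qed.

Lemma leaves_sub t x : x \in leaves t -> x \in labels t.
Proof. by rewrite mem_labels mem_cat => ->. Qed.

Lemma uniq_labels_leaves t : uniq (labels t) -> uniq (leaves t).
Proof. by rewrite (perm_uniq (perm_labels t)) cat_uniq => /and3P[]. Qed.

Lemma uniq_root_leaves r t : uniq (r :: labels t) -> uniq (r :: leaves t).
Proof.
rewrite !cons_uniq => /andP[h1 h2]; rewrite uniq_labels_leaves // andbT.
by apply: contra h1; apply: leaves_sub.
Qed.

Lemma leaf_notin_nodes t x : uniq (labels t) -> x \in leaves t -> x \notin nodes t.
Proof.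
rewrite (perm_uniq (perm_labels t)) cat_uniq => /and3P[_ /hasPn d _] xl.
by apply/negP => /d; rewrite /= xl.
Qed.

Definition swap12 n := match n with 1 => 2 | 2 => 1 | m => m end.

Lemma side_mirror t x i : uniq (labels t) ->
  side (mirror t) x i = swap12 (side t x i).
Proof.
elim: t => //= v L hL M hM /uniq_labelsP[uL uM vL vM d].
rewrite !(perm_mem (perm_labels_mirror _)) hL // hM //.
case: eqVneq => [_|_].
  have [iL|iL] := boolP (i \in labels L); first by rewrite (negbTE (d _ iL)).
  by case: ifP.
have [xL|xL] := boolP (x \in labels L).
  rewrite [side M x i]side_notin; first by rewrite addn0.
  by exact: contra (@nodes_sub _ _) (d _ xL).
by rewrite [side L x i]side_notin ?addn0 //; exact: contra (@nodes_sub _ _) xL.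
Qed.

Lemma tri_mirror t x i j k : uniq (labels t) ->
  tri (mirror t) x i j k = tri t x i j k.
Proof.
move=> u; have sw_inj : injective swap12 by do 2 case=> [|[|[|?]]] //.
by rewrite /tri !side_mirror // -[RHS](map_inj_uniq sw_inj).
Qed.

End BtBasic.

(** * Grafting at a leaf *)

Section Graft.
Variable T : eqType.
Implicit Types (t s L : bt T) (x y i j k a b q r u v : T).

(** Grafting [Node q (Leaf a) (Leaf b)] at the leaf [b] is the inverse of removing the cherry with
    black points [a], [b] and white point [q]; both inductions on cherries are phrased with it. *)
Fixpoint graft b s t := match t with
  | Leaf v => if v == b then s else Leaf v
  | Node v L M => Node v (graft b s L) (graft b s M) end.

Lemma leaves_graft b s t :
  leaves (graft b s t) =
  flatten [seq (if v == b then leaves s else [:: v]) | v <- leaves t].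
Proof.
elim: t => [v|v L hL M hM] /=; first by rewrite cats0; case: ifP.
by rewrite hL hM map_cat flatten_cat.
Qed.

Lemma leaves_graft_cat b s t (s1 s2 : seq T) : leaves t = s1 ++ b :: s2 -> uniq (leaves t) ->
  leaves (graft b s t) = s1 ++ leaves s ++ s2.
Proof.
move=> e; rewrite leaves_graft e cat_uniq /= => /and4P[_ /norP[b1 _] b2 _].
have id c : b \notin c ->
    flatten [seq (if v == b then leaves s else [:: v]) | v <- c] = c.
  elim: c => //= v c IH; rewrite inE negb_or => /andP[nv /IH->].
  by rewrite eq_sym (negbTE nv).
by rewrite map_cat flatten_cat /= eqxx !id.
Qed.

Variables (a b q : T).
Let s := Node q (Leaf a) (Leaf b).

Lemma nodes_graft t : uniq (leaves t) -> b \in leaves t ->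
  perm_eq (nodes (graft b s t)) (q :: nodes t).
Proof.
(* With multiplicities, one [q] per occurrence of [b], the induction needs no disjointness of the
   two subtrees. *)
move=> ut bt; suff h : perm_eq (nodes (graft b s t))
    (nseq (count_mem b (leaves t)) q ++ nodes t).
  by rewrite count_uniq_mem // bt in h.
elim: t {ut bt} => [v|v L hL M hM] /=; first by rewrite eq_sym; case: ifP.
apply/permP => P; move/permP: hL => /(_ P); move/permP: hM => /(_ P).
rewrite /= !(count_cat, count_nseq) /= !(count_cat, count_nseq) mulnDr; lia.
Qed.

Lemma labels_graft t i : i != a -> i != q -> (i \in labels (graft b s t)) = (i \in labels t).
Proof.
move=> ia iq; elim: t => [v|v L hL M hM] /=; last by rewrite !inE !mem_cat hL hM.
by case: eqVneq => [->|] //=; rewrite !inE (negbTE ia) (negbTE iq).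
Qed.

Lemma labels_graft_a t : a != q -> a \notin labels t -> b \notin nodes t ->
  (a \in labels (graft b s t)) = (b \in labels t).
Proof.
move=> aq; elim: t => [v|v L hL M hM] /=.
  rewrite !inE => na _; case: eqVneq => _ /=; first by rewrite !inE !eqxx orbT.
  by rewrite inE (negbTE na).
rewrite !inE !mem_cat !negb_or => /and3P[a1 a2 a3] /and3P[b1 b2 b3].
by rewrite hL // hM // (negbTE a1) (negbTE b1).
Qed.

Lemma side_graft t x i : x != q -> i != a -> i != q ->
  side (graft b s t) x i = side t x i.
Proof.
move=> xq ia iq; elim: t => [v|v L hL M hM] /=.
  by case: eqVneq => //=; rewrite (negbTE xq).
by rewrite hL hM !labels_graft.
Qed.

Lemma side_graft_a t x : x != q -> a != q -> a \notin labels t -> b \notin nodes t ->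
  side (graft b s t) x a = side t x b.
Proof.
move=> xq aq; elim: t => [v|v L hL M hM] /=.
  by case: eqVneq => //=; rewrite (negbTE xq).
rewrite !inE !mem_cat !negb_or => /and3P[a1 a2 a3] /and3P[b1 b2 b3].
by rewrite hL // hM // !labels_graft_a.
Qed.

Lemma side_graft_q t i : q \notin labels t -> uniq (leaves t) -> b \in leaves t ->
  side (graft b s t) q i = if i == a then 1 else if i == b then 2 else 0.
Proof.
move=> qt ut bl; suff -> : side (graft b s t) q i =
    count_mem b (leaves t) * (if i == a then 1 else if i == b then 2 else 0).
  by rewrite count_uniq_mem // bl mul1n.
elim: t qt {ut bl} => [v|v L hL M hM] /=.
  rewrite inE addn0 => nq; case: eqVneq => //= _.
  by rewrite eqxx !inE mul1n.
rewrite inE mem_cat !negb_or => /and3P[/negbTE-> /hL-> /hM->].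
by rewrite count_cat mulnDl.
Qed.

End Graft.

(** * A binary tree is determined by its leaves and its separated triples *)

Section BtUnique.
Variable T : eqType.
Implicit Types (t L M : bt T) (x v i j k r : T).

Lemma side_Node v L M x i : uniq (labels (Node v L M)) ->
  side (Node v L M) x i =
  if x == v then if i \in labels L then 1%N else if i \in labels M then 2%N else 0%N
  else if x \in labels L then side L x i else side M x i.
Proof.
move=> /uniq_labelsP[uL uM vL vM d] /=; case: ifP => // _.
case: ifP => xL; last by rewrite side_notin // (contra (@nodes_sub _ _ _)) ?xL.
by rewrite [side M x i]side_notin ?addn0 // (contra (@nodes_sub _ _ _)) ?d.
Qed.

(** For a subtree the outer leaf [r] stands in for everything beyond its root: away from [v] no side
    changes, and at [v] itself the leaves of [L] share one branch and [r] lies in another, which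
    leaves no room for three branches. *)
Lemma tri_subl r v L M x i j k : uniq (r :: labels (Node v L M)) ->
  i \in r :: leaves L -> j \in r :: leaves L -> k \in r :: leaves L ->
  tri (Node v L M) x i j k = tri L x i j k.
Proof.
move=> u; have [rn /uniq_labelsP[uL uM vL vM d]] := andP u.
have u' : uniq (labels (Node v L M)) by case/andP: u.
have side_eq y : y \in r :: leaves L -> x != v ->
    side (Node v L M) x y = side L x y.
  move=> yl xv; rewrite side_Node // (negbTE xv); case: ifP => // xL.
  rewrite [RHS]side_notin ?(contra (@nodes_sub _ _ _)) ?xL //.
  apply: side_out; move: yl; rewrite inE => /predU1P[->|/leaves_sub/d//].
  by move: rn; rewrite /= inE mem_cat !negb_or => /and3P[].
move=> hi hj hk; case: (eqVneq x v) => [->|xv]; last by rewrite /tri !side_eq.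
have -> : tri L v i j k = false.
  by rewrite /tri !side_notin // (contra (@nodes_sub _ _ _)).
have sd y : y \in r :: leaves L -> side (Node v L M) v y = (y != r).
  rewrite side_Node // eqxx inE => /predU1P[->|yl].
    move: rn; rewrite /= inE mem_cat !negb_or eqxx => /and3P[_ h1 h2].
    by rewrite (negbTE h1) (negbTE h2).
  rewrite (leaves_sub yl); case: eqP yl rn => // -> rl.
  by rewrite /= inE mem_cat (leaves_sub rl) orbT.
by rewrite /tri !sd //; case: eqP; case: eqP; case: eqP.
Qed.

Lemma tri_subr r v L M x i j k : uniq (r :: labels (Node v L M)) ->
  i \in r :: leaves M -> j \in r :: leaves M -> k \in r :: leaves M ->
  tri (Node v L M) x i j k = tri M x i j k.
Proof.
move=> u; have [rn /uniq_labelsP[uL uM vL vM d]] := andP u.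
have u' : uniq (labels (Node v L M)) by case/andP: u.
have d' y : y \in labels M -> y \notin labels L.
  by move=> yM; apply/negP => /d; rewrite yM.
have side_eq y : y \in r :: leaves M -> x != v ->
    side (Node v L M) x y = side M x y.
  move=> yl xv; rewrite side_Node // (negbTE xv); case: ifP => // xL.
  rewrite [RHS]side_notin ?(contra (@nodes_sub _ _ _)) ?d //.
  apply: side_out; move: yl; rewrite inE => /predU1P[->|/leaves_sub/d'//].
  by move: rn; rewrite /= inE mem_cat !negb_or => /and3P[].
move=> hi hj hk; case: (eqVneq x v) => [->|xv]; last by rewrite /tri !side_eq.
have -> : tri M v i j k = false.
  by rewrite /tri !side_notin // (contra (@nodes_sub _ _ _)).
have sd y : y \in r :: leaves M -> side (Node v L M) v y = ((y != r).*2)%N.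
  rewrite side_Node // eqxx inE => /predU1P[->|yl].
    move: rn; rewrite /= inE mem_cat !negb_or eqxx => /and3P[_ h1 h2].
    by rewrite (negbTE h1) (negbTE h2).
  rewrite (negbTE (d' _ (leaves_sub yl))) (leaves_sub yl).
  case: eqP yl rn => // -> rl.
  by rewrite /= inE mem_cat (leaves_sub rl) !orbT.
by rewrite /tri !sd //; case: eqP; case: eqP; case: eqP.
Qed.

Lemma cat_split_eq (s1 s2 s1' s2' : seq T) : s1 ++ s2 = s1' ++ s2' ->
  uniq (s1 ++ s2) -> s1 =i s1' -> s1 = s1' /\ s2 = s2'.
Proof.
move=> e u h; have u1 : uniq s1 by move: u; rewrite cat_uniq => /and3P[].
have u1' : uniq s1' by move: u; rewrite e cat_uniq => /and3P[].
have /eqP es : size s1 == size s1' by rewrite -uniq_size_uniq.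
by move/eqP: e; rewrite eqseq_cat // => /andP[/eqP-> /eqP->].
Qed.

(** At the root [v], [r] occupies the branch of the parent and [m] the right one, so a third branch
    can only be the left one. This test recovers the split of the leaves from [tri] alone. *)
Lemma tri_top r v L M i m : uniq (r :: labels (Node v L M)) ->
  i \in leaves (Node v L M) -> m \in leaves M ->
  tri (Node v L M) v r i m = (i \in leaves L).
Proof.
move=> u il mM; have [rn un] := andP u; have [uL uM vL vM d] := uniq_labelsP un.
have dM y : y \in leaves M -> y \notin labels L.
  by move=> /leaves_sub yM; apply/negP => /d; rewrite yM.
have sr : side (Node v L M) v r = 0%N by apply: side_out.
have sm : side (Node v L M) v m = 2%N.
  by rewrite side_Node // eqxx (negbTE (dM _ mM)) leaves_sub.
rewrite /tri sr sm side_Node // eqxx.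
move: il; rewrite /= mem_cat => /orP[iL|iM]; first by rewrite iL leaves_sub.
rewrite (negbTE (dM _ iM)) (leaves_sub iM) /=; apply/esym/negbTE.
by apply/negP => /leaves_sub; apply/negP/dM.
Qed.

(** The first leaf [l] lies in both left subtrees and the last leaf [m] in both right ones. The root
    is the only node that separates [r], [l] and [m]; then [tri_top] gives the same split of the
    leaf list, and the subtrees follow with [r] again as outer leaf. *)
Lemma bt_unique r t t' : uniq (r :: labels t) -> uniq (r :: labels t') ->
  leaves t = leaves t' ->
  (forall x i j k, i \in r :: leaves t -> j \in r :: leaves t -> k \in r :: leaves t ->
     tri t x i j k = tri t' x i j k) -> t = t'.
Proof.
elim: t t' => [v|v L IHL M IHM] [v'|v' L' M'] u u' /= el ht.
- by case: el => ->.
- have := congr1 size el; rewrite /= size_cat !size_leaves; lia.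
- have := congr1 size el; rewrite /= size_cat !size_leaves; lia.
have [l [lL lL']] : exists l, l \in leaves L /\ l \in leaves L'.
  move: el (leaves_neq0 L) (leaves_neq0 L'); case: (leaves L) => // l s.
  by case: (leaves L') => // l' s' [-> _] _ _; exists l'; rewrite !mem_head.
have [m [mM mM']] : exists m, m \in leaves M /\ m \in leaves M'.
  move: el (leaves_neq0 M) (leaves_neq0 M'); case/lastP: (leaves M) => // s m.
  case/lastP: (leaves M') => // s' m'; rewrite -!rcons_cat => /rcons_inj[_ ->] _ _.
  by exists m'; rewrite !mem_rcons !mem_head.
have hl : l \in leaves L ++ leaves M by rewrite mem_cat lL.
have hm : m \in leaves L ++ leaves M by rewrite mem_cat mM orbT.
have rin : r \in r :: leaves L ++ leaves M by rewrite mem_head.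
have inr i : i \in leaves L ++ leaves M -> i \in r :: leaves L ++ leaves M.
  by move=> h; rewrite inE h orbT.
have evv : v = v'.
  have := tri_top u hl mM; rewrite lL (ht _ _ _ _ rin (inr _ hl) (inr _ hm)).
  have [rn un] := andP u'; have [uL uM vL vM d] := uniq_labelsP un.
  have sr : side (Node v' L' M') v r = 0%N by apply: side_out.
  case: (eqVneq v v') => // nv; rewrite /tri sr !side_Node // (negbTE nv).
  case: ifP => _; last first.
    by rewrite [side M' v l]side_out // d // leaves_sub.
  rewrite [side L' v m]side_out; first by rewrite /= !inE eqxx orbT.
  by apply/negP => /d; rewrite leaves_sub.
subst v'.
have [eL eM] : leaves L = leaves L' /\ leaves M = leaves M'.
  have hs i : i \in leaves L ++ leaves M -> (i \in leaves L) = (i \in leaves L').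
    move=> hi; rewrite -(tri_top u hi mM) (ht _ _ _ _ rin (inr _ hi) (inr _ hm)) (tri_top u') //.
    by rewrite /= -el.
  apply: (cat_split_eq el); first by apply: (uniq_labels_leaves (t := Node v L M)); case/andP: u.
  move=> i; apply/idP/idP => hi; first by rewrite -hs // mem_cat hi.
  by rewrite hs // el mem_cat hi.
have hsub (A A' : bt T) : {subset labels A <= labels A'} -> uniq (labels A) ->
    uniq (r :: labels A') -> uniq (r :: labels A).
  by move=> sub uA /= /andP[rA _]; rewrite uA andbT; apply: contra rA; apply: sub.
have subL (N N' : bt T) : {subset labels N <= labels (Node v N N')} by
  move=> y h; rewrite /= inE mem_cat h orbT.
have subM (N N' : bt T) : {subset labels N' <= labels (Node v N N')} by
  move=> y h; rewrite /= inE mem_cat h !orbT.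
have [uL uM _ _ _] := uniq_labelsP (proj2 (andP u)).
have [uL' uM' _ _ _] := uniq_labelsP (proj2 (andP u')).
congr Node.
  apply: IHL => //; [exact: hsub u | exact: hsub u' |].
  move=> x i j k hi hj hk; rewrite -(tri_subl x u) // ht; first last.
  - by move: hk; rewrite !inE mem_cat orbA => ->.
  - by move: hj; rewrite !inE mem_cat orbA => ->.
  - by move: hi; rewrite !inE mem_cat orbA => ->.
  by rewrite (tri_subl x u') // -eL.
apply: IHM => //; [exact: hsub u | exact: hsub u' |].
move=> x i j k hi hj hk; rewrite -(tri_subr x u) // ht; first last.
- by move: hk; rewrite !inE mem_cat => /orP[->|->]; rewrite ?orbT.
- by move: hj; rewrite !inE mem_cat => /orP[->|->]; rewrite ?orbT.
- by move: hi; rewrite !inE mem_cat => /orP[->|->]; rewrite ?orbT.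
by rewrite (tri_subr x u') // -eM.
Qed.

End BtUnique.

(** * Neighbour lists and depth *)

Section Neighbours.
Variable T : eqType.
Implicit Types (t L M : bt T) (x y z u v w r : T).

(** The order parent, left, right is the cyclic order, so [next] on this list will be [succ]. The
    two recursive lists can be concatenated because, for distinct labels, at most one of them is
    nonempty. *)
Fixpoint nb u t x : seq T := match t with
  | Leaf v => if x == v then [:: u] else [::]
  | Node v L M =>
      if x == v then [:: u; bt_root L; bt_root M] else nb v L x ++ nb v M x
  end.

Definition nbr r t x := if x == r then [:: bt_root t] else nb r t x.

Lemma nb_out u t x : x \notin labels t -> nb u t x = [::].
Proof.
elim: t u => [v|v L hL M hM] u /=; first by rewrite inE => /negbTE->.
by rewrite inE mem_cat !negb_or => /and3P[/negbTE-> h1 h2]; rewrite hL // hM.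
Qed.

Lemma nb_Node u v L M x : uniq (labels (Node v L M)) ->
  nb u (Node v L M) x =
  if x == v then [:: u; bt_root L; bt_root M] else
  if x \in labels L then nb v L x else nb v M x.
Proof.
move=> /uniq_labelsP[uL uM vL vM d] /=; case: ifP => // _.
by case: ifP => xL; [rewrite [nb v M x]nb_out ?cats0 ?d | rewrite nb_out ?xL].
Qed.

Lemma uniq_parent u v L M : uniq (u :: labels (Node v L M)) ->
  [/\ uniq (v :: labels L), uniq (v :: labels M), u != v, u \notin labels L &
      u \notin labels M].
Proof.
case/andP=> un /uniq_labelsP[uL uM vL vM d].
by move: un; rewrite /= inE mem_cat !negb_or vL vM uL uM => /and3P[].
Qed.

Lemma nb_sub u t x y : y \in nb u t x -> y \in u :: labels t.
Proof.
elim: t u => [v|v L hL M hM] u /=.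
  by case: ifP => // _; rewrite inE => /eqP->; rewrite mem_head.
case: ifP => _; last first.
  by rewrite mem_cat => /orP[/hL|/hM]; rewrite !inE mem_cat => /orP[]->; rewrite ?orbT.
rewrite !inE mem_cat => /or3P[]/eqP->; first by rewrite eqxx.
  by rewrite bt_root_labels !orbT.
by rewrite bt_root_labels !orbT.
Qed.

Lemma nb_root u t : uniq (u :: labels t) -> u \in nb u t (bt_root t).
Proof. by case: t => [v|v L M] /=; rewrite eqxx mem_head. Qed.

Lemma nb_sym u t x y : uniq (u :: labels t) -> x \in labels t -> y \in nb u t x ->
  y = u /\ x = bt_root t \/ y \in labels t /\ x \in nb u t y.
Proof.
elim: t u => [v|v L hL M hM] u ut.
  by rewrite inE => /eqP->; rewrite /= eqxx inE => /eqP->; left.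
have [_ uv] := andP ut; have [vL vM _ _ _] := uniq_parent ut.
have [uL uM nvL nvM d] := uniq_labelsP uv.
have d' y' : y' \in labels M -> y' \notin labels L.
  by move=> h; apply/negP => /d; rewrite h.
have nv y' : y' \in labels L \/ y' \in labels M -> y' == v = false.
  by move=> h; apply: contraTF (introT orP h) => /eqP->; rewrite negb_or nvL.
have mL z : z \in labels L -> z \in labels (Node v L M) by
  move=> h; rewrite /= inE mem_cat h orbT.
have mM z : z \in labels M -> z \in labels (Node v L M) by
  move=> h; rewrite /= inE mem_cat h !orbT.
rewrite {1}[labels _]/= inE mem_cat => /or3P[/eqP->|xL|xM]; rewrite nb_Node //.
- rewrite eqxx !inE => /or3P[]/eqP->; first by left.
    right; split; first by apply/mL/bt_root_labels.
    rewrite nb_Node // nv; last by left; apply: bt_root_labels.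
    by rewrite bt_root_labels; apply: nb_root.
  right; split; first by apply/mM/bt_root_labels.
  rewrite nb_Node // nv; last by right; apply: bt_root_labels.
  by rewrite (negbTE (d' _ _)) ?bt_root_labels //; apply: nb_root.
- rewrite nv ?xL; last by left.
  case/(hL _ vL xL) => [[-> ->]|[yL hy]]; right.
    by split; rewrite ?nb_Node // ?eqxx !inE eqxx ?orbT.
  by split; [exact: mL | rewrite nb_Node // nv ?yL //; left].
rewrite nv ?(negbTE (d' _ xM)); last by right.
case/(hM _ vM xM) => [[-> ->]|[yM hy]]; right.
  by split; rewrite ?nb_Node // ?eqxx !inE eqxx ?orbT.
by split; [exact: mM | rewrite nb_Node // nv ?(negbTE (d' _ yM)) //; right].
Qed.

Lemma nb_leaf u t x : uniq (u :: labels t) -> x \in leaves t ->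
  exists y, nb u t x = [:: y].
Proof.
elim: t u => [v|v L hL M hM] u ut.
  by rewrite inE => /eqP-> /=; rewrite eqxx; exists u.
have [_ uv] := andP ut; have [vL vM _ _ _] := uniq_parent ut.
have [uL uM nvL nvM d] := uniq_labelsP uv.
rewrite [leaves _]/= mem_cat nb_Node // => /orP[xL|xM].
  have xL' := leaves_sub xL; rewrite xL'; case: eqP => [e|_]; last exact: hL.
  by rewrite -e xL' in nvL.
have xM' := leaves_sub xM; case: eqP => [e|_]; first by rewrite -e xM' in nvM.
by case: ifP => [/d|_]; [rewrite xM' | exact: hM].
Qed.

Lemma nb_node u t x : uniq (u :: labels t) -> x \in nodes t ->
  exists a b c, nb u t x = [:: a; b; c] /\
   [/\ side t x a = 0, side t x b = 1 & side t x c = 2].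
Proof.
elim: t u => [v|v L hL M hM] u ut //.
have [nu uv] := andP ut; have [vL vM _ _ _] := uniq_parent ut.
have [uL uM nvL nvM d] := uniq_labelsP uv.
rewrite inE mem_cat => /or3P[/eqP->|xL|xM].
- rewrite nb_Node // eqxx; exists u, (bt_root L), (bt_root M); split=> //.
  split; first exact: side_out.
    by rewrite side_Node // eqxx bt_root_labels.
  rewrite side_Node // eqxx bt_root_labels.
  by case: ifP => // /d; rewrite bt_root_labels.
- have xL' := nodes_sub xL; have nx : (x == v) = false.
    by apply: contraTF xL' => /eqP->.
  have [a [b [c [e h]]]] := hL _ vL xL; exists a, b, c.
  by rewrite nb_Node // nx xL' !side_Node // nx xL'.
have xM' := nodes_sub xM; have nx : (x == v) = false.
  by apply: contraTF xM' => /eqP->.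
have xL : x \in labels L = false by apply/negbTE/negP => /d; rewrite xM'.
have [a [b [c [e h]]]] := hM _ vM xM; exists a, b, c.
by rewrite nb_Node // nx xL !side_Node // nx xL.
Qed.

Lemma side_root u t x : uniq (u :: labels t) -> side t x (bt_root t) = 0.
Proof.
case: t => //= v L M ut; have [_ uv] := andP ut.
have [uL uM nvL nvM d] := uniq_labelsP uv.
by rewrite (negbTE nvL) (negbTE nvM) !side_out ?if_same.
Qed.

(** An edge that avoids [x] stays within one branch at [x]. This turns paths in the tree into
    statements on [side]. *)
Lemma side_nb u t x y z : uniq (u :: labels t) -> y \in labels t -> z \in nb u t y ->
  y != x -> z != x -> side t x y = side t x z.
Proof.
elim: t u => [v|v L hL M hM] u ut //.
have [nu uv] := andP ut; have [vL vM nuv nuL nuM] := uniq_parent ut.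
have [uL uM nvL nvM d] := uniq_labelsP uv.
have d' y' : y' \in labels M -> y' \notin labels L.
  by move=> h; apply/negP => /d; rewrite h.
rewrite {1}[labels _]/= inE mem_cat => /or3P[/eqP->|yL|yM]; rewrite nb_Node // => hz nyx nzx.
- have -> : side (Node v L M) x v = 0 by apply: (side_root _ ut).
  move: hz nzx; rewrite eqxx !inE => /or3P[]/eqP-> nzx.
  + by rewrite side_out.
  + rewrite side_Node // eq_sym (negbTE nyx) (side_root _ vL).
    by rewrite [side M _ _]side_out ?if_same // d // bt_root_labels.
  rewrite side_Node // eq_sym (negbTE nyx) (side_root _ vM).
  by rewrite [side L _ _]side_out ?if_same // d' // bt_root_labels.
- have nyv : (y == v) = false by apply: contraTF yL => /eqP->.
  move: hz; rewrite nyv yL => hz; rewrite !side_Node //.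
  have := nb_sub hz; rewrite inE => zv.
  case: (eqVneq x v) => [ex|nxv].
    by move: zv; rewrite -ex (negbTE nzx) yL /= => ->.
  case: ifP => _; first by apply: hL vL yL hz nyx nzx.
  have zM : z \notin labels M by case/orP: zv => [/eqP->|/d].
  by rewrite (side_out _ zM) side_out ?d.
have nyv : (y == v) = false by apply: contraTF yM => /eqP->.
have yL := negbTE (d' _ yM).
move: hz; rewrite nyv yL => hz; rewrite !side_Node //.
have := nb_sub hz; rewrite inE => zv.
case: (eqVneq x v) => [ex|nxv].
  move: zv; rewrite -ex (negbTE nzx) yL yM /= => zM.
  by rewrite zM (negbTE (d' _ zM)).
case: ifP => _; last by apply: hM vM yM hz nyx nzx.
have zL : z \notin labels L by case/orP: zv => [/eqP->|/d'].
by rewrite (side_out _ zL) side_out ?yL.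
Qed.

Fixpoint depth t x := match t with
  | Leaf _ => 0
  | Node v L M =>
      if x == v then 0 else if x \in labels L then (depth L x).+1 else (depth M x).+1
  end.

(** The exceptional neighbour is the parent, every other one being a child. A potential that
    increases towards all neighbours but one is what rules out cycles later. *)
Lemma nb_depth u t x : uniq (u :: labels t) -> x \in labels t ->
  exists2 y, y \in nb u t x & forall z, z \in nb u t x -> z = y \/
    z \in labels t /\ depth t x < depth t z.
Proof.
elim: t u => [v|v L hL M hM] u ut.
  rewrite inE => /eqP->; exists u; rewrite /= eqxx ?mem_head // => z.
  by rewrite inE => /eqP; left.
have [nu uv] := andP ut; have [vL vM nuv nuL nuM] := uniq_parent ut.
have [uL uM nvL nvM d] := uniq_labelsP uv.
have d' y' : y' \in labels M -> y' \notin labels L.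
  by move=> h; apply/negP => /d; rewrite h.
have nv y' : y' \in labels L \/ y' \in labels M -> y' == v = false.
  by move=> h; apply: contraTF (introT orP h) => /eqP->; rewrite negb_or nvL.
rewrite {1}[labels _]/= inE mem_cat => /or3P[/eqP->|xL|xM]; rewrite nb_Node //.
- rewrite eqxx; exists u => [|z]; first by rewrite mem_head.
  rewrite !inE => /or3P[]/eqP->; first by left.
    right; split; first by rewrite mem_cat bt_root_labels orbT.
    by rewrite /= eqxx nv; [case: ifP | left; apply: bt_root_labels].
  right; split; first by rewrite mem_cat bt_root_labels !orbT.
  by rewrite /= eqxx nv; [case: ifP | right; apply: bt_root_labels].
- rewrite nv ?xL; last by left.
  have [y hy h] := hL _ vL xL; exists y => // z /h[->|[zL hz]]; first by left.
  right; split; first by rewrite /= inE mem_cat zL orbT.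
  by rewrite /= !nv ?xL ?zL //; left.
rewrite nv ?(negbTE (d' _ xM)); last by right.
have [y hy h] := hM _ vM xM; exists y => // z /h[->|[zM hz]]; first by left.
right; split; first by rewrite /= inE mem_cat zM !orbT.
by rewrite /= !nv ?(negbTE (d' _ xM)) ?(negbTE (d' _ zM)) //; right.
Qed.

Lemma nb_irr u t x : uniq (u :: labels t) -> x \in labels t -> x \notin nb u t x.
Proof.
elim: t u => [v|v L hL M hM] u ut.
  move: ut; rewrite /= !inE => /andP[nu _] /eqP->.
  by rewrite eqxx inE eq_sym.
have [nu uv] := andP ut; have [vL vM nuv nuL nuM] := uniq_parent ut.
have [uL uM nvL nvM d] := uniq_labelsP uv.
rewrite {1}[labels _]/= inE mem_cat nb_Node //; case: eqP => [-> _|_ /= xin].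
  rewrite !inE !negb_or eq_sym nuv /=; apply/andP; split.
    by apply: contraNneq nvL => ->; apply: bt_root_labels.
  by apply: contraNneq nvM => ->; apply: bt_root_labels.
by case: ifP xin => [xL _|_ /= xM]; [apply: hL | apply: hM].
Qed.

Definition swap_tail (s : seq T) := match s with
  | [:: a; b; c] => [:: a; c; b] | _ => s end.

Lemma bt_root_mirror t : bt_root (mirror t) = bt_root t.
Proof. by case: t. Qed.

Lemma nb_mirror u t x : uniq (u :: labels t) ->
  nb u (mirror t) x = swap_tail (nb u t x).
Proof.
elim: t u => [v|v L hL M hM] u ut; first by rewrite /=; case: ifP.
have [nu uv] := andP ut; have [vL vM nuv nuL nuM] := uniq_parent ut.
have [uL uM nvL nvM d] := uniq_labelsP uv.
rewrite nb_Node // [nb u _ x]/=; case: ifP => _; first by rewrite !bt_root_mirror.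
rewrite hL // hM //; case: ifP => xL; first by rewrite [nb v M x]nb_out ?d.
by rewrite [nb v L x]nb_out ?xL // cats0.
Qed.

End Neighbours.

Section BtMap.
Variables (T T' : eqType) (f : T -> T').
Hypothesis f_inj : injective f.

Fixpoint bt_map t := match t with
  | Leaf v => Leaf (f v) | Node v L M => Node (f v) (bt_map L) (bt_map M) end.

Lemma leaves_map t : leaves (bt_map t) = map f (leaves t).
Proof. by elim: t => //= v L -> M ->; rewrite map_cat. Qed.

Lemma nodes_map t : nodes (bt_map t) = map f (nodes t).
Proof. by elim: t => //= v L -> M ->; rewrite map_cat. Qed.

Lemma labels_map t : labels (bt_map t) = map f (labels t).
Proof. by elim: t => //= v L -> M ->; rewrite map_cat. Qed.

Lemma bt_root_map t : bt_root (bt_map t) = f (bt_root t).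
Proof. by case: t. Qed.

Lemma side_map t x i : side (bt_map t) (f x) (f i) = side t x i.
Proof.
by elim: t => //= v L -> M ->; rewrite (inj_eq f_inj) !labels_map !mem_map.
Qed.

Lemma tri_map t x i j k : tri (bt_map t) (f x) (f i) (f j) (f k) = tri t x i j k.
Proof. by rewrite /tri !side_map. Qed.

Lemma nb_map u t x : nb (f u) (bt_map t) (f x) = map f (nb u t x).
Proof.
elim: t u => [v|v L hL M hM] u /=; rewrite (inj_eq f_inj); first by case: ifP.
by rewrite hL hM !bt_root_map -map_cat; case: ifP.
Qed.

Lemma nbr_map r t x : nbr (f r) (bt_map t) (f x) = map f (nbr r t x).
Proof. by rewrite /nbr (inj_eq f_inj) nb_map bt_root_map; case: ifP. Qed.

End BtMap.

(** * 3-trees as rooted binary trees *)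

Section Unfolding.
Variable G : tree3.
Implicit Types (u v w x y : G) (t L M : bt G) (s : seq G).

(** The part of [G] behind the directed edge from [u] to the root of [t]: at each node the children
    are taken in the order given by [succ], starting after the parent. *)
Fixpoint unfolding u t : Prop := match t with
  | Leaf v => adj u v /\ leaf v
  | Node v L M => [/\ adj u v, trivalent v, bt_root L = succ v u,
      bt_root M = succ v (succ v u) & unfolding v L /\ unfolding v M]
  end.

Lemma unfolding_adj u t : unfolding u t -> adj u (bt_root t).
Proof. by case: t => [v []|v L M []]. Qed.

Lemma trivalent_leaf v : trivalent v -> leaf v = false.
Proof. by rewrite /trivalent /leaf => /eqP->. Qed.

(** An injection of three neighbours without fixed point is a 3-cycle: if it exchanged two of them,
    the image of the third would have to be a fourth neighbour. *)
Lemma succ3 u v : trivalent v -> adj v u ->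
  [/\ uniq [:: u; succ v u; succ v (succ v u)],
      adj v =i [:: u; succ v u; succ v (succ v u)] &
      succ v (succ v (succ v u)) = u].
Proof.
move=> /eqP tv vu; set a := succ v u; set b := succ v a.
have va : adj v a by apply: succ_adj.
have vb : adj v b by apply: succ_adj.
have au : a != u by apply: succ_neq.
have ba : b != a by apply: succ_neq.
have nbu : b != u.
  apply/eqP => bu.
  have [z [vz zu za]] : exists z, [/\ adj v z, z != u & z != a].
    have : (0 < #|[predD1 [predD1 (adj v) & u] & a]|).
      have := cardD1 u (adj v); rewrite tv [u \in _]vu.
      have := cardD1 a [predD1 (adj v) & u]; rewrite !inE au [a \in _]va => ->.
      by case: #|_|.
    case/card_gt0P => z; rewrite !inE => /and3P[h1 h2 h3].
    by exists z.
  have vsz := succ_adj tv vz; have sz := succ_neq tv vz.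
  have szu : succ v z != u.
    apply: contra za => /eqP e; apply/eqP.
    by apply: (succ_inj tv) => //; rewrite e -/b bu.
  have sza : succ v z != a.
    by apply: contra zu => /eqP e; apply/eqP; apply: (succ_inj tv).
  have us : uniq [:: u; a; z; succ v z].
    by rewrite /= !inE !negb_or eq_sym au eq_sym zu eq_sym szu eq_sym za eq_sym sza eq_sym sz.
  have : #|[:: u; a; z; succ v z]| <= #|adj v|.
    by apply/subset_leq_card/fintype.subsetP => y; rewrite !inE => /or4P[]/eqP->.
  by rewrite tv (card_uniqP us).
have us : uniq [:: u; a; b].
  by rewrite /= !inE !negb_or eq_sym au eq_sym nbu eq_sym ba.
have sub : [:: u; a; b] \subset adj v.
  by apply/fintype.subsetP => y; rewrite !inE => /or3P[]/eqP->.
have eqi : [:: u; a; b] =i adj v.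
  by apply/subset_cardP => //; rewrite (card_uniqP us) tv.
split; [by [] | by move=> y; rewrite eqi |].
have sbb := succ_neq tv vb; have : succ v b \in [:: u; a; b] by rewrite eqi; apply: succ_adj.
rewrite !inE => /or3P[/eqP //|/eqP e|/eqP e]; last by rewrite e eqxx in sbb.
by case/eqP: nbu; apply: (succ_inj tv).
Qed.

Fixpoint nbwalk s : bool := match s with
  | a :: s' => (if s' is b :: s'' then
       adj a b && (if s'' is c :: _ then a != c else true) && nbwalk s' else true)
  | [::] => true end.

Lemma nbwalk_cons2 a b s : nbwalk (a :: b :: s) ->
  [/\ adj a b, a != head b s \/ s = [::] & nbwalk (b :: s)].
Proof.
move=> /= /andP[/andP[ab hc] h]; split=> //.
by case: s hc {h} => [|c s] hc; [right | left].
Qed.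

Lemma nbwalk_path a s : nbwalk (a :: s) -> path (@adj G) a s.
Proof.
by elim: s a => //= b s IH a /andP[/andP[-> _] h] /=; apply: IH.
Qed.

(* A walk in a tree that never turns back cannot revisit a vertex: the first
   repetition would close a cycle. *)
Lemma nbwalk_uniq s : nbwalk s -> uniq s.
Proof.
elim: s => // a s IH h; have hs : nbwalk s by case: s h {IH} => [|b s] //= /andP[].
rewrite /= IH // andbT; apply/negP => ain.
case/splitPr: ain h hs IH => s1 s2 h hs IH.
have u := IH hs; have pa := nbwalk_path h.
have na : a \notin s1.
  by move: u; rewrite cat_uniq /= => /and3P[_ /norP[]].
apply: (@tree_acyclic G (a :: s1)).
  case: s1 h pa {hs IH u na} => [|b [|c s1]] //= /andP[/andP[]].
    by rewrite adj_irr.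
  by rewrite eqxx.
rewrite /ucycle /= na; move: u; rewrite cat_uniq => /andP[-> _].
by move: pa; rewrite cat_path rcons_path /= => /and3P[-> ->].
Qed.

(** The only new turn is at [a], and it is no return because the two first steps differ. *)
Lemma nbwalk_catrev a s1 s2 : nbwalk (a :: s1) -> nbwalk (a :: s2) ->
  s1 = [::] \/ s2 = [::] \/ head a s1 != head a s2 -> nbwalk (catrev s1 (a :: s2)).
Proof.
elim: s1 a s2 => [|b s1 IH] a s2 // h1 h2 hd.
have [ab hb h1'] := nbwalk_cons2 h1; apply: (IH b (a :: s2)) => //.
  rewrite /= adj_sym ab -[X in _ && X]/(nbwalk (a :: s2)) h2 andbT.
  by case: s2 {h2} hd => [|c s2] //= [|[]].
case: hb => [hb|->]; last by left.
case: s1 hb {IH h1 h1' hd} => [|c s1] /= hb; first by left.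
by right; right; rewrite eq_sym.
Qed.

Lemma unfolding_walk u t x : unfolding u t -> x \in labels t ->
  exists s, nbwalk [:: u, bt_root t & s] /\ last (bt_root t) s = x.
Proof.
elim: t u => [v|v L hL M hM] u /=.
  by case=> uv lv; rewrite inE => /eqP->; exists [::]; rewrite /= uv.
case=> uv tv eL eM [uL uM];
have vu : adj v u by rewrite adj_sym.
have [us _ _] := succ3 tv vu; move: us => /=; rewrite !inE !negb_or -eM -eL => /andP[/andP[nL nM] _].
rewrite mem_cat => /or3P[/eqP->|/(hL _ uL)|/(hM _ uM)].
- by exists [::]; rewrite /= uv.
- case=> s [hw hl]; exists (bt_root L :: s); split=> //.
  by move: hw => /= ->; rewrite uv nL.
case=> s [hw hl]; exists (bt_root M :: s); split=> //.
by move: hw => /= ->; rewrite uv nM.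
Qed.

(** A label common to both subtrees of [v] is reached from [v] by two walks with different first
    steps; joined at [v] they visit it twice, against [nbwalk_uniq]. *)
Lemma unfolding_uniq u t : unfolding u t -> uniq (u :: labels t).
Proof.
have out u' t' : unfolding u' t' -> u' \notin labels t'.
  move=> h; apply/negP => /(unfolding_walk h)[s [/nbwalk_uniq]] /= /andP[nu _] hl.
  by move: nu; rewrite -{1}hl mem_last.
elim: t u => [v|v L hL M hM] u hu; first by rewrite cons_uniq out.
rewrite cons_uniq out //; have [uv tv eL eM [uL uM]] := hu.
have := hL _ uL; rewrite cons_uniq => /andP[vL uqL].
have := hM _ uM; rewrite cons_uniq => /andP[vM uqM].
rewrite /= mem_cat negb_or vL vM cat_uniq uqL uqM !andbT /=.
apply/hasPn => x xM; apply/negP => xL.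
have [s1 [w1 l1]] := unfolding_walk uL xL; have [s2 [w2 l2]] := unfolding_walk uM xM.
have vu : adj v u by rewrite adj_sym.
have [us _ _] := succ3 tv vu; move: us => /=; rewrite !inE !negb_or -eM -eL => /and3P[_ nLM _].
have /nbwalk_uniq : nbwalk (catrev (bt_root L :: s1) (v :: bt_root M :: s2)).
  by apply: nbwalk_catrev => //; right; right.
rewrite catrevE cat_uniq => /and3P[_ /hasPn hd _].
have x1 : x \in bt_root L :: s1 by rewrite -l1 mem_last.
have x2 : x \in v :: bt_root M :: s2 by rewrite inE -l2 mem_last orbT.
by move: (hd x x2); rewrite /= mem_rev x1.
Qed.

Lemma unfolding_adj_nb u t x : unfolding u t -> x \in labels t -> adj x =i nb u t x.
Proof.
move=> hu; have := unfolding_uniq hu; elim: t u hu => [v|v L hL M hM] u hu uq.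
  rewrite inE => /eqP->; case: hu => uv lv y; rewrite /= eqxx inE.
  have vu : adj v u by rewrite adj_sym.
  have sub : [:: u] \subset adj v by apply/fintype.subsetP => z; rewrite inE => /eqP->.
  have e : [:: u] =i adj v by apply/subset_cardP; rewrite // (card_uniqP _) // (eqP lv).
  by rewrite -e inE.
have [uv tv eL eM [uL uM]] := hu; have [_ uq'] := andP uq.
have [vL vM _ _ _] := uniq_parent uq; have [qL qM nvL nvM d] := uniq_labelsP uq'.
rewrite {1}[labels _]/= inE mem_cat => xin y; rewrite nb_Node //.
case: eqP xin => [-> _|_ /= xin].
  have vu : adj v u by rewrite adj_sym.
  by have [_ e _] := succ3 tv vu; rewrite eL eM; apply: e.
case: ifP xin => [xL _|_ /= xM]; first exact: hL.
exact: hM.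
Qed.

Lemma unfolding_succ u t x w : unfolding u t -> x \in labels t -> trivalent x ->
  adj x w -> succ x w = next (nb u t x) w.
Proof.
move=> hu; have := unfolding_uniq hu; elim: t u hu => [v|v L hL M hM] u hu uq.
  by rewrite inE => /eqP->; case: hu => uv lv /trivalent_leaf; rewrite lv.
have [uv tv eL eM [uL uM]] := hu; have [_ uq'] := andP uq.
have [vL vM _ _ _] := uniq_parent uq; have [qL qM nvL nvM d] := uniq_labelsP uq'.
rewrite {1}[labels _]/= inE mem_cat => xin tx xw; rewrite nb_Node //.
case: eqP xin xw => [-> _|_ /= xin xw].
  have vu : adj v u by rewrite adj_sym.
  have [us e s3] := succ3 tv vu.
  rewrite [adj v w]e eL eM; move: us s3 => /=; rewrite !inE !negb_or andbT.
  set a := succ v u; set b := succ v a => /andP[/andP[h1 h2] h3] s3.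
  case/or3P=> /eqP->; first by rewrite eqxx.
    by rewrite eq_sym (negbTE h1) eqxx.
  by rewrite eq_sym (negbTE h2) eq_sym (negbTE h3) eqxx.
case: ifP xin => [xL _|_ /= xM]; first exact: hL.
exact: hM.
Qed.

End Unfolding.

Section Rooted.
Variable G : tree3.
Implicit Types (u v w x y r : G) (t L M : bt G) (s : seq G).

Lemma leaf_or_trivalent v : leaf v || trivalent v.
Proof. exact: tree_deg. Qed.

(** Recursion on fuel: the walk already made grows with each step, and since it never repeats a
    vertex it cannot outgrow [G]. *)
Lemma unfolding_exists u v : adj u v -> exists2 t, unfolding u t & bt_root t = v.
Proof.
move=> uv; suff [n [s [h1 h2]]] : exists n s, nbwalk [:: v, u & s] /\
    #|G| < n + size [:: v, u & s].
  elim: n u v s {uv} h1 h2 => [|n IH] u v s hw hn.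
    have := nbwalk_uniq hw => /card_uniqP e; move: hn; rewrite add0n -e.
    by rewrite ltnNge max_card.
  have [vu _ _] := nbwalk_cons2 hw.
  case/orP: (leaf_or_trivalent v) => hv.
    by exists (Leaf v); rewrite //= adj_sym.
  have [us e _] := succ3 hv vu.
  have vs w : w \in [:: u; succ v u; succ v (succ v u)] -> adj v w by rewrite -e.
  move: us; rewrite /= !inE !negb_or => /andP[/andP[n1 n2] _].
  have step w : adj v w -> u != w -> exists2 t, unfolding v t & bt_root t = w.
    move=> vw uw; apply: (IH v w (u :: s)); last by move: hn; rewrite /= addSnnS.
    by move: hw => /= ->; rewrite adj_sym vw eq_sym uw.
  have [|L hL rL] := step (succ v u) _ n1; first by rewrite vs // !inE eqxx ?orbT.
  have [|M hM rM] := step (succ v (succ v u)) _ n2; first by rewrite vs // !inE eqxx ?orbT.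
  by exists (Node v L M) => //=; rewrite adj_sym.
by exists #|G|, [::]; rewrite /= adj_sym uv addn2; split.
Qed.

Lemma unfolding_leaves u t x : unfolding u t -> x \in leaves t -> leaf x.
Proof.
elim: t u => [v|v L hL M hM] u; first by rewrite inE => -[_ h] /eqP->.
by case=> _ _ _ _ [uL uM]; rewrite mem_cat => /orP[/(hL _ uL)|/(hM _ uM)].
Qed.

Lemma unfolding_nodes u t x : unfolding u t -> x \in nodes t -> trivalent x.
Proof.
elim: t u => [v|v L hL M hM] u //; case=> _ tv _ _ [uL uM].
by rewrite inE mem_cat => /or3P[/eqP->//|/(hL _ uL)|/(hM _ uM)].
Qed.

Definition rooted r t : Prop := leaf r /\ unfolding r t.

Lemma rooted_exists r : leaf r -> exists t, rooted r t.
Proof.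
move=> lr; have : 0 < #|adj r| by rewrite (eqP lr).
case/card_gt0P => v hv; have [t ht _] := unfolding_exists hv.
by exists t.
Qed.

Lemma leaf_exists : exists r : G, leaf r.
Proof.
have /card_gt0P[v _] := vert_gt0 G.
have : 0 < #|adj v| by case/orP: (tree_deg v) => /eqP->.
case/card_gt0P => w hw; have [t ht _] := unfolding_exists hw.
case e : (leaves t) (leaves_neq0 t) => [|r s] // _; exists r.
by apply: (unfolding_leaves ht); rewrite e mem_head.
Qed.

Variables (r : G) (t : bt G).
Hypothesis hr : rooted r t.

Lemma rooted_uniq : uniq (r :: labels t).
Proof. exact: unfolding_uniq hr.2. Qed.

Lemma rooted_adj_nbr x : x \in r :: labels t -> adj x =i nbr r t x.
Proof.
have [lr ht] := hr; rewrite /nbr inE; case: (eqVneq x r) => [-> _|_ /= xt].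
  have ra := unfolding_adj ht.
  have sub : [:: bt_root t] \subset adj r.
    by apply/fintype.subsetP => z; rewrite inE => /eqP->.
  have e : [:: bt_root t] =i adj r.
    by apply/subset_cardP; rewrite // (card_uniqP _) // (eqP lr).
  by move=> y; rewrite -e.
exact: unfolding_adj_nb ht xt.
Qed.

Lemma rooted_all x : x \in r :: labels t.
Proof.
have step y z : y \in r :: labels t -> adj y z -> z \in r :: labels t.
  move=> yr yz; have : z \in nbr r t y by rewrite -rooted_adj_nbr.
  rewrite /nbr; case: ifP => _; last exact: nb_sub.
  by rewrite inE => /eqP->; rewrite inE bt_root_labels orbT.
have /connectP[s] := tree_connected r x.
elim: s {1 3 4}r (mem_head r (labels t)) => [|y s IH] z zr /=; first by move=> _ ->.
by case/andP=> zy; apply: IH; apply: step zy.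
Qed.

Lemma rooted_adj x y : adj x y = (y \in nbr r t x).
Proof. by rewrite -rooted_adj_nbr // rooted_all. Qed.

Lemma rooted_leaf x : leaf x = (x \in r :: leaves t).
Proof.
have [lr ht] := hr; rewrite inE; case: eqP => [->|/eqP nx] /=; first by rewrite lr.
have := rooted_all x; rewrite inE (negbTE nx) /= mem_labels mem_cat => /orP[xl|xn].
  by rewrite xl (unfolding_leaves ht).
rewrite (trivalent_leaf (unfolding_nodes ht xn)); apply/esym/negbTE.
apply: contraL xn; apply: leaf_notin_nodes.
by case/andP: rooted_uniq.
Qed.

Lemma rooted_trivalent x : trivalent x = (x \in nodes t).
Proof.
have [lr ht] := hr; apply/idP/idP => [tx|]; last exact: unfolding_nodes ht.
have := rooted_all x; rewrite inE mem_labels mem_cat orbA -in_cons -rooted_leaf.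
by rewrite trivalent_leaf.
Qed.

Lemma rooted_succ x w : trivalent x -> adj x w -> succ x w = next (nbr r t x) w.
Proof.
move=> tx xw; have [lr ht] := hr; rewrite /nbr; case: eqP => [e|_].
  by move: tx => /trivalent_leaf; rewrite e lr.
apply: (unfolding_succ ht _ tx xw); apply: nodes_sub.
by rewrite -rooted_trivalent.
Qed.

Lemma rooted_side_adj u x y : adj x y -> x != u -> y != u -> side t u x = side t u y.
Proof.
have uq := rooted_uniq; have [_ ul] := andP uq.
have key x' y' : x' != r -> adj x' y' -> x' != u -> y' != u -> side t u x' = side t u y'.
  move=> nx xy xu yu; have := rooted_all x'; rewrite inE (negbTE nx) /= => xl.
  apply: (side_nb uq xl _ xu yu); move: xy; rewrite rooted_adj /nbr.
  by rewrite (negbTE nx).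
move=> xy xu yu; case: (eqVneq x r) => [ex|nx]; last exact: key.
case: (eqVneq y r) => [ey|ny]; first by rewrite ex ey.
by apply/esym/key => //; rewrite adj_sym.
Qed.

Lemma rooted_side_inj u x y : trivalent u -> adj u x -> adj u y ->
  side t u x = side t u y -> x = y.
Proof.
rewrite rooted_trivalent !rooted_adj /nbr => un.
case: eqP => [e|_].
  have /andP[] := rooted_uniq; by rewrite -e (nodes_sub un).
have [a [b [c [-> [h1 h2 h3]]]]] := nb_node rooted_uniq un.
by rewrite !inE => /or3P[]/eqP-> /or3P[]/eqP->; rewrite ?h1 ?h2 ?h3.
Qed.

Lemma path_side u x s : path (@adj G) x s -> u \notin x :: s ->
  {in x :: s, forall y, side t u y = side t u x}.
Proof.
elim: s x => [|z s IH] x /=; first by move=> _ _ y; rewrite inE => /eqP->.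
rewrite inE negb_or => /andP[xz hs] /andP[ux us] y.
rewrite inE => /predU1P[->//|ys]; rewrite (IH z hs us y ys).
apply/esym/rooted_side_adj => //; first by rewrite eq_sym.
by move: us; rewrite inE negb_or eq_sym => /andP[].
Qed.

(** After its first step a simple path from [u] stays in one branch at [u], and each branch contains
    a single neighbour of [u]. So disjoint paths enter different branches, and paths in different
    branches are disjoint. *)
Lemma tripod_tri u x y z : trivalent u -> leaf x -> leaf y -> leaf z ->
  tripod u x y z <-> tri t u x y z.
Proof.
move=> tu lx ly lz.
have nul v : leaf v -> u != v by apply: contraTneq => <-; rewrite trivalent_leaf.
split.
  case=> p1 [p2 [p3 [[h1 h2 h3] [d12 d13 d23]]]].
  have start v p : leaf v -> simple_path u v p ->
      exists2 w, w \in p & adj u w /\ side t u v = side t u w.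
    move=> lv [pp up ep]; case: p pp up ep => [|w p] /=.
      by move=> _ _ e; case/eqP: (nul v lv).
    case/andP=> uw pp /andP[un _] ep; exists w; first by rewrite mem_head.
    by split=> //; rewrite (path_side pp un) // -ep mem_last.
  have neq v v' p p' : leaf v -> leaf v' -> simple_path u v p -> simple_path u v' p' ->
      ~~ has (mem p) p' -> side t u v != side t u v'.
    move=> lv lv' hp hp' /hasPn d; have [w wp [uw e]] := start _ _ lv hp.
    have [w' wp' [uw' e']] := start _ _ lv' hp'; rewrite e e'.
    by apply/eqP => /(rooted_side_inj tu uw uw') ww; have := d _ wp'; rewrite -ww /= wp.
  rewrite /tri /= !inE !negb_or !andbT.
  by rewrite (neq _ _ _ _ lx ly h1 h2) // (neq _ _ _ _ lx lz h1 h3) // (neq _ _ _ _ ly lz h2 h3).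
rewrite /tri /= !inE !negb_or !andbT => /andP[/andP[xy xz] yz].
have ex v : leaf v -> exists2 p, simple_path u v p & {in p, forall w, side t u w = side t u v}.
  move=> lv; have /connectP[p0 hp0 ev] := tree_connected u v.
  case: (shortenP hp0) ev => p hp up _ ev; exists p; first by split.
  case: p hp up ev => [|w p] //= /andP[uw pp] /andP[un _] ev w' w'p.
  by rewrite (path_side pp un w'p) ev (path_side pp un) // mem_last.
have [p1 h1 e1] := ex x lx; have [p2 h2 e2] := ex y ly; have [p3 h3 e3] := ex z lz.
exists p1, p2, p3; split=> //; split; apply/hasPn => w wp; apply/negP => /= wp'.
- by move: xy; rewrite -(e1 _ wp') (e2 _ wp) eqxx.
- by move: xz; rewrite -(e1 _ wp') (e3 _ wp) eqxx.
by move: yz; rewrite -(e2 _ wp') (e3 _ wp) eqxx.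
Qed.

(** The Euler tour of the part behind the edge from [u], in the order of [walk_step]. The final
    return to [u] is left out and supplied by the caller, so that the pieces concatenate. *)
Fixpoint darts u t' : seq (G * G) := match t' with
  | Leaf v => [:: (u, v)]
  | Node v L M =>
      (u, v) :: darts v L ++ (bt_root L, v) :: darts v M ++ [:: (bt_root M, v)]
  end.

Definition tour := (bt_root t, r) :: darts r t.

Lemma darts_path u t' d : unfolding u t' ->
  walk_step d = (u, bt_root t') -> fpath (@walk_step G) d (darts u t') /\
  walk_step (last d (darts u t')) = (bt_root t', u).
Proof.
elim: t' u d => [v|v L hL M hM] u d /=.
  by case=> uv lv ->; rewrite eqxx /walk_step /= (_ : trivalent v = false) //;
    rewrite /trivalent (eqP lv).
case=> uv tv eL eM [uL uM] ->; rewrite eqxx /=.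
have vu : adj v u by rewrite adj_sym.
have [us e s3] := succ3 tv vu.
have [h1 h2] : fpath (@walk_step G) (u, v) (darts v L) /\
    walk_step (last (u, v) (darts v L)) = (bt_root L, v).
  by apply: hL => //; rewrite /walk_step /= tv eL.
have [h3 h4] : fpath (@walk_step G) (bt_root L, v) (darts v M) /\
    walk_step (last (bt_root L, v) (darts v M)) = (bt_root M, v).
  by apply: hM => //; rewrite /walk_step /= tv eM eL.
rewrite cat_path /= h1 /= h2 eqxx cat_path /= h3 /= h4 eqxx; split=> //.
by rewrite last_cat /= last_cat /= /walk_step /= tv eM s3.
Qed.

Lemma tour_cycle : fcycle (@walk_step G) tour.
Proof.
have [lr ht] := hr; rewrite /tour /=.
have [|h1 h2] := @darts_path r t (bt_root t, r) ht.
  by rewrite /walk_step /= (_ : trivalent r = false) // /trivalent (eqP lr).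
by rewrite rcons_path h1 /= h2 eqxx.
Qed.

Lemma darts_sub u t' d : d \in darts u t' -> d.1 \in u :: labels t' /\ d.2 \in labels t'.
Proof.
elim: t' u => [v|v L hL M hM] u /=; first by rewrite inE => /eqP->; rewrite !inE !eqxx.
rewrite inE mem_cat inE mem_cat inE => /or4P[/eqP->|/hL[h1 h2]|/eqP->|].
- by rewrite !inE !eqxx.
- by move: h1; rewrite !inE !mem_cat h2 => /orP[->|->]; rewrite !orbT.
- by rewrite !inE !mem_cat bt_root_labels eqxx !orbT.
case/orP=> [/hM[h1 h2]|/eqP->].
  by move: h1; rewrite !inE !mem_cat h2 => /orP[->|->]; rewrite !orbT.
by rewrite !inE !mem_cat bt_root_labels eqxx !orbT.
Qed.

Lemma darts_uniq u t' : uniq (u :: labels t') -> uniq (darts u t').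
Proof.
elim: t' u => [v|v L hL M hM] u // uq.
have [nu uv] := andP uq; have [vL vM nuv nuL nuM] := uniq_parent uq.
have [uL uM nvL nvM d] := uniq_labelsP uv.
have nL : (bt_root L, v) \notin darts v L.
  by apply/negP => /darts_sub[_] /=; apply/negP.
have nM : (bt_root M, v) \notin darts v M.
  by apply/negP => /darts_sub[_] /=; apply/negP.
have nML : (bt_root M, v) \notin darts v L.
  by apply/negP => /darts_sub[_] /=; apply/negP.
have nLM : (bt_root L, v) \notin darts v M.
  by apply/negP => /darts_sub[_] /=; apply/negP.
have nr : bt_root L != bt_root M.
  apply/eqP => e; have := d _ (bt_root_labels L).
  by rewrite e bt_root_labels.
have notu e : e \in darts v L ++ (bt_root L, v) :: darts v M ++ [:: (bt_root M, v)] ->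
    e.1 != u.
  move=> he; have hin : e.1 \in v :: labels L ++ labels M.
    move: he; rewrite mem_cat inE mem_cat inE => /or4P[/darts_sub[h _]|/eqP->|/darts_sub[h _]|/eqP->].
    - by move: h; rewrite !inE mem_cat => /orP[->|->]; rewrite ?orbT.
    - by rewrite inE mem_cat bt_root_labels !orbT.
    - by move: h; rewrite !inE mem_cat => /orP[->|->]; rewrite ?orbT.
    by rewrite inE mem_cat bt_root_labels !orbT.
  by apply: contraNneq nu => <-.
rewrite [darts _ _]/= cons_uniq; apply/andP; split.
  by apply/negP => he; have := notu _ he; rewrite eqxx.
rewrite cat_uniq (hL _ vL) cons_uniq cats1 rcons_uniq nM (hM _ vM) !andTb andbT.
apply/andP; split; last first.
  by rewrite mem_rcons inE xpair_eqE (negbTE nr).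
apply/hasPn => -[e1 e2]; rewrite inE mem_rcons inE.
case/or3P=> [/eqP[-> ->]|/eqP[-> ->]|/darts_sub[_ h2]] //.
by apply/negP => /darts_sub[_ h1]; have := d _ h1; rewrite h2.
Qed.

Lemma tour_uniq : uniq tour.
Proof.
rewrite /tour /= darts_uniq ?rooted_uniq // andbT.
apply/negP => /darts_sub[_] /=; apply/negP; by case/andP: rooted_uniq.
Qed.

Lemma nb_darts u t' x y : uniq (u :: labels t') -> y \in labels t' -> x \in nb u t' y ->
  (x, y) \in darts u t'.
Proof.
elim: t' u => [v|v L hL M hM] u uq.
  by rewrite inE => /eqP-> /=; rewrite eqxx !inE => /eqP->.
have [nu uv] := andP uq; have [vL vM nuv nuL nuM] := uniq_parent uq.
have [uL uM nvL nvM d] := uniq_labelsP uv.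
rewrite {1}[labels _]/= inE mem_cat nb_Node //; case: eqP => [-> _|_ /= yin].
  by rewrite !inE => /or3P[]/eqP->; rewrite /= !(inE, mem_cat) !eqxx ?orbT.
rewrite /= inE mem_cat inE mem_cat; case: ifP yin => [yL _|_ /= yM] hx.
  by rewrite hL ?orbT.
by rewrite hM ?orbT.
Qed.

Lemma tour_all x y : adj x y -> (x, y) \in tour.
Proof.
rewrite adj_sym rooted_adj /nbr /tour inE; case: eqP => [->|/eqP ny].
  by rewrite inE => /eqP->; rewrite eqxx.
move=> h; rewrite nb_darts ?orbT ?rooted_uniq //.
by have := rooted_all y; rewrite inE (negbTE ny).
Qed.

Lemma tour_leaves : [seq b.2 | b <- tour & leaf b.2] = r :: leaves t.
Proof.
have [lr ht] := hr; rewrite /tour /= lr /=; congr (_ :: _).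
elim: t r ht => [v|v L hL M hM] u /=; first by case=> _ ->.
case=> _ tv _ _ [uL uM]; rewrite trivalent_leaf // filter_cat /= trivalent_leaf //.
by rewrite filter_cat /= trivalent_leaf // cats0 map_cat (hL _ uL) (hM _ uM).
Qed.

Lemma filter_map_rot (A B : Type) (g : A -> B) (P : pred A) i (s : seq A) :
  exists j, [seq g b | b <- rot i s & P b] = rot j [seq g b | b <- s & P b].
Proof.
exists (size [seq g b | b <- take i s & P b]).
rewrite -{3}(cat_take_drop i s) filter_cat map_cat rot_size_cat.
by rewrite /rot filter_cat map_cat.
Qed.

(** Every directed edge lies on [tour], so a walk with another start visits the same leaves up to
    rotation. *)
Lemma leaf_order_rot c : leaf_order c -> exists j, c = rot j (r :: leaves t).
Proof.
case=> -[x y] /= xy ->; have [i ->] := orbit_rot_cycle tour_cycle tour_uniq (tour_all xy).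
by have [j ->] := filter_map_rot snd (fun b : G * G => leaf b.2) i tour;
   exists j; rewrite -tour_leaves.
Qed.

Lemma leaf_order_leaves : leaf_order (r :: leaves t).
Proof.
have [lr ht] := hr.
exists (bt_root t, r); first by rewrite /= adj_sym; apply: unfolding_adj ht.
have -> : orbit (@walk_step G) (bt_root t, r) = tour.
  rewrite (orbitE tour_cycle tour_uniq) ?mem_head // /= eqxx rot0 //.
by rewrite tour_leaves.
Qed.

End Rooted.

(** * The 3-tree of a rooted binary tree *)

Section TreeOfBt.
Variables (I : finType) (r : I) (t : bt I).
Hypotheses (uq : uniq (r :: labels t)) (all_in : forall x, x \in r :: labels t).

Let A : rel I := fun x y => y \in nbr r t x.

Let in_labels x : x != r -> x \in labels t.
Proof. by move=> nx; have := all_in x; rewrite inE (negbTE nx). Qed.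

Let r_out : r \notin labels t. Proof. by case/andP: uq. Qed.

Lemma nbr_sym : symmetric A.
Proof.
suff imp x y : A x y -> A y x by move=> x y; apply/idP/idP; apply: imp.
rewrite /A /nbr; case: (eqVneq x r) => [-> |nx].
  rewrite inE => /eqP->; case: eqP => [e|_].
    by move: r_out; rewrite -e bt_root_labels.
  exact: nb_root.
move=> h; case: (nb_sym uq (in_labels nx) h) => [[-> ->]|[yt h']].
  by rewrite eqxx mem_head.
by case: eqP => [e|_] //; move: r_out; rewrite -e yt.
Qed.

Lemma nbr_irr : irreflexive A.
Proof.
move=> x; rewrite /A /nbr; case: (eqVneq x r) => [->|nx].
  by rewrite inE; apply/negbTE; apply: contraNneq r_out => ->; apply: bt_root_labels.
by apply/negbTE/nb_irr => //; apply: in_labels.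
Qed.

Lemma nbr_shape x :
  x \in r :: leaves t /\ (exists y, nbr r t x = [:: y]) \/
  x \in nodes t /\ (exists a b c, nbr r t x = [:: a; b; c] /\ uniq [:: a; b; c]).
Proof.
rewrite /nbr; case: (eqVneq x r) => [->|nx].
  by left; split; [rewrite mem_head | exists (bt_root t)].
have := in_labels nx; rewrite mem_labels mem_cat => /orP[xl|xn].
  have [y ->] := nb_leaf uq xl; left; split; last by exists y.
  by rewrite inE xl orbT.
have [a [b [c [-> [h1 h2 h3]]]]] := nb_node uq xn; right; split=> //.
exists a, b, c; split=> //.
have ne i j y z : side t x y = i -> side t x z = j -> i != j -> y != z.
  by move=> <- <-; apply: contraNneq => ->.
by rewrite /= !inE negb_or (ne _ _ _ _ h1 h2) // (ne _ _ _ _ h1 h3) // (ne _ _ _ _ h2 h3).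
Qed.

Lemma nbr_connected x y : connect A x y.
Proof.
suff from_r z : connect A r z.
  by apply: connect_trans (from_r y); rewrite (sym_connect_sym nbr_sym).
have step u s : (forall x, x \in labels s -> nbr r t x = nb u s x) ->
    uniq (u :: labels s) -> {in labels s, forall x, connect A u x}.
  elim: s u => [v|v L hL M hM] u h uqs.
    move=> x' ; rewrite inE => /eqP->; apply: connect1.
    by rewrite nbr_sym /A h ?mem_head //= eqxx mem_head.
  have [nu uv] := andP uqs; have [vL vM nuv nuL nuM] := uniq_parent uqs.
  have [uL uM nvL nvM d] := uniq_labelsP uv.
  have uv' : connect A u v.
    apply: connect1; rewrite nbr_sym /A h; last by rewrite /= mem_head.
    by rewrite nb_Node // eqxx mem_head.
  move=> x'; rewrite inE mem_cat => /or3P[/eqP->//|xL|xM]; apply: connect_trans uv' _.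
    apply: hL => // y' yL; rewrite h ?nb_Node // ?yL ?inE ?mem_cat ?yL ?orbT //.
    by case: eqP => // e; move: nvL; rewrite -e yL.
  apply: hM => // y' yM; rewrite h ?nb_Node // ?inE ?mem_cat ?yM ?orbT //.
  case: eqP => [e|_]; first by move: nvM; rewrite -e yM.
  by case: ifP => // /d; rewrite yM.
case: (eqVneq z r) => [->|/in_labels zt]; first exact: connect0.
apply: step zt => // x' xt; rewrite /nbr; case: eqP => // e.
by move: r_out; rewrite -e xt.
Qed.

Lemma nbr_depth : exists dep : I -> nat, forall x, exists y, forall z,
  A x z -> z = y \/ dep x < dep z.
Proof.
exists (fun x => if x == r then 0 else (depth t x).+1) => x; rewrite /A /nbr.
case: (eqVneq x r) => [_|nx].
  by exists (bt_root t) => z; rewrite inE => /eqP; left.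
have [y _ hz] := nb_depth uq (in_labels nx); exists y => z /hz[->|[zt hd]]; first by left.
by right; case: eqP => // e; move: r_out; rewrite -e zt.
Qed.

Lemma max_in_seq (dep : I -> nat) x s : exists2 y, y \in x :: s &
  {in x :: s, forall z, dep z <= dep y}.
Proof.
elim: s x => [|z s IH] x.
  by exists x => [|y]; rewrite inE // => /eqP->.
have [y yin hy] := IH z; have [h|h] := leqP (dep x) (dep y).
  exists y => [|w]; rewrite inE ?yin ?orbT // => /predU1P[->//|]; exact: hy.
exists x => [|w]; first by rewrite mem_head.
by rewrite inE => /predU1P[->//|/hy hw]; apply: leq_trans hw (ltnW h).
Qed.

(* A vertex of maximal depth on a cycle has only its parent as neighbour there. *)
Lemma nbr_acyclic c : 2 < size c -> ~ ucycle A c.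
Proof.
case: c => // x0 s0; set c := x0 :: s0 => sc uc.
have [dep hdep] := nbr_depth; have [x xc xmax] := max_in_seq dep x0 s0.
have [i s es] := rot_to xc.
have {uc} : ucycle A (x :: s) by rewrite -es rot_ucycle.
have {}xmax z : z \in x :: s -> dep z <= dep x.
  by rewrite -es mem_rot; apply: xmax.
have : 2 < size (x :: s) by rewrite -es size_rot.
case: s es xmax => [|y [|z s]] // es xmax _ /andP[].
rewrite /= -/(rcons _ _) rcons_path /= => /and3P[Axy _ /andP[_ Alx]] /and3P[_ ny _].
have [w hw] := hdep x; set l := last z s in Alx.
have parent v : v \in x :: [:: y, z & s] -> A x v -> v = w.
  by move=> vs /hw[//|]; rewrite ltnNge xmax.
have lin : l \in z :: s by rewrite mem_last.
have eyl : y = l.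
  rewrite (parent y) ?inE ?eqxx ?orbT // (parent l) //.
    by rewrite inE inE lin !orbT.
  by rewrite nbr_sym.
by move: ny; rewrite eyl lin.
Qed.

Lemma nbr_card x : #|A x| = size (nbr r t x).
Proof.
have -> : #|A x| = #|nbr r t x| by apply: eq_card.
apply/card_uniqP; case: (nbr_shape x) => -[_]; first by case=> y ->.
by case=> a [b [c [-> ]]].
Qed.

Lemma nbr_deg x : (#|A x| == 1) || (#|A x| == 3).
Proof.
rewrite nbr_card; case: (nbr_shape x) => -[_]; first by case=> y ->.
by case=> a [b [c [-> _]]].
Qed.

Definition nbr_succ x y := next (nbr r t x) y.

Lemma nbr_3 x : #|A x| = 3 -> uniq (nbr r t x) /\ size (nbr r t x) = 3.
Proof.
rewrite nbr_card => h; split=> //; case: (nbr_shape x) => -[_].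
  by case=> y e; move: h; rewrite e.
by case=> a [b [c [->]]].
Qed.

Lemma nbr_succ_adj x y : #|A x| = 3 -> A x y -> A x (nbr_succ x y).
Proof. by move=> _; rewrite /A mem_next. Qed.

Lemma nbr_succ_neq x y : #|A x| = 3 -> A x y -> nbr_succ x y != y.
Proof.
case/nbr_3; rewrite /A /nbr_succ; case: (nbr r t x) => [|a [|b [|c [|]]]] //= + _.
rewrite !inE negb_or andbT => /andP[/andP[ab ac] bc] /or3P[]/eqP->.
- by rewrite eqxx eq_sym.
- by rewrite [b == a]eq_sym (negbTE ab) eqxx eq_sym.
- by rewrite [c == a]eq_sym (negbTE ac) [c == b]eq_sym (negbTE bc) eqxx.
Qed.

Lemma nbr_succ_inj x : #|A x| = 3 -> {in A x &, injective (nbr_succ x)}.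
Proof.
by case/nbr_3 => u _ y z _ _; apply: (can_inj (prev_next u)).
Qed.

Lemma nbr_card_gt0 : 0 < #|I|.
Proof. by apply/card_gt0P; exists r. Qed.

Definition tree_of_bt : tree3 :=
  @Tree3 I A nbr_succ nbr_sym nbr_irr nbr_card_gt0 nbr_connected nbr_acyclic
    nbr_deg nbr_succ_adj nbr_succ_neq nbr_succ_inj.

Lemma tree_of_bt_leaf x : @leaf tree_of_bt x = (x \in r :: leaves t).
Proof.
rewrite /leaf /= nbr_card; case: (nbr_shape x) => -[xin].
  by case=> y ->; rewrite xin.
case=> a [b [c [-> _]]]; apply/esym/negbTE; rewrite inE negb_or.
have xt := nodes_sub xin; apply/andP; split; first by apply: contraNneq r_out => <-.
by apply: contraL xin; apply: leaf_notin_nodes; case/andP: uq.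
Qed.

Lemma tree_of_bt_rooted : @rooted tree_of_bt r t.
Proof.
split; first by rewrite tree_of_bt_leaf mem_head.
have key u s : (forall x, x \in labels s -> nbr r t x = nb u s x) ->
    uniq (u :: labels s) -> A u (bt_root s) ->
    {subset leaves s <= leaves t} -> {subset nodes s <= nodes t} ->
    @unfolding tree_of_bt u s.
  elim: s u => [v|v L hL M hM] u h uqs uv sl sn.
    by split=> //; rewrite tree_of_bt_leaf inE sl ?orbT // mem_head.
  have [nu uvq] := andP uqs; have [vL vM nuv nuL nuM] := uniq_parent uqs.
  have [uL uM nvL nvM d] := uniq_labelsP uvq.
  have ev : nbr r t v = [:: u; bt_root L; bt_root M].
    by rewrite h ?mem_head // nb_Node // eqxx.
  have tv : @trivalent tree_of_bt v by rewrite /trivalent /= nbr_card ev.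
  have u3 : uniq [:: u; bt_root L; bt_root M].
    by rewrite -ev; apply: (nbr_3 _).1; apply/eqP.
  move: u3; rewrite /= !inE negb_or andbT => /andP[/andP[n1 n2] n3].
  have sa : nbr_succ v u = bt_root L by rewrite /nbr_succ ev /= eqxx.
  have sb : nbr_succ v (bt_root L) = bt_root M.
    by rewrite /nbr_succ ev /= eq_sym (negbTE n1) eqxx.
  split; [exact: uv | exact: tv | by rewrite /= sa | by rewrite /= sa sb | split].
    apply: hL => //.
    - move=> y' yL; rewrite h ?nb_Node // ?yL ?inE ?mem_cat ?yL ?orbT //.
      by case: eqP => // e; move: nvL; rewrite -e yL.
    - by rewrite /A ev !inE eqxx orbT.
    - by move=> y hy; apply: sl; rewrite /= mem_cat hy.
    - by move=> y hy; apply: sn; rewrite /= inE mem_cat hy orbT.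
  apply: hM => //.
  - move=> y' yM; rewrite h ?nb_Node // ?inE ?mem_cat ?yM ?orbT //.
    case: eqP => [e|_]; first by move: nvM; rewrite -e yM.
    by case: ifP => // /d; rewrite yM.
  - by rewrite /A ev !inE eqxx !orbT.
  - by move=> y hy; apply: sl; rewrite /= mem_cat hy orbT.
  - by move=> y hy; apply: sn; rewrite /= inE mem_cat hy !orbT.
apply: key => //; last by rewrite /A /nbr eqxx mem_head.
move=> x' xt; rewrite /nbr; case: eqP => // e.
by move: r_out; rewrite -e xt.
Qed.

End TreeOfBt.

Import Order.TTheory GRing.Theory Num.Theory.
Local Open Scope ring_scope.

(** * Orientations in the plane *)

Section Det3.
Variable R : realFieldType.
Implicit Types a b c d o u v w : 'rV[R]_2.

Definition det3 a b c : R :=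
  (b 0 0 - a 0 0) * (c 0 1 - a 0 1) - (b 0 1 - a 0 1) * (c 0 0 - a 0 0).

Lemma det3C a b c : det3 b c a = det3 a b c.
Proof. by rewrite /det3; ring. Qed.

Lemma det3N a b c : det3 b a c = - det3 a b c.
Proof. by rewrite /det3; ring. Qed.

Lemma det3S a b c : det3 a c b = - det3 a b c.
Proof. by rewrite /det3; ring. Qed.

Lemma det3aa a c : det3 a a c = 0.
Proof. by rewrite /det3; ring. Qed.

Lemma det3_eq12 a b : det3 a b b = 0.
Proof. by rewrite /det3; ring. Qed.

Lemma det3_eq02 a b : det3 a b a = 0.
Proof. by rewrite /det3; ring. Qed.

Lemma det3_4 a b c d : det3 a b c = det3 b c d - det3 a c d + det3 a b d.
Proof. by rewrite /det3; ring. Qed.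

(* The three-term Grassmann-Pluecker relation of the vectors from [o]. *)
Lemma det3_GP o u v w d :
  det3 o u w * det3 o v d = det3 o u v * det3 o w d + det3 o u d * det3 o v w.
Proof. by rewrite /det3; ring. Qed.

(** Barycentric coordinates of [w] in the triangle, with denominators cleared, under the affine
    function [det3 u v]. *)
Lemma det3_bary a b c w u v :
  det3 a b c * det3 u v w =
  det3 b c w * det3 u v a + det3 c a w * det3 u v b + det3 a b w * det3 u v c.
Proof. by rewrite /det3; ring. Qed.

(** All three turns have the same nonzero sign: this does not depend on the orientation of the
    triangle and also excludes degenerate triangles. *)
Definition in_tri (w x y z : 'rV[R]_2) : bool :=
  (0 < det3 x y w * det3 y z w) && (0 < det3 y z w * det3 z x w).

Lemma affine_zero3 al be ga (x y z : 'rV[R]_2) :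
  al + be * x 0 0 + ga * x 0 1 = 0 -> al + be * y 0 0 + ga * y 0 1 = 0 ->
  al + be * z 0 0 + ga * z 0 1 = 0 -> be * det3 x y z = 0 /\ ga * det3 x y z = 0.
Proof.
move=> hx hy hz; pose f (v : 'rV[R]_2) := al + be * v 0 0 + ga * v 0 1.
have [fx [fy fz]] : f x = 0 /\ f y = 0 /\ f z = 0 by [].
split.
  transitivity ((f y - f x) * (z 0 1 - x 0 1) - (f z - f x) * (y 0 1 - x 0 1)).
    by rewrite /f /det3; ring.
  by rewrite fx fy fz; ring.
transitivity ((f z - f x) * (y 0 0 - x 0 0) - (f y - f x) * (z 0 0 - x 0 0)).
  by rewrite /f /det3; ring.
by rewrite fx fy fz; ring.
Qed.

Lemma mulr_gt0_trans (x y z : R) : 0 < x * y -> 0 < y * z -> 0 < x * z.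
Proof.
case: (ltrgt0P y) => hy; last by rewrite hy mulr0 ltxx.
- by rewrite pmulr_lgt0 // pmulr_rgt0 // => *; apply: mulr_gt0.
- by rewrite nmulr_lgt0 // nmulr_rgt0 // => *; rewrite nmulr_lgt0.
Qed.

Lemma in_triC w x y z : in_tri w y z x = in_tri w x y z.
Proof.
rewrite /in_tri; set A := det3 x y w; set B := det3 y z w; set C := det3 z x w.
apply/andP/andP => -[h1 h2]; split=> //.
- by rewrite mulrC; apply: mulr_gt0_trans h1 h2.
- by rewrite mulrC; apply: mulr_gt0_trans h1 h2.
Qed.

Lemma in_triN w x y z : in_tri w y x z = in_tri w x y z.
Proof.
rewrite /in_tri (det3N x y) (det3N z x) (det3N y z) !mulrNN.
set A := det3 x y w; set B := det3 y z w; set C := det3 z x w.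
apply/andP/andP => -[h1 h2]; split.
- exact: mulr_gt0_trans h1 h2.
- by rewrite mulrC.
- exact: mulr_gt0_trans h1 h2.
- by rewrite mulrC.
Qed.

Lemma in_triS w x y z : in_tri w x z y = in_tri w x y z.
Proof. by rewrite in_triN in_triC in_triC. Qed.

Lemma in_tri_pos w x y z : 0 < det3 x y z ->
  in_tri w x y z = [&& 0 < det3 x y w, 0 < det3 y z w & 0 < det3 z x w].
Proof.
rewrite (det3_4 x y z w) (det3N z x) opprK /in_tri.
set A := det3 x y w; set B := det3 y z w; set C := det3 z x w => h.
apply/idP/idP => [/andP[h1 h2]|/and3P[h1 h2 h3]]; last by rewrite !mulr_gt0.
have B0 : 0 < B by rewrite ltNge; apply/negP => hB; nra.
by apply/and3P; split=> //; nra.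
Qed.

Lemma in_tri_neq0 w x y z : in_tri w x y z -> det3 x y z != 0.
Proof.
move=> tw; apply/eqP => h; move: tw.
rewrite /in_tri (_ : det3 z x w = - det3 x y w - det3 y z w); last first.
  by move: h; rewrite (det3_4 x y z w) (det3N z x); lra.
move=> /andP[h1 h2]; exfalso; move: h1 h2.
move: (det3 x y w) (det3 y z w) => A B h1.
by have := sqr_ge0 B; rewrite mulrBr mulrN expr2 (mulrC B A); lra.
Qed.

(** The value at [w] is a combination with positive weights of the values at the vertices, of which
    at least one is positive. Many convexity arguments below apply this with a suitable line
    [u v]. *)
Lemma in_tri_gt0 u v w x y z : in_tri w x y z ->
  0 <= det3 u v x -> 0 <= det3 u v y -> 0 <= det3 u v z ->
  0 < det3 u v x + det3 u v y + det3 u v z -> 0 < det3 u v w.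
Proof.
have pos x' y' z' : 0 < det3 x' y' z' -> in_tri w x' y' z' ->
    0 <= det3 u v x' -> 0 <= det3 u v y' -> 0 <= det3 u v z' ->
    0 < det3 u v x' + det3 u v y' + det3 u v z' -> 0 < det3 u v w.
  move=> h; rewrite in_tri_pos // => /and3P[hA hB hC] hx hy hz hs.
  rewrite -(pmulr_rgt0 _ h) det3_bary.
  have tx := mulr_ge0 (ltW hB) hx; have ty := mulr_ge0 (ltW hC) hy.
  have tz := mulr_ge0 (ltW hA) hz.
  have [hx0|hx0] := ltrP 0 (det3 u v x'); first by have := mulr_gt0 hB hx0; lra.
  have [hy0|hy0] := ltrP 0 (det3 u v y'); first by have := mulr_gt0 hC hy0; lra.
  by have := mulr_gt0 hA (_ : 0 < det3 u v z'); lra.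
case: (ltrgt0P (det3 x y z)) => h; first exact: pos.
  rewrite -in_triN => tw hx hy hz hs.
  by apply: pos tw _ _ _ _ => //; [rewrite det3N oppr_gt0 | rewrite (addrC (det3 u v y))].
by move=> /in_tri_neq0; rewrite h eqxx.
Qed.

Lemma in_tri_uniq w x y z : in_tri w x y z -> [&& x != y, y != z & z != x].
Proof.
rewrite /in_tri => /andP[h1 h2]; apply/and3P; split.
- by apply: contraTneq h1 => ->; rewrite det3aa mul0r ltxx.
- by apply: contraTneq h1 => ->; rewrite det3aa mulr0 ltxx.
- by apply: contraTneq h2 => ->; rewrite det3aa mulr0 ltxx.
Qed.

End Det3.

(** * Triples in the order of a list *)

Section Subseq3.
Variable I : eqType.
Implicit Types (c s : seq I) (x y z : I).

Lemma index_subseq3 c x y z : (index x c < index y c < index z c)%N ->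
  z \in c -> subseq [:: x; y; z] c.
Proof.
elim: c => [|a c IH] //=; rewrite inE [a == x]eq_sym [a == y]eq_sym [a == z]eq_sym.
case: (eqVneq z a) => [->|nza /=]; first by rewrite andbF.
case: (eqVneq y a) => [->|nya] /=; first by case: eqP.
case: (eqVneq x a) => [_|nxa] /=; rewrite !ltnS; last exact: IH.
move=> h zc; elim: c h zc {IH} => [|b c IH] //=.
rewrite inE [b == y]eq_sym [b == z]eq_sym.
case: (eqVneq z b) => [->|nzb /=]; first by rewrite ?eqxx ltn0.
by case: (eqVneq y b) => [_ _|nyb /=]; [rewrite sub1seq | rewrite ltnS => /IH].
Qed.

Lemma perm3_ind c (P : I -> I -> I -> Prop) :
  (forall x y z, P x y z -> P y x z) -> (forall x y z, P x y z -> P y z x) ->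
  (forall x y z, subseq [:: x; y; z] c -> P x y z) ->
  forall x y z, x \in c -> y \in c -> z \in c ->
    [&& x != y, y != z & z != x] -> P x y z.
Proof.
move=> hN hC hs x y z xc yc zc /and3P[xy yz zx].
have ne u v : u \in c -> v \in c -> u != v -> index u c != index v c.
  by move=> uc vc; apply: contra_neq; apply: index_inj.
have key u v w : w \in c -> (index u c < index v c < index w c)%N -> P u v w.
  by move=> wc h; apply/hs/index_subseq3.
move: (ne _ _ xc yc xy) (ne _ _ yc zc yz) (ne _ _ zc xc zx).
case: ltngtP => // h1 _; case: ltngtP => // h2 _; case: ltngtP => // h3 _.
- by have := ltn_trans (ltn_trans h1 h2) h3; rewrite ltnn.
- by apply: key; rewrite // h1.
- by apply: (hC); apply: key; rewrite // h3.
- by apply: (hC); apply: (hN); apply: key; rewrite // h3.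
- by apply: (hC); apply: (hC); apply: key; rewrite // h2.
- by apply: (hN); apply: key; rewrite // h1.
- by apply: (hC); apply: (hC); apply: (hN); apply: key; rewrite // h2.
- by have := ltn_trans (ltn_trans h3 h2) h1; rewrite ltnn.
Qed.

Lemma nth_subseq3 x0 c i j k : (i < j < k)%N -> (k < size c)%N ->
  subseq [:: nth x0 c i; nth x0 c j; nth x0 c k] c.
Proof.
elim: c i j k => [|a c IH] [|i] [|j] [|k] //=; rewrite ?ltn0 ?andbF // !ltnS => h hk.
- rewrite eqxx; elim: c j k h hk {IH} => [|b c IH] [|j] [|k] //=; rewrite !ltnS.
    by move=> _ hk; rewrite eqxx sub1seq mem_nth.
  by case: eqP => [_ _ hk|_]; [rewrite sub1seq mem_nth | apply: IH].
- have := IH _ _ _ h hk; case: eqP => // _ hs.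
  exact: subseq_trans (subseq_cons _ _) hs.
Qed.

End Subseq3.

(** * Configurations and cherries *)

Section Conf.
Variables (R : realFieldType) (I : eqType) (p : I -> 'rV[R]_2).
Implicit Types (c s W : seq I) (x y z w q a b k : I).

Local Notation D x y z := (det3 (p x) (p y) (p z)).
Local Notation tr w x y z := (in_tri (p w) (p x) (p y) (p z)).

(** Convexity is asked of all triples in list order, not only of consecutive ones, so that it passes
    to sublists. *)
Definition ccw c := forall x y z, subseq [:: x; y; z] c -> 0 < D x y z.

Definition edge c x y :=
  x != y /\ forall k, k \in c -> k != x -> k != y -> 0 < D x y k.

(* [c] is a convex polygon and every triangle of its vertices contains exactly
   one point of [W]: the combinatorial content of being a T-diagram. *)
Record conf c W : Prop := Conf {
  conf_ccw : ccw c;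
  conf_uniq : uniq c;
  conf_uniqW : uniq W;
  conf_size : size c = (size W).+2;
  conf_gen : forall w x y,
    w \in W -> x \in c -> y \in c -> x != y -> D x y w != 0;
  conf_in : forall w, w \in W ->
    exists x y z, [/\ x \in c, y \in c, z \in c & tr w x y z];
  conf_ex : forall x y z, x \in c -> y \in c -> z \in c ->
    [&& x != y, y != z & z != x] -> exists2 w, w \in W & tr w x y z;
  conf_un : forall x y z w w', x \in c -> y \in c -> z \in c ->
    w \in W -> w' \in W -> tr w x y z -> tr w' x y z -> w = w' }.

Lemma ccw_sub c c' : subseq c' c -> ccw c -> ccw c'.
Proof. by move=> h hc x y z hs; apply/hc/(subseq_trans hs). Qed.

Lemma ccw_rot1 x s : ccw (x :: s) -> ccw (rcons s x).
Proof.
move=> h u v w; rewrite -[rcons s x]cats1 -[[:: u; v; w]]revK -[s ++ _]revK subseq_rev.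
rewrite rev_cat /=; case: (eqVneq w x) => [-> |nw].
  rewrite -[[:: v; u]]/(rev [:: u; v]) subseq_rev => hs; rewrite -det3C -det3C.
  by apply: h; rewrite /= eqxx.
rewrite subseq_rev => hs.
by apply: h; apply: subseq_trans hs (subseq_cons _ _).
Qed.

Lemma ccw_rot n c : ccw c -> ccw (rot n c).
Proof.
move=> h; elim: n => [|n IH]; first by rewrite rot0.
have [hn|hn] := leqP (size c) n.
  by rewrite rot_oversize // (leq_trans hn).
rewrite rotS //; move: IH; case: (rot n c) => [|x s] hs //.
by rewrite rot1_cons; apply: ccw_rot1.
Qed.

Lemma ccw_head a b s k : ccw (a :: b :: s) -> k \in s -> 0 < D a b k.
Proof. by move=> h ks; apply: h; rewrite /= !eqxx sub1seq. Qed.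

Lemma ccw_edge a b s : uniq (a :: b :: s) -> ccw (a :: b :: s) ->
  edge (a :: b :: s) a b.
Proof.
rewrite /= inE negb_or => /and3P[/andP[nab _] _ _] h; split=> // k.
by rewrite !inE => /or3P[/eqP->|/eqP->|ks _ _]; rewrite ?eqxx //; apply: ccw_head ks.
Qed.

Lemma edge_eq_mem c c' x y : c =i c' -> edge c x y -> edge c' x y.
Proof. by move=> h [nxy e]; split=> // k; rewrite -h; apply: e. Qed.

Lemma rot_cat2 (s1 s2 : seq I) : rot (size s1) (s1 ++ s2) = s2 ++ s1.
Proof. exact: rot_size_cat. Qed.

Lemma ccw_next c x : (1 < size c)%N -> uniq c -> ccw c -> x \in c ->
  exists y, y \in c /\ edge c x y.
Proof.
move=> hs uc hc xc; case: (rot_to xc) => i s ds.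
have hm : c =i x :: s by move=> y; rewrite -ds mem_rot.
have : uniq (x :: s) by rewrite -ds rot_uniq.
have : ccw (x :: s) by rewrite -ds; apply: ccw_rot.
case: s ds hm => [|y s] ds hm; first by move: hs; rewrite -(size_rot i) ds.
move=> h1 h2; exists y; rewrite hm !inE eqxx orbT; split=> //.
by apply: edge_eq_mem (ccw_edge h2 h1) => z; rewrite hm.
Qed.

Lemma conf_rot n c W : conf c W -> conf (rot n c) W.
Proof.
case=> h1 h2 h3 h4 h5 h6 h7 h8; split; rewrite ?rot_uniq ?size_rot //.
- exact: ccw_rot.
- by move=> w x y; rewrite !mem_rot; apply: h5.
- by move=> w /h6[x [y [z []]]]; exists x, y, z; rewrite !mem_rot.
- by move=> x y z; rewrite !mem_rot; apply: h7.
- by move=> x y z w w'; rewrite !mem_rot; apply: h8.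
Qed.

Lemma conf_cat s1 s2 W : conf (s1 ++ s2) W -> conf (s2 ++ s1) W.
Proof. by move=> /(conf_rot (size s1)); rewrite rot_cat2. Qed.

Lemma edge_ge0 c x y k : edge c x y -> k \in c -> 0 <= D x y k.
Proof.
move=> [_ e] kc; case: (eqVneq k x) => [->|nx]; first by rewrite det3_eq02.
by case: (eqVneq k y) => [->|ny]; rewrite ?det3_eq12 // ltW // e.
Qed.

Lemma tr_uniq w x y z : tr w x y z -> [&& x != y, y != z & z != x].
Proof.
move=> /in_tri_uniq /and3P[h1 h2 h3].
by apply/and3P; split; [move: h1 | move: h2 | move: h3]; apply: contraNneq => ->.
Qed.

(** The line [u v] supports the polygon and touches it at most at [x] and [y]. A triangle has three
    distinct vertices, so one of them is off the line. *)
Lemma halfplane_in_tri c (u v : 'rV[R]_2) x y w a b z :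
  (forall k, k \in c -> 0 <= det3 u v (p k)) ->
  (forall k, k \in c -> k != x -> k != y -> 0 < det3 u v (p k)) ->
  a \in c -> b \in c -> z \in c -> tr w a b z -> 0 < det3 u v (p w).
Proof.
move=> ge gt ac bc zc t; have /and3P[nab nbz nza] := tr_uniq t.
apply: in_tri_gt0 t (ge _ ac) (ge _ bc) (ge _ zc) _.
have := ge _ ac; have := ge _ bc; have := ge _ zc.
case: (boolP ((a != x) && (a != y))) => [/andP[h1 h2]|ha].
  by have := gt _ ac h1 h2; lra.
case: (boolP ((b != x) && (b != y))) => [/andP[h1 h2]|hb].
  by have := gt _ bc h1 h2; lra.
suff /andP[h1 h2] : (z != x) && (z != y) by have := gt _ zc h1 h2; lra.
move: ha hb; rewrite !negb_and !negbK.
case/orP=> /eqP ea; case/orP=> /eqP eb; subst; rewrite ?eqxx // in nab nbz nza *.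
- by rewrite nza eq_sym nbz.
- by rewrite nza eq_sym nbz.
Qed.

Lemma edge_inside c W x y w : conf c W -> edge c x y -> w \in W -> 0 < D x y w.
Proof.
move=> hc e /(conf_in hc)[u [v [z [uc vc zc t]]]].
apply: halfplane_in_tri uc vc zc t; last exact: e.2.
by move=> k; apply: edge_ge0.
Qed.

Lemma tr_pos w x y z : 0 < D x y z -> tr w x y z ->
  [/\ 0 < D x y w, 0 < D y z w & 0 < D z x w].
Proof. by move=> h; rewrite in_tri_pos // => /and3P. Qed.

Lemma tr_posI w x y z : 0 < D x y w -> 0 < D y z w -> 0 < D z x w -> tr w x y z.
Proof. by move=> h1 h2 h3; rewrite /in_tri !mulr_gt0. Qed.

Lemma mul_gt0_eq (x y z : R) : x != 0 -> y != 0 -> (0 < x) = (0 < y) ->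
  (0 < x * z) = (0 < y * z).
Proof.
case: (ltrgt0P x) => // hx _; case: (ltrgt0P y) => // hy _ _.
  by rewrite !pmulr_rgt0.
by rewrite !nmulr_rgt0.
Qed.

(** * Removing a cherry *)

Section Cherry.
Variables (a b q : I) (s W : seq I).
Hypotheses (hc : conf [:: a, b & s] W) (qW : q \in W).
Hypothesis ch : forall k, k \in s -> tr q a b k.

Let c := [:: a, b & s].
Let ac : a \in c. Proof. by rewrite inE eqxx. Qed.
Let bc : b \in c. Proof. by rewrite !inE eqxx orbT. Qed.
Let sc k : k \in s -> k \in c. Proof. by rewrite !inE => ->; rewrite !orbT. Qed.
Let nab : a != b.
Proof. by have := conf_uniq hc; rewrite /= inE negb_or => /andP[/andP[]]. Qed.
Let nas k : k \in s -> k != a.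
Proof.
have := conf_uniq hc; rewrite /= inE negb_or => /andP[/andP[_ h] _] ks.
by apply: contraNneq h => <-.
Qed.
Let nbs k : k \in s -> k != b.
Proof.
by have := conf_uniq hc; rewrite /= => /and3P[_ h _] ks; apply: contraNneq h => <-.
Qed.
Let eab : edge c a b. Proof. exact: ccw_edge (conf_uniq hc) (conf_ccw hc). Qed.
Let pos k : k \in s -> 0 < D a b k. Proof. exact: ccw_head (conf_ccw hc). Qed.

Lemma cherry_only w k : w \in W -> k \in s -> tr w a b k -> w = q.
Proof. by move=> wW ks t; exact: (conf_un hc ac bc (sc ks) wW qW t (ch ks)). Qed.

(** Of the two ways to separate [a] from [b] by the line [k w], one puts [w] into the triangle
    [a b k], whose only white point is [q]; the other puts it on the wrong side of the edge leaving
    [k]. *)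
Lemma cherry_side w k : w \in W -> w != q -> k \in s ->
  (0 < D a k w) = (0 < D b k w).
Proof.
move=> wW nwq ks; have abw := edge_inside hc eab wW.
have nak := conf_gen hc wW ac (sc ks); have nbk := conf_gen hc wW bc (sc ks).
rewrite eq_sym nas // in nak; rewrite eq_sym nbs // in nbk.
have {}nak := nak isT; have {}nbk := nbk isT.
have size1 : (1 < size c)%N by [].
case: (ltrgt0P (D a k w)) nak => // ak _; case: (ltrgt0P (D b k w)) nbk => // bk _.
  have [n [nc e]] := ccw_next size1 (conf_uniq hc) (conf_ccw hc) (sc ks).
  have h0 := edge_ge0 e; have h1 := edge_inside hc e wW.
  have := det3_bary (p a) (p b) (p k) (p w) (p k) (p n).
  rewrite det3_eq02 mulr0 addr0 (det3N (p a) (p k)).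
  have t0 := mulr_gt0 (pos ks) h1.
  have t1 := mulr_ge0 (ltW ak) (h0 _ bc).
  have t2 : 0 <= - D b k w * D k n a by rewrite mulr_ge0 ?h0 // oppr_ge0 ltW.
  lra.
case/negP: nwq; apply/eqP/(cherry_only wW ks)/tr_posI => //.
by rewrite det3N oppr_gt0.
Qed.

Lemma cherry_tr w j k : w \in W -> w != q -> j \in s -> k \in s ->
  tr w a j k = tr w b j k.
Proof.
move=> wW nwq js ks; rewrite /in_tri.
have h i : i \in s -> forall z : R, (0 < D a i w * z) = (0 < D b i w * z).
  move=> si z; apply: mul_gt0_eq; rewrite ?cherry_side //.
    by apply: (conf_gen hc) => //; rewrite ?sc // eq_sym nas.
  by apply: (conf_gen hc) => //; rewrite ?sc // eq_sym nbs.
congr (_ && _); first exact: h.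
rewrite (det3N (p a) (p k)) (det3N (p b) (p k)) !mulrN -!mulNr.
by rewrite [- _ * D a k w]mulrC [- _ * D b k w]mulrC h.
Qed.

Lemma cherry_gt k : k \in s -> 0 < D a q k /\ 0 < D q b k.
Proof.
move=> ks; have [h1 h2 h3] := tr_pos (pos ks) (ch ks).
by split; [rewrite det3C | rewrite -det3C].
Qed.

(** The line from [q] to [b] has all of [b :: s] on its left except [b] itself, so a triangle around
    [q] would put [q] strictly left of a line through [q]. *)
Lemma cherry_notin_a x y z : x \in b :: s -> y \in b :: s -> z \in b :: s ->
  ~~ tr q x y z.
Proof.
move=> xs ys zs; apply/negP => t.
have : 0 < D q b q.
  apply: (halfplane_in_tri (x := b) (y := b)) xs ys zs t.
    move=> k; rewrite inE => /predU1P[->|/cherry_gt[_ /ltW//]].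
    by rewrite det3_eq12.
  by move=> k; rewrite inE => /predU1P[->|/cherry_gt[_ //]]; rewrite eqxx.
by rewrite det3_eq02 ltxx.
Qed.

Lemma cherry_notin_b x y z : x \in a :: s -> y \in a :: s -> z \in a :: s ->
  ~~ tr q x y z.
Proof.
move=> xs ys zs; apply/negP => t.
have : 0 < D a q q.
  apply: (halfplane_in_tri (x := a) (y := a)) xs ys zs t.
    move=> k; rewrite inE => /predU1P[->|/cherry_gt[/ltW//]].
    by rewrite det3_eq02.
  by move=> k; rewrite inE => /predU1P[->|/cherry_gt[//]]; rewrite eqxx.
by rewrite det3_eq12 ltxx.
Qed.

(** In a triangle around [w] the vertices [a] and [b] may be exchanged by [cherry_tr]; both cannot
    occur in it, for then [w] would be [q]. *)
Lemma cherry_in w : w \in W -> w != q ->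
  (exists x y z, [/\ x \in b :: s, y \in b :: s, z \in b :: s & tr w x y z]) /\
  (exists x y z, [/\ x \in a :: s, y \in a :: s, z \in a :: s & tr w x y z]).
Proof.
move=> wW nwq.
have key e y z : (e == a) || (e == b) -> y \in s -> z \in s -> tr w e y z ->
    tr w a y z /\ tr w b y z.
  by move=> /orP[]/eqP-> ys zs t; [rewrite -cherry_tr | rewrite cherry_tr].
have ins x : x \in s -> forall e, x \in e :: s by move=> h e; rewrite inE h orbT.
have := conf_in hc wW => -[x [y [z [xc yc zc t]]]].
have no2 u v k : k \in c -> (u == a) || (u == b) -> (v == a) || (v == b) ->
    ~~ tr w u v k.
  move=> kc hu hv; apply/negP => tk; have /and3P[nuv nvk nku] := tr_uniq tk.
  have ks : k \in s.
    move: kc hu hv nuv nvk nku; rewrite !inE => /or3P[|/eqP->|//]; first last.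
      case/orP=> /eqP->; first by case/orP=> /eqP->; rewrite ?eqxx.
      by rewrite eqxx.
    move=> /eqP->; case/orP=> /eqP->; first by rewrite eqxx.
    by case/orP=> /eqP->; rewrite ?eqxx.
  case/negP: nwq; apply/eqP/(cherry_only wW ks).
  move: hu hv nuv tk; case/orP=> /eqP->; case/orP=> /eqP->; rewrite ?eqxx // => _.
  by rewrite in_triN.
suff [e [y' [z' [he hy hz t']]]] : exists e y' z',
    [/\ e \in c, y' \in s, z' \in s & tr w e y' z'].
  case: (boolP (e \in s)) => es.
    by split; exists e, y', z'; rewrite !ins.
  have hab : (e == a) || (e == b) by move: he; rewrite !inE (negbTE es) orbF.
  have [ta tb] := key _ _ _ hab hy hz t'.
  by split; [exists b | exists a]; exists y', z'; rewrite mem_head !ins.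
have ss k : k \in c -> ~~ ((k == a) || (k == b)) -> k \in s.
  by rewrite !inE orbA => /orP[->|].
have [hx|/(ss _ xc) xs] := boolP ((x == a) || (x == b)).
  exists x, y, z; split=> //; apply: ss => //; apply/negP => h.
    by have := no2 _ _ _ zc hx h; rewrite t.
  by have := no2 _ _ _ yc h hx; rewrite -in_triC t.
have [hy|/(ss _ yc) ys] := boolP ((y == a) || (y == b)).
  exists y, z, x; split=> //; last by rewrite in_triC.
  apply: ss => //; apply/negP => h.
  by have := no2 _ _ _ xc hy h; rewrite in_triC t.
by exists z, x, y; split=> //; rewrite -in_triC.
Qed.

Lemma cherry_remove : conf (b :: s) (rem q W).
Proof.
have sub k : k \in b :: s -> k \in c by rewrite !inE => ->; rewrite orbT.
have remW w : w \in rem q W -> w \in W /\ w != q.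
  by rewrite mem_rem_uniq ?(conf_uniqW hc) // inE => /andP[].
split.
- by apply: ccw_sub (conf_ccw hc); apply: subseq_cons.
- by have := conf_uniq hc => /andP[].
- by rewrite rem_uniq // (conf_uniqW hc).
- have := conf_size hc; rewrite size_rem //= => -[->].
  by rewrite prednK // -has_predT; apply/hasP; exists q.
- by move=> w x y /remW[wW _] /sub xc /sub yc; apply: (conf_gen hc).
- by move=> w /remW[wW nwq]; case: (cherry_in wW nwq).
- move=> x y z xc yc zc h; have [w wW t] := conf_ex hc (sub _ xc) (sub _ yc) (sub _ zc) h.
  exists w => //; rewrite mem_rem_uniq ?(conf_uniqW hc) // inE wW andbT.
  by apply: contraTneq t => ->; apply: cherry_notin_a.
- move=> x y z w w' /sub xc /sub yc /sub zc /remW[wW _] /remW[wW' _].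
  exact: (conf_un hc).
Qed.

End Cherry.

End Conf.

(** * Existence of a cherry *)

Section CherryExists.
Variables (R : realFieldType) (I : eqType) (p : I -> 'rV[R]_2).
Implicit Types (c s W : seq I) (x y z w q a b k : I).

Local Notation D x y z := (det3 (p x) (p y) (p z)).
Local Notation tr w x y z := (in_tri (p w) (p x) (p y) (p z)).
Local Notation ccw := (ccw p).
Local Notation conf := (conf p).

(** The extreme cases, [k = N] and [k] the last point [M], are given. Seen from [b], and likewise
    from [a], every other [k] lies between [N] and [M], and [q] is on the same side of both extreme
    rays; the three-term relation writes the required sign as a sum of positive products. *)
Lemma ears_cherry a b N s q : ccw [:: a, b, N & s] ->
  tr q a b N -> tr q (last N s) a b -> forall k, k \in N :: s -> tr q a b k.
Proof.
move=> h tN tM k.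
have [abq bNq Naq] := tr_pos (ccw_head h (mem_head _ _)) tN.
have MN : last N s \in N :: s by rewrite mem_last.
rewrite in_triC in tM; rewrite in_triC in tM.
have {tM}[_ bMq Maq] : [/\ 0 < D a b q, 0 < D b (last N s) q & 0 < D (last N s) a q].
  by apply: tr_pos tM; apply: ccw_head h _.
case: (lastP s) h tN bMq Maq {MN} => [|t M] /=; first by move=> _ ? _ _; rewrite inE => /eqP->.
rewrite last_rcons => h tN bMq Maq.
rewrite inE mem_rcons inE => /or3P[/eqP->//|/eqP->|kt]; first exact: tr_posI.
have sub e : (e == a) || (e == b) -> [/\ 0 < D e N k, 0 < D e k M & 0 < D e N M].
  move=> he; have kM : subseq [:: k; M] (rcons t M).
    by rewrite -cats1; apply: (@cat_subseq _ [:: k] [:: M]); rewrite sub1seq ?mem_head.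
  have := kM; rewrite -[[:: k; M]]/([:: k] ++ [:: M]) => kM'.
  have hk : k \in rcons t M by rewrite mem_rcons inE kt orbT.
  have hM : M \in rcons t M by rewrite mem_rcons inE eqxx.
  have sube v w : subseq [:: v; w] (N :: rcons t M) ->
      subseq [:: e; v; w] [:: a, b, N & rcons t M].
    move=> hs; case/orP: he => /eqP->; first by
      rewrite /= eqxx; apply: subseq_trans hs (subseq_cons _ _).
    apply: subseq_trans (subseq_cons _ _).
    by rewrite [subseq _ _]/= eqxx.
  by split; apply/h/sube; rewrite ?[subseq [:: N; _] _]/= ?eqxx ?sub1seq //;
    apply: subseq_trans kM (subseq_cons _ _).
have [bNk bkM bNM] : [/\ 0 < D b N k, 0 < D b k M & 0 < D b N M].
  by apply: sub; rewrite eqxx orbT.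
have [aNk akM aNM] : [/\ 0 < D a N k, 0 < D a k M & 0 < D a N M].
  by apply: sub; rewrite eqxx.
apply: tr_posI => //.
  by rewrite -(pmulr_rgt0 _ bNM) det3_GP addr_gt0 // mulr_gt0.
rewrite -det3C -(pmulr_rgt0 _ aNM) det3_GP addr_gt0 //; last first.
  by rewrite mulr_gt0 // det3C.
rewrite (_ : _ * _ = D N a q * D a k M) ?mulr_gt0 //.
by rewrite /det3; ring.
Qed.

Lemma drop_nth2 (r : I) (ls : seq I) i : (i.+1 < size ls)%N ->
  ls = take i ls ++ [:: nth r ls i, nth r ls i.+1 & drop i.+2 ls].
Proof.
move=> h; rewrite -(drop_nth r h) -(drop_nth r (ltnW h)).
by rewrite cat_take_drop.
Qed.

(* The [m] ears centred at the points of [ls] contain only [m - 1] white points,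
   so two of them share one; ears that do not overlap are disjoint, hence these
   two are centred at consecutive points. *)
Lemma conf_cherry (r : I) (ls : seq I) W : conf (r :: ls) W -> (1 < size ls)%N ->
  exists s1 a b s2 q, [/\ ls = s1 ++ [:: a, b & s2], q \in W
    & forall k, k \in s2 ++ r :: s1 -> tr q a b k].
Proof.
(* The default value [r] of [nth] closes the polygon: index [m.+1] gives [r] again, so the last ear
   needs no wrap-around. Ear [i] is centred at [l i.+1], hence never at [r]. *)
move=> hc hs; pose l := nth r (r :: ls); pose m := size ls.
have sz : size (r :: ls) = m.+1 by [].
have lt3 (i j k : nat) : (i < j < k)%N -> (k <= m)%N -> 0 < D (l i) (l j) (l k).
  by move=> h hk; apply/(conf_ccw hc)/nth_subseq3.
have lm : l m.+1 = r by rewrite /l nth_default // sz.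
have l0 : l 0 = r by [].
have lin (i : nat) : l i \in r :: ls.
  by case: (ltnP i m.+1) => h; [apply: mem_nth | rewrite /l nth_default ?mem_head].
have ear_pos (i : nat) : (i < m)%N -> 0 < D (l i) (l i.+1) (l i.+2).
  move=> h; case: (ltnP i.+1 m) => h2; first by apply: lt3; rewrite ?ltnS ?leqnn.
  have ei : i.+1 = m by apply/eqP; rewrite eqn_leq h h2.
  rewrite ei lm -l0 -det3C -det3C; apply: lt3 => //; rewrite -ei ltnSn andbT.
  by rewrite -ltnS ei.
have ear (i : 'I_m) : exists w, w \in W /\ tr w (l i) (l i.+1) (l i.+2).
  have [|w wW t] := conf_ex hc (lin i) (lin i.+1) (lin i.+2); last by exists w.
  have := ear_pos _ (ltn_ord i); case: (eqVneq (l i) _) => [->|_]; first by rewrite det3aa ltxx.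
  case: (eqVneq (l i.+1) _) => [->|_]; first by rewrite det3_eq12 ltxx.
  by case: (eqVneq (l i.+2) _) => [->|_] //; rewrite det3_eq02 ltxx.
have [g hg] := fin_all_exists ear.
have [i [j [lij eg]]] : exists i j : 'I_m, (i < j)%N /\ g i = g j.
  have /injectivePn[x [y nxy e]] : ~~ injectiveb g.
    apply/injectiveP => gi.
    have us : uniq [seq g i | i <- enum 'I_m] by rewrite map_inj_uniq ?enum_uniq.
    have : (size [seq g i | i <- enum 'I_m] <= size W)%N.
      by apply: uniq_leq_size us _ => _ /mapP[x _ ->]; have [] := hg x.
    by rewrite size_map size_enum_ord; have := conf_size hc; rewrite sz => -[->]; rewrite ltnn.
  case: (ltngtP x y) => h; [by exists x, y | by exists y, x |].
  by case/eqP: nxy; apply: val_inj.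
set q := g i in eg; have [qW ti] := hg i; have [_ tj] := hg j.
rewrite -/q -?eg in qW ti tj.
(* For [j > i + 1] the diagonal from [l i] to [l i.+2] has the white point of ear [i] on its right,
   and the vertices of ear [j] on its left or on it, not all on it. *)
have eij : j = i.+1 :> nat.
  apply/eqP; rewrite eqn_leq lij andbT leqNgt; apply/negP => hij.
  have [_ _ h1] := tr_pos (ear_pos _ (ltn_ord i)) ti.
  have im : (i.+2 <= m)%N by rewrite (leq_trans hij) // ltnW.
  have h0 (k : nat) : (i.+2 <= k)%N -> (k <= m.+1)%N -> 0 <= D (l i) (l i.+2) (l k) /\
      (k != i.+2 -> k != m.+1 -> 0 < D (l i) (l i.+2) (l k)).
    move=> hk; rewrite leq_eqVlt => /predU1P[->|km].
      split; last by rewrite eqxx.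
      rewrite lm -l0; case: (i : nat) im => [|i'] im; first by rewrite det3_eq02.
      by rewrite -det3C -det3C ltW // lt3 //= !ltnS leqnSn.
    have gt : k != i.+2 -> 0 < D (l i) (l i.+2) (l k).
      by move=> nk; apply: lt3 => //; rewrite ltnW //= ltn_neqAle eq_sym nk.
    split; last by move=> h _; apply: gt.
    by case: (eqVneq k i.+2) => [->|/gt/ltW//]; rewrite det3_eq12.
  have [hj _] := h0 _ hij (leqW (ltnW (ltn_ord j))).
  have [hj1 hj1'] := h0 j.+1 (leq_trans hij (leqnSn _)) (leqW (ltn_ord j)).
  have [hj2 _] := h0 j.+2 (leq_trans hij (ltnW (leqnSn _))) (ltn_ord j).
  suff : 0 < D (l i) (l i.+2) q by rewrite det3N; lra.
  apply: (in_tri_gt0 tj hj hj1 hj2).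
  have := hj1' _ _; rewrite !eqSS neq_ltn hij orbT neq_ltn ltn_ord => /(_ isT isT).
  lra.
have im : (i.+1 < m)%N by rewrite -eij.
pose s1 := take i ls; pose s2 := drop i.+2 ls.
exists s1, (nth r ls i), (nth r ls i.+1), s2, q; split=> //; first exact: drop_nth2.
have els : r :: ls = (r :: s1) ++ [:: nth r ls i, nth r ls i.+1 & s2].
  by rewrite cat_cons -drop_nth2.
have hc' := hc; rewrite els in hc'; have {}hc' := conf_cat hc'.
have hd : s2 ++ r :: s1 = head r s2 :: behead (s2 ++ r :: s1) by case: (s2).
move: hc'; rewrite !cat_cons hd => hc'.
apply: ears_cherry (conf_ccw hc') _ _.
  move: tj; rewrite eij; congr (in_tri _ _ _ (p _)).
  by rewrite /l /= /s2 -nth0 nth_drop addn0.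
have -> : last (head r s2) (behead (s2 ++ r :: s1)) = l i.
  have -> : last (head r s2) (behead (s2 ++ r :: s1)) = last r (s2 ++ r :: s1).
    by rewrite hd.
  rewrite last_cat /= (last_nth r) size_take (ltn_trans _ im) //.
  by rewrite /l /s1; case: (i : nat) => [|i'] //=; rewrite nth_take.
by move: ti.
Qed.

End CherryExists.

(** * White points seen from a black point *)

Section ConfSigns.
Variables (R : realFieldType) (I : eqType) (p : I -> 'rV[R]_2).
Implicit Types (c s W : seq I) (x y z w q a b k : I).

Local Notation D x y z := (det3 (p x) (p y) (p z)).
Local Notation tr w x y z := (in_tri (p w) (p x) (p y) (p z)).
Local Notation ccw := (ccw p).
Local Notation conf := (conf p).

Lemma sign_change (P : pred I) u t : P u -> ~~ P (last u t) ->
  exists s1 v w s2, [/\ u :: t = s1 ++ [:: v, w & s2], P v & ~~ P w].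
Proof.
elim: t u => [|v t IH] u /= Pu; first by rewrite Pu.
have [Pv /(IH _ Pv)[s1 [v' [w [s2 [-> h1 h2]]]]]|nPv _] := boolP (P v).
  by exists (u :: s1), v', w, s2.
by exists [::], u, v, t.
Qed.

Lemma ccw_edge_cat c s1 s2 a b : uniq c -> ccw c -> c = s1 ++ [:: a, b & s2] ->
  edge p c a b.
Proof.
move=> uc hc e; have ec : rot (size s1) c = [:: a, b & s2] ++ s1 by rewrite e rot_size_cat.
have u' : uniq ([:: a, b & s2] ++ s1) by rewrite -ec rot_uniq.
have c' : ccw ([:: a, b & s2] ++ s1) by rewrite -ec; apply: ccw_rot.
by apply: edge_eq_mem (ccw_edge u' c') => k; rewrite -[in RHS](mem_rot (size s1)) ec.
Qed.

Lemma ccw_edge_last x u t : uniq (x :: u :: t) -> ccw (x :: u :: t) ->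
  edge p (x :: u :: t) (last u t) x.
Proof.
move=> uc hc; have e : x :: u :: t = (x :: belast u t) ++ [:: last u t].
  by rewrite cats1 rcons_cons -lastI.
have ec : rot (size (x :: belast u t)) (x :: u :: t) = [:: last u t, x & belast u t].
  by rewrite e rot_size_cat.
have u' : uniq [:: last u t, x & belast u t] by rewrite -ec rot_uniq.
have c' : ccw [:: last u t, x & belast u t] by rewrite -ec; apply: ccw_rot.
apply: edge_eq_mem (ccw_edge u' c') => k.
by rewrite -[in RHS](mem_rot (size (x :: belast u t))) ec.
Qed.

(** Seen from [x], the white point comes after the first black point and before the last, so some
    consecutive pair [u], [v] encloses it, and the edge [u v] closes the triangle. Stated from the
    edges, so that it can also serve in establishing [conf]. *)
Lemma wedge_of_edges x l ls w : uniq [:: x, l & ls] -> ccw [:: x, l & ls] ->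
  (forall y z, y \in [:: x, l & ls] -> z \in [:: x, l & ls] ->
     edge p [:: x, l & ls] y z -> 0 < D y z w) ->
  (forall y, y \in l :: ls -> D x y w != 0) ->
  exists s1 u v s2, [/\ l :: ls = s1 ++ [:: u, v & s2], 0 < D x u w, 0 < D v x w
    & tr w x u v].
Proof.
move=> uc hc he nz.
have h1 : 0 < D x l w.
  by apply: he; rewrite ?inE ?eqxx ?orbT //; apply: (ccw_edge_cat (s1 := [::])).
have h2 : ~~ (0 < D x (last l ls) w).
  have := he _ _ _ (mem_head _ _) (ccw_edge_last uc hc); rewrite in_cons mem_last orbT => /(_ isT).
  by rewrite det3N oppr_gt0 -leNgt => /ltW.
have [s1 [u [v [s2 [e hu hv]]]]] := sign_change (P := fun k => 0 < D x k w) h1 h2.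
exists s1, u, v, s2.
have hv' : 0 < D v x w.
  rewrite det3N oppr_gt0 lt_neqAle leNgt hv andbT nz //.
  by rewrite e mem_cat !inE eqxx !orbT.
split=> //; apply: tr_posI => //.
apply: he; rewrite 1?in_cons ?e ?mem_cat ?inE ?eqxx ?orbT //.
by rewrite -e; apply: (ccw_edge_cat (s1 := x :: s1) uc hc); rewrite e.
Qed.

Lemma wedge x ls W w : conf (x :: ls) W -> w \in W ->
  exists s1 u v s2, [/\ ls = s1 ++ [:: u, v & s2], 0 < D x u w, 0 < D v x w
    & tr w x u v].
Proof.
move=> hc wW; case: ls hc => [|l ls] hc.
  by have := conf_size hc; case: (W) wW.
apply: wedge_of_edges; rewrite ?(conf_uniq hc) ?(conf_ccw hc) //.
- exact: conf_ccw hc.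
- by move=> y z _ _ e; apply: edge_inside hc e wW.
move=> y yl; apply: (conf_gen hc) => //; rewrite ?mem_head //.
  by rewrite inE yl orbT.
by apply: contraTneq (conf_uniq hc) => ->; rewrite cons_uniq yl.
Qed.

(** If no black point came between [w1] and [w2] around [x], both would lie in the same wedge, hence
    in the same triangle [x u v], and coincide. Thus the order of white points around a black one is
    fixed by triples with two black points. *)
Lemma conf_bww x w1 w2 c W : conf c W -> x \in c -> w1 \in W -> w2 \in W ->
  0 < D x w1 w2 <-> exists2 k, k \in c & 0 < D x w1 k /\ 0 < D x k w2.
Proof.
move=> hc xc w1W w2W.
have back u1 u2 k : u1 \in W -> u2 \in W -> k \in c ->
    0 < D x u1 k -> 0 < D x k u2 -> 0 < D x u1 u2.
  move=> h1 h2 kc g1 g2.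
  have sz : (1 < size c)%N by rewrite (conf_size hc).
  have [n [nc e]] := ccw_next sz (conf_uniq hc) (conf_ccw hc) xc.
  have e1 := edge_inside hc e h1; have e2 := edge_inside hc e h2.
  have e3 := edge_ge0 e kc.
  have := det3_GP (p x) (p n) (p u1) (p k) (p u2).
  have := addr_gt0 (mulr_gt0 e1 g2) (mulr_gt0 e2 g1) => h eq1.
  rewrite -eq1 in h; rewrite -(pmulr_rgt0 _ (_ : 0 < D x n k)) //.
  rewrite lt_neqAle e3 andbT eq_sym; apply: contraTneq h => ->.
  by rewrite mul0r ltxx.
split=> [h|[k kc [g1 g2]]]; last exact: back g1 g2.
have [i ls dls] := rot_to xc; have mem_ls k : k \in c = (k \in x :: ls).
  by rewrite -dls mem_rot.
have hc' : conf (x :: ls) W by rewrite -dls; apply: conf_rot.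
have [s1 [u [v [s2 [e hu hv t]]]]] := wedge hc' w1W.
have uc : u \in c by rewrite mem_ls e inE mem_cat !inE eqxx !orbT.
have vc : v \in c by rewrite mem_ls e inE mem_cat !inE eqxx !orbT.
have ne k w : 0 < D x k w \/ 0 < D k x w -> k != x.
  by case; apply: contraTneq => ->; rewrite det3aa ltxx.
have h1 : 0 < D x w1 v by rewrite det3C.
have [|hv2] := ltrP 0 (D x v w2); first by exists v.
have nv := conf_gen hc w2W xc vc; rewrite eq_sym (ne _ w1) in nv; last by right.
have {}hv2 : 0 < D v x w2 by rewrite det3N oppr_gt0 lt_neqAle hv2 nv.
have nu := conf_gen hc w2W xc uc; rewrite eq_sym (ne _ w1) in nu; last by left.
have [hu2|hu2] := ltrP 0 (D x u w2).
  have e12 : w1 = w2.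
    apply: (conf_un hc xc uc vc) => //; apply: tr_posI => //.
    apply: (edge_inside hc' _ w2W).
    by apply: (ccw_edge_cat (s1 := x :: s1) (conf_uniq hc') (conf_ccw hc')); rewrite e.
  by move: h; rewrite e12 det3_eq12 ltxx.
have hu2' : 0 < D x w2 u by rewrite det3C det3N oppr_gt0 lt_neqAle hu2 nu.
have := back _ _ _ w2W w1W uc hu2' hu.
by rewrite det3C det3N -det3C oppr_gt0; move: h; rewrite -det3C; lra.
Qed.

End ConfSigns.

(** * Orientations at a cherry *)

Section CherrySigns.
Variables (R : realFieldType) (I : eqType) (p : I -> 'rV[R]_2).
Implicit Types (c s W : seq I) (x y z w q a b k : I).

Local Notation D x y z := (det3 (p x) (p y) (p z)).
Local Notation tr w x y z := (in_tri (p w) (p x) (p y) (p z)).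
Local Notation conf := (conf p).

Variables (a b q : I) (s W : seq I).
Hypotheses (hc : conf [:: a, b & s] W) (qW : q \in W).
Hypothesis ch : forall k, k \in s -> tr q a b k.

(** Every other white point lies in a triangle of [a :: s] and in one of [b :: s]; the line [a q]
    supports the first list, the line [q b] the second. *)
Lemma cherry_bww y : y \in W -> y != q -> 0 < D a q y /\ 0 < D q b y.
Proof.
move=> yW nyq; have [[u [v [k [us vs ks t]]]] [u' [v' [k' [us' vs' ks' t']]]]] :=
  cherry_in hc qW ch yW nyq.
split.
  apply: (halfplane_in_tri (x := a) (y := a)) us' vs' ks' t'.
    move=> e; rewrite inE => /predU1P[->|/(cherry_gt hc ch)[/ltW//]].
    by rewrite det3_eq02.
  by move=> e; rewrite inE => /predU1P[->|/(cherry_gt hc ch)[//]]; rewrite eqxx.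
apply: (halfplane_in_tri (x := b) (y := b)) us vs ks t.
  move=> e; rewrite inE => /predU1P[->|/(cherry_gt hc ch)[_ /ltW//]].
  by rewrite det3_eq12.
by move=> e; rewrite inE => /predU1P[->|/(cherry_gt hc ch)[_ //]]; rewrite eqxx.
Qed.

(** By [conf_bww] the order is witnessed by a black [k], which is neither [a] nor [b] since all
    white points are left of the edge [a b]; for such [k] the points [a] and [b] agree by
    [cherry_side]. *)
Lemma cherry_same y z : y \in W -> z \in W -> y != q -> z != q ->
  (0 < D a y z) = (0 < D b y z).
Proof.
move=> yW zW nyq nzq.
have eab := ccw_edge (conf_uniq hc) (conf_ccw hc).
have ac : a \in [:: a, b & s] by rewrite mem_head.
have bc : b \in [:: a, b & s] by rewrite !inE eqxx orbT.
have abw w : w \in W -> 0 < D a b w by apply: edge_inside hc eab.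
have sw k w : k \in s -> w \in W -> w != q ->
    (0 < D a w k) = (0 < D b w k) /\ (0 < D a k w) = (0 < D b k w).
  move=> ks wW nwq; have e := cherry_side hc qW ch wW nwq ks.
  have kc : k \in [:: a, b & s] by rewrite !inE ks !orbT.
  have neg e' : e' \in [:: a, b & s] -> e' != k -> (0 < D e' w k) = ~~ (0 < D e' k w).
    move=> ec nek; have := conf_gen hc wW ec kc nek.
    rewrite (_ : D e' w k = - D e' k w) ?oppr_gt0 -?leNgt; last by rewrite /det3; ring.
    by rewrite lt_neqAle => ->.
  have := conf_uniq hc; rewrite /= inE negb_or => /and3P[/andP[_ nas] nbs _].
  by split=> //; rewrite !neg ?e //; apply: contraTneq ks => <-.
apply/idP/idP => /(conf_bww hc)[]// k kc [g1 g2].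
  have ks : k \in s.
    move: kc g1 g2; rewrite !inE => /or3P[/eqP->|/eqP->|//].
      by rewrite det3_eq02 ltxx.
    by rewrite det3S; have := abw _ yW; lra.
  have [e1 _] := sw _ _ ks yW nyq; have [_ e2] := sw _ _ ks zW nzq.
  by apply/(conf_bww hc) => //; exists k; rewrite -?e1 -?e2.
have ks : k \in s.
  move: kc g1 g2; rewrite !inE => /or3P[/eqP->|/eqP->|//].
    by move=> _; rewrite det3N; have := abw _ zW; lra.
  by rewrite det3_eq02 ltxx.
have [e1 _] := sw _ _ ks yW nyq; have [_ e2] := sw _ _ ks zW nzq.
by apply/(conf_bww hc) => //; exists k; rewrite ?e1 ?e2.
Qed.

(** Up to the positive factor [D a b z], [D q y z] is a combination with positive coefficients of
    [D a y z] and [D b y z], which are positive together. *)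
Lemma cherry_www y z : y \in W -> z \in W -> y != q -> z != q ->
  (0 < D q y z) = (0 < D a y z).
Proof.
move=> yW zW nyq nzq.
have eab := ccw_edge (conf_uniq hc) (conf_ccw hc).
have abz : 0 < D a b z by apply: edge_inside hc eab zW.
have [aqz qbz] := cherry_bww zW nzq.
have GP : D q y z * D a b z = D a q z * D b y z + D q b z * D a y z.
  by rewrite /det3; ring.
rewrite -(pmulr_lgt0 _ abz) GP; have e := cherry_same yW zW nyq nzq.
have [h|h] := ltrP 0 (D a y z).
  by rewrite addr_gt0 // mulr_gt0 // -e.
have h' : D b y z <= 0 by rewrite leNgt -e -leNgt.
apply/negbTE; rewrite -leNgt.
have := mulr_ge0_le0 (ltW aqz) h'; have := mulr_ge0_le0 (ltW qbz) h; lra.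
Qed.

End CherrySigns.

(** * Containment in triangles determines orientations *)

Section Rigid.
Variables (R : realFieldType) (I : eqType).
Implicit Types (c s W : seq I) (x y z w q a b k : I) (p : I -> 'rV[R]_2).

Local Notation D p x y z := (det3 (p x) (p y) (p z)).
Local Notation tr p w x y z := (in_tri (p w) (p x) (p y) (p z)).

Definition same_tr p p' c W := forall w x y z, w \in W ->
  x \in c -> y \in c -> z \in c -> tr p w x y z = tr p' w x y z.

Lemma same_tr_sym p p' c W : same_tr p p' c W -> same_tr p' p c W.
Proof. by move=> h w x y z wW xc yc zc; rewrite h. Qed.

(** A triangle [x u v] around [w] with [u], [v] consecutive contains [w] in both configurations.
    Convex position then decides for every other [y]: those up to [u] come before [w] around [x],
    those from [v] on come after it. *)
Lemma conf_bbw_rigid p p' c W x y w : conf p c W -> conf p' c W ->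
  same_tr p p' c W -> w \in W -> x \in c -> y \in c ->
  0 < D p x y w -> 0 < D p' x y w.
Proof.
move=> hc hc' st wW xc yc h.
have [i ls dls] := rot_to xc; have mem_ls k : k \in c = (k \in x :: ls).
  by rewrite -dls mem_rot.
have {}hc : conf p (x :: ls) W by rewrite -dls; apply: conf_rot.
have {}hc' : conf p' (x :: ls) W by rewrite -dls; apply: conf_rot.
have [s1 [u [v [s2 [e hu hv t]]]]] := wedge hc wW.
have uc : u \in c by rewrite mem_ls e inE mem_cat !inE eqxx !orbT.
have vc : v \in c by rewrite mem_ls e inE mem_cat !inE eqxx !orbT.
have t' : tr p' w x u v by rewrite -st.
have sub3 k l : subseq [:: k; l] ls -> 0 < D p x k l /\ 0 < D p' x k l.
  move=> hs; have hs' : subseq [:: x; k; l] (x :: ls) by rewrite /= eqxx.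
  by split; [apply: (conf_ccw hc) | apply: (conf_ccw hc')].
have [uv uv'] : 0 < D p x u v /\ 0 < D p' x u v.
  apply: sub3; rewrite e; apply: subseq_trans (suffix_subseq _ _).
  by rewrite /= !eqxx sub0seq.
have [hu' _ hv'] := tr_pos uv' t'.
move: yc; rewrite mem_ls inE => /predU1P[ey|]; first by move: h; rewrite ey det3aa ltxx.
rewrite e mem_cat => /orP[y1|].
  have [yu yv] : 0 < D p' x y u /\ 0 < D p' x y v.
    split; apply: (sub3 _ _ _).2; rewrite e.
      by apply: (@cat_subseq _ [:: y] [:: u]); rewrite sub1seq ?mem_head.
    by apply: (@cat_subseq _ [:: y] [:: v]); rewrite sub1seq ?inE ?eqxx ?orbT.
  apply: (in_tri_gt0 t'); rewrite ?det3_eq02 ?lexx ?(ltW yu) ?(ltW yv) //.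
  by rewrite ?add0r ?(addr_gt0 yu yv) ?(addr_gt0 yv yu).
rewrite !inE => /or3P[/eqP->//|/eqP ey|y2].
  by move: h hv; rewrite ey det3N; lra.
have [yu yv] : 0 < D p x u y /\ 0 < D p x v y.
  split; apply: (sub3 _ _ _).1; rewrite e; apply: subseq_trans (suffix_subseq _ _).
    by apply: (@cat_subseq _ [:: u] [:: y] [:: u] (v :: s2));
      rewrite sub1seq ?mem_head // inE y2 orbT.
  by apply: subseq_trans (subseq_cons _ _); rewrite /= eqxx sub1seq.
suff : 0 < D p y x w by rewrite det3N; lra.
rewrite det3C in yu; rewrite det3C in yv.
apply: (in_tri_gt0 t); rewrite ?det3_eq12 ?lexx ?(ltW yu) ?(ltW yv) //.
by rewrite ?add0r ?(addr_gt0 yu yv) ?(addr_gt0 yv yu).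
Qed.

Lemma conf_bww_rigid p p' c W x y z : conf p c W -> conf p' c W ->
  same_tr p p' c W -> x \in c -> y \in W -> z \in W ->
  0 < D p x y z -> 0 < D p' x y z.
Proof.
move=> hc hc' st xc yW zW /(conf_bww hc xc yW zW)[k kc [g1 g2]].
apply/(conf_bww hc' xc yW zW); exists k => //; split.
  rewrite det3C; apply: (conf_bbw_rigid hc) => //; by rewrite -det3C.
exact: (conf_bbw_rigid hc).
Qed.

Lemma conf_cherry_remove p r s1 s2 a b q W :
  conf p (r :: s1 ++ [:: a, b & s2]) W -> q \in W ->
  (forall k, k \in s2 ++ r :: s1 -> tr p q a b k) ->
  conf p [:: a, b & s2 ++ r :: s1] W /\ conf p (r :: s1 ++ b :: s2) (rem q W).
Proof.
move=> hc qW ch.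
have hc1 : conf p ([:: a, b & s2] ++ (r :: s1)) W by apply: conf_cat.
split=> //; apply: (@conf_cat _ _ _ (b :: s2) (r :: s1)).
exact: (cherry_remove hc1 qW ch).
Qed.

(** A cherry of [p] is one of [p'] because it is defined by containment. Triples through its white
    point reduce to one black and two white points by [cherry_www]; the others remain after its
    removal. *)
Lemma conf_www_rigid p p' c W x y z : conf p c W -> conf p' c W ->
  same_tr p p' c W -> x \in W -> y \in W -> z \in W ->
  0 < D p x y z -> 0 < D p' x y z.
Proof.
elim: {W}(size W) {-2}W (erefl (size W)) c => [|n IH] W hW c hc hc' st xW yW zW h.
  by move: xW; rewrite (size0nil hW).
case: c hc hc' st => [|r ls] hc hc' st; first by have := conf_size hc.
have sls : size ls = n.+2 by have := conf_size hc; rewrite /= hW => -[].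
have [|s1 [a [b [s2 [q [e qW ch]]]]]] := conf_cherry hc; first by rewrite sls.
subst ls.
have mems k : k \in [:: a, b & s2 ++ r :: s1] -> k \in r :: s1 ++ [:: a, b & s2].
  move=> hk; change (k \in (r :: s1) ++ [:: a, b & s2]).
  by rewrite mem_cat orbC -mem_cat.
have [hc1 hc2] := conf_cherry_remove hc qW ch.
have ch' k : k \in s2 ++ r :: s1 -> tr p' q a b k.
  move=> ks; rewrite -st ?ch //; apply: mems; rewrite !inE ?eqxx ?orbT //.
  by rewrite -[_ \in s2 ++ _]/(k \in s2 ++ r :: s1) ks !orbT.
have [hc1' hc2'] := conf_cherry_remove hc' qW ch'.
have hq u v : u \in W -> v \in W -> 0 < D p q u v -> 0 < D p' q u v.
  move=> uW vW; case: (eqVneq u q) => [->|nu]; first by rewrite det3aa ltxx.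
  case: (eqVneq v q) => [->|nv]; first by rewrite det3_eq02 ltxx.
  rewrite (cherry_www hc1 qW ch) // (cherry_www hc1' qW ch') //.
  by apply: (conf_bww_rigid hc hc') => //; apply: mems; rewrite mem_head.
case: (eqVneq x q) h => [->|nx h]; first exact: hq.
case: (eqVneq y q) h => [->|ny h]; first by rewrite -det3C -[X in _ -> 0 < X]det3C; apply: hq.
case: (eqVneq z q) h => [->|nz h]; first by rewrite det3C [X in _ -> 0 < X]det3C; apply: hq.
have mr w : w \in W -> w != q -> w \in rem q W.
  by move=> wW nw; rewrite mem_rem_uniq ?(conf_uniqW hc) // inE nw.
apply: (IH (rem q W) _ _ hc2 hc2') => //; rewrite ?mr //.
  by rewrite size_rem // hW.
have sub w : w \in r :: s1 ++ b :: s2 -> w \in r :: s1 ++ [:: a, b & s2].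
  apply: mem_subseq; rewrite /= eqxx; apply: cat_subseq => //.
  exact: subseq_cons.
by move=> w u v k /mem_rem wW /sub uc /sub vc /sub kc; apply: st.
Qed.

End Rigid.

(** * The tree of a configuration *)

Section Realizes.
Variables (R : realFieldType) (I : eqType) (p : I -> 'rV[R]_2).
Implicit Types (c s W : seq I) (x y z w q a b k r : I) (t : bt I).

Local Notation D x y z := (det3 (p x) (p y) (p z)).
Local Notation tr w x y z := (in_tri (p w) (p x) (p y) (p z)).
Local Notation conf := (conf p).

Lemma mem_leaves_graft t a b q e : e \in leaves (graft b (Node q (Leaf a) (Leaf b)) t) ->
  e = a \/ e \in leaves t.
Proof.
rewrite leaves_graft => /flattenP[s /mapP[v vt ->]].
case: eqP => [ev|_]; rewrite !inE; last by move/eqP->; right.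
by case/orP=> /eqP->; [left | right; rewrite -ev].
Qed.

Definition realizes r t := forall w x y z, w \in nodes t ->
  x \in r :: leaves t -> y \in r :: leaves t -> z \in r :: leaves t ->
  tr w x y z = tri t w x y z.

(** The hypotheses say how a cherry sits among the old points: [q] separates exactly [a], [b] and
    the rest, and no old white point separates [a] from [b]. They are kept abstract because the same
    step is used when a cherry is removed from a configuration and when one is added. *)
Lemma realizes_graft r t a b q : uniq (r :: labels t) -> b \in leaves t ->
  a \notin r :: labels t -> q \notin r :: labels t -> a != q ->
  realizes r t ->
  (forall k, k \in r :: leaves t -> k != b -> tr q a b k) ->
  (forall w j k, w \in nodes t -> j \in r :: leaves t -> k \in r :: leaves t ->
     j != b -> k != b -> tr w a j k = tr w b j k) ->
  (forall w k, w \in nodes t -> k \in r :: leaves t -> ~~ tr w a b k) ->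
  (forall x y z, x \in r :: leaves t -> y \in r :: leaves t -> z \in r :: leaves t ->
     ~~ tr q x y z) ->
  (forall x y z, x \in a :: rem b (r :: leaves t) -> y \in a :: rem b (r :: leaves t) ->
     z \in a :: rem b (r :: leaves t) -> ~~ tr q x y z) ->
  realizes r (graft b (Node q (Leaf a) (Leaf b)) t).
Proof.
move=> u bl na nq naq hr ch1 ch2 ch3 ch4 ch5 w x y z hw.
have [ru ut] : r \notin labels t /\ uniq (labels t) by case/andP: u.
have ul := uniq_labels_leaves ut.
have [nar nal] : a != r /\ a \notin labels t by move: na; rewrite inE negb_or => /andP.
have [nqr nql] : q != r /\ q \notin labels t by move: nq; rewrite inE negb_or => /andP.
have bnn : b \notin nodes t by apply: leaf_notin_nodes.
set c := r :: leaves t in ch1 ch2 ch3 ch4 ch5 *.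
have anc : a \notin c by rewrite inE negb_or nar /=; apply: contra (@leaves_sub _ _ _) nal.
have qnc : q \notin c by rewrite inE negb_or nqr /=; apply: contra (@leaves_sub _ _ _) nql.
have bc : b \in c by rewrite inE bl orbT.
have uc : uniq c by rewrite /= ul andbT; apply: contra (@leaves_sub _ _ _) ru.
have hc e : e \in r :: leaves (graft b (Node q (Leaf a) (Leaf b)) t) ->
    e = a \/ e \in c.
  rewrite inE => /predU1P[->|]; first by right; rewrite mem_head.
  by move=> /mem_leaves_graft[->|h]; [left | right; rewrite inE h orbT].
have nab : a != b by apply: contraNneq anc => ->.
have trxx w' e f : [/\ tr w' e e f = false, tr w' e f e = false & tr w' f e e = false].
  by split; apply/negP => /tr_uniq; rewrite eqxx ?andbF.
have ne_a e : e \in c -> e != a by apply: contraTneq => ->.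
have ne_q e : e \in c -> e != q by apply: contraTneq => ->.
move: hw; rewrite (perm_mem (nodes_graft _ _ ul bl)) inE; case: (eqVneq w q) => [->|nwq] /=.
  move=> _ /hc hx /hc hy /hc hz.
  pose sg e := if e == a then 1%N else if e == b then 2%N else 0%N.
  have -> : tri (graft b (Node q (Leaf a) (Leaf b)) t) q x y z = uniq [:: sg x; sg y; sg z].
    by rewrite /tri !side_graft_q.
  have sa : sg a = 1%N by rewrite /sg eqxx.
  have sb : sg b = 2%N by rewrite /sg eqxx eq_sym (negbTE nab).
  have so e : e \in c -> e != b -> sg e = 0%N.
    by move=> ec eb; rewrite /sg (negbTE (ne_a _ ec)) (negbTE eb).
  have mb e : e \in c -> e != b -> e \in a :: rem b c.
    by move=> ec eb; rewrite inE mem_rem_uniq // inE eb ec orbT.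
  have ma : a \in a :: rem b c by rewrite mem_head.
  case: hx => [->|xc]; [|case: (eqVneq x b) => [->|xb]];
  (case: hy => [->|yc]; [|case: (eqVneq y b) => [->|yb]]);
  (case: hz => [->|zc]; [|case: (eqVneq z b) => [->|zb]]);
  rewrite ?sa ?sb ?(so _ xc xb) ?(so _ yc yb) ?(so _ zc zb) //=;
  try by [apply/negbTE/ch4 => // | apply/negbTE/ch5; rewrite ?ma ?mb
     | have [-> _ _] := trxx q a a
     | apply/negP => /tr_uniq; rewrite eqxx ?andbF].
  - exact: ch1.
  - by rewrite in_triS ch1.
  - by rewrite in_triN ch1.
  - by rewrite in_triC ch1.
  - by rewrite -in_triC ch1.
  - by rewrite -in_triC in_triN ch1.
move=> wt /hc hx /hc hy /hc hz.
(* At an old node [a] is in the branch of [b], so it may be replaced by [b] in the tree and in the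
   plane. *)
pose be e := if e == a then b else e.
have sb e : e = a \/ e \in c ->
    side (graft b (Node q (Leaf a) (Leaf b)) t) w e = side t w (be e).
  rewrite /be => -[->|ec]; first by rewrite eqxx side_graft_a.
  by rewrite (negbTE (ne_a _ ec)) side_graft // ?ne_a ?ne_q.
have bec e : e = a \/ e \in c -> be e \in c.
  by rewrite /be => -[->|ec]; [rewrite eqxx | case: ifP].
have -> : tri (graft b (Node q (Leaf a) (Leaf b)) t) w x y z =
    tri t w (be x) (be y) (be z) by rewrite /tri !sb.
rewrite -hr ?bec //.
have one e f : e \in c -> f \in c -> tr w a e f = tr w b e f.
  move=> ec fc; case: (eqVneq e b) => [->|eb].
    by have [-> _ _] := trxx w b f; apply/negbTE/ch3.
  case: (eqVneq f b) => [->|fb]; last exact: ch2.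
  by have [_ -> _] := trxx w b e; rewrite in_triS; apply/negbTE/ch3.
rewrite /be; case: hx => [->|xc]; case: hy => [->|yc]; case: hz => [->|zc];
  rewrite ?eqxx ?(negbTE (ne_a _ xc)) ?(negbTE (ne_a _ yc)) ?(negbTE (ne_a _ zc)).
- by have [-> _ _] := trxx w a a; have [-> _ _] := trxx w b b.
- by have [-> _ _] := trxx w a z; have [-> _ _] := trxx w b z.
- by have [_ -> _] := trxx w a y; have [_ -> _] := trxx w b y.
- exact: one.
- by have [_ _ ->] := trxx w a x; have [_ _ ->] := trxx w b x.
- by rewrite -in_triC -[RHS]in_triC one.
- by rewrite in_triC [RHS]in_triC one.
- by [].
Qed.

Lemma conf_disjoint c W w : conf c W -> w \in W -> w \notin c.
Proof.
move=> hc wW; apply/negP => wc.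
have [|y [yc [nwy _]]] := ccw_next _ (conf_uniq hc) (conf_ccw hc) wc.
  by rewrite (conf_size hc).
by have := conf_gen hc wW wc yc nwy; rewrite det3_eq02 eqxx.
Qed.

Lemma conf_uniq_labels r t W : conf (r :: leaves t) W -> perm_eq (nodes t) W ->
  uniq (r :: labels t).
Proof.
move=> hc pW; have uc := conf_uniq hc.
have h w : w \in nodes t -> w \notin r :: leaves t.
  by rewrite (perm_mem pW); apply: conf_disjoint hc.
rewrite /= mem_labels mem_cat negb_or (perm_uniq (perm_labels t)) cat_uniq.
rewrite (perm_uniq pW) (conf_uniqW hc) andbT.
move: uc => /= /andP[-> ->]; rewrite /=; apply/andP; split.
  by apply/negP => /h; rewrite mem_head.
by apply/hasPn => w /h; rewrite inE negb_or => /andP[].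
Qed.

(** The cherry is found away from [r]; the tree of the smaller configuration has [b] as a leaf,
    where the cherry is grafted. The base case has two black points and no white one. *)
Lemma conf_tree r ls W : conf (r :: ls) W ->
  exists t, [/\ leaves t = ls, perm_eq (nodes t) W & realizes r t].
Proof.
elim: {W}(size W) {-2}W (erefl (size W)) ls => [|n IH] W hW ls hc.
  have := conf_size hc; rewrite hW (size0nil hW) /=.
  case: ls hc => [|v [|]] //= hc _; exists (Leaf v); split=> //.
have sls : size ls = n.+2 by have := conf_size hc; rewrite /= hW => -[].
have [|s1 [a [b [s2 [q [e qW ch]]]]]] := conf_cherry hc; first by rewrite sls.
subst ls; have [hc1 hc2] := conf_cherry_remove hc qW ch.
have [|t [lt pt rt]] := IH (rem q W) _ _ hc2; first by rewrite size_rem // hW.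
have u : uniq (r :: labels t) by apply: conf_uniq_labels pt; rewrite lt.
have ut : uniq (labels t) by case/andP: u.
have ul : uniq (leaves t) := uniq_labels_leaves ut.
have bl : b \in leaves t by rewrite lt mem_cat mem_head orbT.
have memW w : w \in nodes t -> w \in W /\ w != q.
  by rewrite (perm_mem pt) mem_rem_uniq ?(conf_uniqW hc) // inE => /andP[].
have mem1 k : k \in r :: leaves t -> k \in b :: s2 ++ r :: s1.
  rewrite lt => hk; change (k \in (b :: s2) ++ (r :: s1)).
  by rewrite mem_cat orbC -mem_cat.
have mem2 k : k \in r :: leaves t -> k != b -> k \in s2 ++ r :: s1.
  by move=> /mem1; rewrite inE => /predU1P[->|//]; rewrite eqxx.
have anc : a \notin r :: leaves t.
  apply/negP => /mem1; have := conf_uniq hc1.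
  by rewrite [uniq _]/= => /andP[/negbTE->].
have disW w : w \in W -> w \notin [:: a, b & s2 ++ r :: s1] := conf_disjoint hc1.
have aW : a \notin W by apply/negP => /disW; rewrite mem_head.
exists (graft b (Node q (Leaf a) (Leaf b)) t); split.
- by rewrite (leaves_graft_cat _ lt).
- apply: perm_trans (nodes_graft _ _ ul bl) _.
  by rewrite perm_sym (perm_trans (perm_to_rem qW)) // perm_cons perm_sym.
apply: realizes_graft => //.
- move: anc; rewrite !inE mem_labels mem_cat !negb_or => /andP[-> ->] /=.
  by apply: contra aW => /memW[].
- rewrite inE mem_labels mem_cat orbA -in_cons negb_or.
  apply/andP; split; last by apply/negP => /memW[_]; rewrite eqxx.
  by apply: contra (disW _ qW) => h; rewrite inE mem1 ?orbT.
- by apply: contraNneq aW => ->.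
- by move=> k kc kb; apply/ch/mem2.
- by move=> w j k /memW[wW nwq] jc kc jb kb; apply: (cherry_tr hc1 qW ch); rewrite ?mem2.
- move=> w k /memW[wW nwq] kc; case: (eqVneq k b) => [->|kb].
    by apply/negP => /tr_uniq; rewrite eqxx andbF.
  by apply: contra nwq => /(cherry_only hc1 qW ch wW (mem2 _ kc kb))->.
- move=> x y z /mem1 xc /mem1 yc /mem1 zc; exact: (cherry_notin_a hc1 ch).
have mem3 k : k \in a :: rem b (r :: leaves t) -> k \in a :: s2 ++ r :: s1.
  rewrite in_cons => /predU1P[->|]; first by rewrite mem_head.
  rewrite mem_rem_uniq; last by have := conf_uniq hc2; rewrite lt.
  by move=> /andP[/= kb kc]; rewrite in_cons mem2 ?orbT.
move=> x y z /mem3 xc /mem3 yc /mem3 zc; exact: (cherry_notin_b hc1 ch).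
Qed.

End Realizes.

(** * Realization of trees *)

Lemma small_perturbation (R : realFieldType) (T : eqType) (s : seq T) (f g : T -> R) :
  {in s, forall x, 0 < f x} ->
  exists2 e : R, 0 < e & forall h, 0 < h -> h <= e -> {in s, forall x, 0 < f x + h * g x}.
Proof.
elim: s => [|x s IH] hf; first by exists 1.
have [|e e0 he] := IH; first by move=> y ys; apply: hf; rewrite inE ys orbT.
have fx : 0 < f x by apply: hf; rewrite mem_head.
have g0 : 0 < 1 + `|g x| by rewrite ltr_wpDr.
(* The 1 keeps the denominator positive; [h] times the absolute value of [g x] is then strictly less
   than [f x]. *)
exists (Order.min e (f x / (1 + `|g x|))); first by rewrite lt_min e0 divr_gt0.
move=> h h0; rewrite le_min => /andP[h1 h2] y; rewrite inE => /predU1P[->|ys]; last exact: he.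
have h3 : h * (1 + `|g x|) <= f x by rewrite -ler_pdivlMr.
have h4 : - (h * `|g x|) <= h * g x by rewrite -mulrN ler_pM2l // lerNl -normrN ler_norm.
by lra.
Qed.

(** * Splitting a black point into a cherry *)

Section Extend.
Variables (R : realFieldType) (I : eqType) (p : I -> 'rV[R]_2).
Variables (a b q : I) (s W : seq I).
Local Notation D x y z := (det3 (p x) (p y) (p z)).

(** [v] is the chord from the next to the previous neighbour of [b]: the line through [b] parallel
    to it supports the polygon. With a single other point there is no chord, and a perpendicular
    direction is taken; this is where distinctness of the points enters. *)
Lemma outward_direction : uniq (b :: s) -> ccw p (b :: s) -> {in b :: s &, injective p} ->
  exists v : 'rV[R]_2, forall k, k \in s -> 0 < det3 (p b + v) (p b) (p k).
Proof.
case: s => [|k s'] u cc pi; first by exists 0.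
case: (lastP s') u cc pi => [|m l] u cc pi.
  exists (\row_i (if i == 0 then - (p k 0 1 - p b 0 1) else p k 0 0 - p b 0 0)) => j.
  rewrite inE => /eqP->.
  rewrite /det3 !mxE /=.
  rewrite (_ : _ - _ = (p k 0 0 - p b 0 0) ^+ 2 + (p k 0 1 - p b 0 1) ^+ 2); last by ring.
  rewrite lt0r addr_ge0 ?sqr_ge0 // andbT paddr_eq0 ?sqr_ge0 // !sqrf_eq0 !subr_eq0.
  apply/negP => /andP[/eqP h0 /eqP h1].
  have : k = b.
    apply: pi; rewrite ?inE ?eqxx ?orbT //; apply/rowP; case=> [[|[|//]]] hi.
      by rewrite (_ : Ordinal hi = 0) //; apply: val_inj.
    by rewrite (_ : Ordinal hi = 1) //; apply: val_inj.
  by move=> e; move: u; rewrite e /= mem_head.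
exists (p l - p k) => j js.
have -> : det3 (p b + (p l - p k)) (p b) (p j) = D b j l + D b k j.
  by rewrite /det3 !mxE; ring.
have bkl : 0 < D b k l by apply: (ccw_head cc); rewrite mem_rcons mem_head.
move: js; rewrite inE mem_rcons inE => /or3P[/eqP->|/eqP->|jm].
- by rewrite det3_eq12 addr0.
- by rewrite det3_eq12 add0r.
have h1 : 0 < D b k j by apply: (ccw_head cc); rewrite mem_rcons inE jm orbT.
have h2 : 0 < D b j l.
  apply: cc; rewrite -[[:: b; j; l]]/([:: b; j] ++ [:: l]) -rcons_cons -rcons_cons -cats1.
  apply: cat_subseq => //; rewrite -[[:: b; j]]cat1s -[[:: b, k & m]]cat1s.
  by rewrite cat_subseq // sub1seq inE jm orbT.
by rewrite addr_gt0.
Qed.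

Hypotheses (hc : conf p (b :: s) W) (pi : {in b :: s &, injective p}).
Hypotheses (aN : a \notin b :: s) (qN : q \notin b :: s).
Hypotheses (aW : a \notin W) (qW : q \notin W) (aq : a != q).

(** The point [a] is placed slightly outward from [b], and [q] just inside the middle of the short
    edge [a b]. Smallness keeps the old strict inequalities when [b] is replaced by [a], and puts
    [q] into every triangle [a b k]. *)
Lemma cherry_extension : exists p' : I -> 'rV[R]_2,
  let D x y z := det3 (p' x) (p' y) (p' z) in
  [/\ forall k, k != a -> k != q -> p' k = p k,
      (forall k, k \in s -> 0 < D a b k) /\ (forall j k, subseq [:: j; k] s -> 0 < D a j k),
      forall w k, w \in W -> k \in s -> 0 < D a k w * D b k w,
      forall k, k \in s -> 0 < D a q k /\ 0 < D q b k & 0 < D a b q].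
Proof.
have [v hv] := outward_direction (conf_uniq hc) (conf_ccw hc) pi.
have [k0 k0s] : exists k, k \in s.
  by have := conf_size hc; case: (s) => // k s' _; exists k; rewrite mem_head.
have abk e k : det3 (p b + e *: v) (p b) (p k) = e * det3 (p b + v) (p b) (p k).
  by rewrite /det3 !mxE; ring.
pose prs := [seq jk <- [seq (j, k) | j <- s, k <- s] | subseq [:: jk.1; jk.2] s].
pose prw := [seq (k, w) | k <- s, w <- W].
have [|e1 e10 he1] := @small_perturbation R _ prs (fun jk => D b jk.1 jk.2)
  (fun jk => det3 (p b + v) (p jk.1) (p jk.2) - D b jk.1 jk.2).
  by move=> jk; rewrite mem_filter => /andP[h _]; apply: (conf_ccw hc); rewrite /= eqxx.
(* The sign of [D b k w] is unknown, so its square serves as the positive quantity: what persists is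
   that [D a k w] has the sign of [D b k w]. *)
have [|e2 e20 he2] := @small_perturbation R _ prw (fun kw => D b kw.1 kw.2 * D b kw.1 kw.2)
  (fun kw => (det3 (p b + v) (p kw.1) (p kw.2) - D b kw.1 kw.2) * D b kw.1 kw.2).
  move=> _ /allpairsP[[k w] [/= ks wW ->]] /=.
  have nbk : b != k by apply: contraTneq (conf_uniq hc) => ->; rewrite cons_uniq ks.
  have : D b k w != 0 by apply: (conf_gen hc) => //; rewrite inE ?eqxx // ks orbT.
  by move: (D b k w) => z; rewrite -expr2 exprn_even_gt0.
pose e := Order.min e1 e2.
have e0 : 0 < e by rewrite lt_min e10 e20.
pose A := p b + e *: v.
have abk0 k : k \in s -> 0 < det3 A (p b) (p k) by move=> ks; rewrite abk mulr_gt0 // hv.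
(* At [d = 0] this is the midpoint of the new edge, where [D a q k] and [D q b k] are half of
   [D a b k]; a small positive [d] moves it towards [k0], strictly inside. *)
pose Q d := 2^-1 *: (A + p b) + d *: (p k0 - p b).
have half k : k \in s -> 0 < 2^-1 * det3 A (p b) (p k).
  by move=> ks; rewrite mulr_gt0 ?invr_gt0 ?ltr0n // abk0.
have [d1 d10 hd1] := small_perturbation (fun k => det3 A (A + (p k0 - p b)) (p k)) half.
have [d2 d20 hd2] := small_perturbation (fun k => D b k k0) half.
pose d := Order.min d1 d2.
have d0 : 0 < d by rewrite lt_min d10 d20.
pose p' k := if k == a then A else if k == q then Q d else p k.
have pa : p' a = A by rewrite /p' eqxx.
have pq : p' q = Q d by rewrite /p' eq_sym (negbTE aq) eqxx.
have pE k : k != a -> k != q -> p' k = p k by rewrite /p' => /negbTE-> /negbTE->.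
have pc k : k \in b :: s -> p' k = p k.
  by move=> kc; apply: pE; apply: contraTneq kc => ->.
have pW k : k \in W -> p' k = p k by move=> kW; apply: pE; apply: contraTneq kW => ->.
have pb : p' b = p b by rewrite pc ?mem_head.
have ps k : k \in s -> p' k = p k by move=> ks; rewrite pc // inE ks orbT.
exists p'; split=> //.
- split=> [k ks|j k jks]; first by rewrite pa pb ps // abk0.
  have js : j \in s by apply: (mem_subseq jks); rewrite mem_head.
  have ks : k \in s by apply: (mem_subseq jks); rewrite !inE eqxx orbT.
  rewrite pa !ps //.
  have := he1 e e0; rewrite ge_min lexx => /(_ isT (j, k)).
  rewrite mem_filter jks allpairs_f // => /(_ isT) /=; congr (0 < _).
  by rewrite /A /det3 !mxE; ring.
- move=> w k wW ks; rewrite pa pb ps // pW //.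
  have := he2 e e0; rewrite ge_min lexx orbT => /(_ isT (k, w)).
  rewrite allpairs_f // => /(_ isT) /=; congr (0 < _).
  by rewrite /A /det3 !mxE; ring.
- move=> k ks; rewrite pa pb pq ps //; split.
    have := hd1 d d0; rewrite ge_min lexx => /(_ isT k ks); congr (0 < _).
    by rewrite /Q /det3 !mxE; field.
  have := hd2 d d0; rewrite ge_min lexx orbT => /(_ isT k ks); congr (0 < _).
  by rewrite /Q /det3 !mxE; field.
rewrite pa pb pq (_ : det3 A (p b) (Q d) = d * det3 A (p b) (p k0)); last first.
  by rewrite /Q /det3 !mxE; field.
by rewrite mulr_gt0 // abk0.
Qed.

End Extend.

Lemma conf_ext (R : realFieldType) (I : eqType) (p p' : I -> 'rV[R]_2) c W :
  {in c, p =1 p'} -> {in W, p =1 p'} -> conf p c W -> conf p' c W.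
Proof.
move=> ec eW [h1 h2 h3 h4 h5 h6 h7 h8]; split=> //.
- move=> x y z hs; have sub k : k \in [:: x; y; z] -> k \in c by apply: mem_subseq.
  rewrite -(ec x) ?sub ?inE ?eqxx // -(ec y) ?sub ?inE ?eqxx ?orbT //.
  by rewrite -(ec z) ?sub ?inE ?eqxx ?orbT //; apply: h1.
- by move=> w x y wW xc yc; rewrite -(ec x) // -(ec y) // -(eW w) //; apply: h5.
- move=> w wW; have [x [y [z [xc yc zc t]]]] := h6 w wW; exists x, y, z.
  by rewrite -(ec x) // -(ec y) // -(ec z) // -(eW w).
- move=> x y z xc yc zc /(h7 x y z xc yc zc)[w wW t]; exists w => //.
  by rewrite -(ec x) // -(ec y) // -(ec z) // -(eW w).
- move=> x y z w w' xc yc zc wW wW'; rewrite -(ec x) // -(ec y) // -(ec z) //.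
  by rewrite -(eW w) // -(eW w') //; apply: h8.
Qed.

Lemma conf_perm (R : realFieldType) (I : eqType) (p : I -> 'rV[R]_2) c W W' :
  perm_eq W W' -> conf p c W -> conf p c W'.
Proof.
move=> e [h1 h2 h3 h4 h5 h6 h7 h8]; split=> //.
- by rewrite -(perm_uniq e).
- by rewrite -(perm_size e).
- by move=> w x y; rewrite -(perm_mem e); apply: h5.
- by move=> w; rewrite -(perm_mem e); apply: h6.
- by move=> x y z xc yc zc u; have [w] := h7 x y z xc yc zc u; exists w; rewrite -?(perm_mem e).
- move=> x y z w w' xc yc zc; rewrite -!(perm_mem e); exact: h8.
Qed.

Lemma pos_mul_eq (R : realFieldType) (x y z : R) : 0 < x * y -> (0 < x * z) = (0 < y * z).
Proof.
move=> h; apply/idP/idP; last exact: mulr_gt0_trans.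
by apply: mulr_gt0_trans; rewrite mulrC.
Qed.

Lemma subseq_pair (I : eqType) (s : seq I) x y : x \in s -> y \in s -> x != y ->
  subseq [:: x; y] s \/ subseq [:: y; x] s.
Proof.
move=> xs; case/splitPr: xs => s1 s2; rewrite mem_cat inE => /or3P[ys|/eqP->|ys] nxy.
- by right; rewrite -[[:: y; x]]cat1s cat_subseq ?sub1seq ?mem_head.
- by rewrite eqxx in nxy.
by left; apply: subseq_trans (suffix_subseq s1 _); rewrite /= eqxx sub1seq.
Qed.

(** * The extended points form a configuration *)

Section ExtendConf.
Variables (R : realFieldType) (I : eqType) (p : I -> 'rV[R]_2).
Variables (a b q : I) (s W : seq I).
Local Notation D x y z := (det3 (p x) (p y) (p z)).
Local Notation tr w x y z := (in_tri (p w) (p x) (p y) (p z)).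

Hypotheses (hc : conf p (b :: s) W).
Hypotheses (aN : a \notin b :: s) (qW : q \notin W).
Hypotheses (abk : forall k, k \in s -> 0 < D a b k)
  (ajk : forall j k, subseq [:: j; k] s -> 0 < D a j k)
  (abw : forall w k, w \in W -> k \in s -> 0 < D a k w * D b k w)
  (aqk : forall k, k \in s -> 0 < D a q k /\ 0 < D q b k) (abq : 0 < D a b q).

Let s_b k : k \in s -> k \in b :: s. Proof. by rewrite inE => ->; rewrite orbT. Qed.

Lemma extend_ccw : ccw p [:: a, b & s].
Proof.
move=> x y z; rewrite /=; case: eqP => [->|_]; last exact: (conf_ccw hc).
case: eqP => [->|_]; last exact: ajk.
by rewrite sub1seq; apply: abk.
Qed.

Lemma extend_base w : w \in W -> 0 < D a b w.
Proof.
move=> wW; have [x [y [z [xc yc zc t]]]] := conf_in hc wW.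
apply: (halfplane_in_tri (c := b :: s) (x := b) (y := b)) xc yc zc t.
  by move=> k; rewrite inE => /predU1P[->|/abk/ltW //]; rewrite det3_eq12.
by move=> k; rewrite inE => /predU1P[->|/abk //]; rewrite eqxx.
Qed.

Lemma extend_tr_q k : k \in s -> tr q a b k.
Proof.
move=> ks; have [h1 h2] := aqk ks; apply: tr_posI => //.
  by rewrite det3C.
by rewrite -det3C.
Qed.

Lemma extend_tr w j k : w \in W -> j \in s -> k \in s -> tr w a j k = tr w b j k.
Proof.
move=> wW js ks; rewrite /in_tri (det3N (p a) (p k)) (det3N (p b) (p k)).
rewrite !mulrN -!mulNr ![- _ * _]mulrC.
congr (_ && _); first exact: pos_mul_eq (abw wW js).
exact: pos_mul_eq (abw wW ks).
Qed.

Lemma extend_only_q w k : w \in W -> k \in b :: s -> ~~ tr w a b k.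
Proof.
move=> wW; rewrite inE => /predU1P[->|ks]; apply/negP => t.
  by have := tr_uniq t; rewrite eqxx andbF.
have [_ h1 h2] := tr_pos (abk ks) t; have := abw wW ks.
by rewrite (det3N (p k) (p a)) mulNr oppr_gt0 ltNge (ltW (mulr_gt0 h2 h1)).
Qed.

Lemma extend_notin_a x y z : x \in b :: s -> y \in b :: s -> z \in b :: s -> ~~ tr q x y z.
Proof.
move=> xs ys zs; apply/negP => t.
have : 0 < D q b q.
  apply: (halfplane_in_tri (x := b) (y := b)) xs ys zs t.
    by move=> k; rewrite inE => /predU1P[->|/aqk[_ /ltW //]]; rewrite det3_eq12.
  by move=> k; rewrite inE => /predU1P[->|/aqk[]//]; rewrite eqxx.
by rewrite det3_eq02 ltxx.
Qed.

Lemma extend_notin_b x y z : x \in a :: s -> y \in a :: s -> z \in a :: s -> ~~ tr q x y z.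
Proof.
move=> xs ys zs; apply/negP => t.
have : 0 < D a q q.
  apply: (halfplane_in_tri (x := a) (y := a)) xs ys zs t.
    by move=> k; rewrite inE => /predU1P[->|/aqk[/ltW //]]; rewrite det3_eq02.
  by move=> k; rewrite inE => /predU1P[->|/aqk[]//]; rewrite eqxx.
by rewrite det3_eq12 ltxx.
Qed.

Let k0s : exists k, k \in s.
Proof. by have := conf_size hc; case: (s) => // k s' _; exists k; rewrite mem_head. Qed.

Lemma extend_conf : conf p [:: a, b & s] (q :: W).
Proof.
have nab : a != b by apply: contraNneq aN => ->; rewrite mem_head.
have nas k : k \in s -> k != a by move=> ks; apply: contraNneq aN => <-; apply: s_b.
have nbs k : k \in s -> k != b.
  by move=> ks; apply: contraTneq (conf_uniq hc) => <-; rewrite cons_uniq ks.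
have cc := extend_ccw.
(* Triples of distinct points of [a :: b :: s] are, up to order, of three kinds: without [a], with
   [a] and [b], with [a] but not [b]. *)
have triple (P : I -> I -> I -> Prop) : (forall x y z, P x y z -> P y x z) ->
    (forall x y z, P x y z -> P y z x) ->
    (forall x y z, x \in b :: s -> y \in b :: s -> z \in b :: s ->
       [&& x != y, y != z & z != x] -> P x y z) ->
    (forall k, k \in s -> P a b k) -> (forall j k, j \in s -> k \in s -> j != k -> P a j k) ->
    forall x y z, x \in [:: a, b & s] -> y \in [:: a, b & s] -> z \in [:: a, b & s] ->
    [&& x != y, y != z & z != x] -> P x y z.
  move=> Psw Prot h1 h2 h3.
  have ha y z : y \in b :: s -> z \in b :: s -> y != z -> P a y z.
    rewrite !inE => /predU1P[->|ys] /predU1P[->|zs]; rewrite ?eqxx // => nyz.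
    - exact: h2.
    - by apply: Prot; apply: Psw; apply: h2.
    exact: h3.
  move=> x y z; rewrite ![_ \in a :: _]in_cons.
  case/predU1P=> [->|xs] /predU1P[->|ys] /predU1P[->|zs]; rewrite ?eqxx ?andbF //= => /and3P[xy yz zx].
  - exact: ha.
  - by apply/Prot/Prot/ha.
  - by apply: Prot; apply: ha.
  by apply: h1; rewrite // xy yz.
split=> //.
- by rewrite cons_uniq aN (conf_uniq hc).
- by rewrite cons_uniq qW (conf_uniqW hc).
- by rewrite /= -(conf_size hc).
(* A line through two old points [x], [y] other than [b] has [a] and [b] on the same side, and [q]
   lies in the triangle [a b x], hence on that side as well. *)
- have genq x y : subseq [:: x; y] s -> 0 < D x y q.
    move=> xys; have xs : x \in s by apply: (mem_subseq xys); rewrite mem_head.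
    have ys : y \in s by apply: (mem_subseq xys); rewrite !inE eqxx orbT.
    have ayx : 0 < D x y a by rewrite -det3C -det3C; apply: ajk.
    have bxy : 0 < D x y b by rewrite -det3C -det3C; apply: (conf_ccw hc); rewrite /= eqxx.
    have x0 : D x y x = 0 by rewrite det3_eq02.
    apply: in_tri_gt0 (extend_tr_q xs) (ltW ayx) (ltW bxy) _ _; rewrite x0 ?lexx //.
    by rewrite addr0; apply: addr_gt0 ayx bxy.
  have pair w : D a b w != 0 -> (forall k, k \in s -> D a k w != 0) ->
      (forall k, k \in s -> D b k w != 0) ->
      (forall x y, x \in s -> y \in s -> x != y -> D x y w != 0) ->
      forall x y, x \in [:: a, b & s] -> y \in [:: a, b & s] -> x != y -> D x y w != 0.
    move=> h1 h2 h3 h4 x y.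
    have sym u v : D u v w != 0 -> D v u w != 0 by rewrite (det3N (p u)) oppr_eq0.
    rewrite !inE => /or3P[/eqP->|/eqP->|xs] /or3P[/eqP->|/eqP->|ys]; rewrite ?eqxx // => nxy.
    - exact: h2.
    - exact: sym.
    - exact: h3.
    - by apply: sym; apply: h2.
    - by apply: sym; apply: h3.
    exact: h4.
  move=> w u v; rewrite inE => /predU1P[->|wW]; apply: pair => [|k ks|k ks|x y xs ys nxy].
  + by rewrite gt_eqF.
  + by rewrite det3S oppr_eq0 gt_eqF //; case: (aqk ks).
  + by rewrite -det3C -det3C gt_eqF //; case: (aqk ks).
  + have [/genq h|/genq h] := subseq_pair xs ys nxy; first by rewrite gt_eqF.
    by rewrite det3N oppr_eq0 gt_eqF.
  + by rewrite gt_eqF // extend_base.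
  + by apply/eqP => e; have := abw wW ks; rewrite e mul0r ltxx.
  + by apply/eqP => e; have := abw wW ks; rewrite e mulr0 ltxx.
  by apply: (conf_gen hc) => //; apply: s_b.
- move=> w; rewrite inE => /predU1P[->|/(conf_in hc)[x [y [z [xs ys zs t]]]]].
    by have [k ks] := k0s; exists a, b, k; rewrite !inE !eqxx ks !orbT extend_tr_q.
  by exists x, y, z; rewrite ![_ \in a :: _]in_cons xs ys zs !orbT.
- apply: triple => [x y z [w]|x y z [w]|x y z xs ys zs u|k ks|j k js ks njk].
  + by exists w => //; rewrite in_triN.
  + by exists w => //; rewrite in_triC.
  + by have [w wW t] := conf_ex hc xs ys zs u; exists w; rewrite // inE wW orbT.
  + by exists q; rewrite ?mem_head ?extend_tr_q.
  have [|w wW t] := conf_ex hc (mem_head b s) (s_b js) (s_b ks).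
    by rewrite njk (eq_sym b) !nbs.
  by exists w; rewrite ?extend_tr // inE wW orbT.
move=> x y z w w' xc yc zc wW wW' t t'; have u := tr_uniq t.
pose P x y z := forall w w', w \in q :: W -> w' \in q :: W -> tr w x y z -> tr w' x y z -> w = w'.
suff : P x y z by apply.
move: x y z xc yc zc u {t t' w w' wW wW'}.
apply: triple => [x y z h|x y z h|x y z xs ys zs _|k ks|j k js ks _] w w'.
- by rewrite !(in_triN _ (p x)); apply: h.
- by rewrite !(in_triC _ (p x)); apply: h.
- rewrite !in_cons => /predU1P[->|wW].
    by move=> _ t; have := extend_notin_a xs ys zs; rewrite t.
  move=> /predU1P[->|wW']; first by move=> _ t; have := extend_notin_a xs ys zs; rewrite t.
  exact: (conf_un hc).
- rewrite !in_cons => /predU1P[->|wW] /predU1P[->|wW'] // t t'.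
  + by have := extend_only_q wW' (s_b ks); rewrite t'.
  + by have := extend_only_q wW (s_b ks); rewrite t.
  by have := extend_only_q wW (s_b ks); rewrite t.
have nb := extend_notin_b (mem_head a s) (_ : j \in a :: s) (_ : k \in a :: s).
rewrite !in_cons js ks !orbT in nb; have {}nb := nb isT isT.
rewrite !in_cons => /predU1P[->|wW]; first by move=> _ t; rewrite t in nb.
move=> /predU1P[->|wW']; first by move=> _ t; rewrite t in nb.
rewrite !extend_tr //; exact: (conf_un hc (mem_head b s) (s_b js) (s_b ks)).
Qed.

End ExtendConf.

Lemma graft_id (T : eqType) (b : T) s t : b \notin labels t -> graft b s t = t.
Proof.
elim: t => [v|v L hL M hM] /=; first by rewrite inE eq_sym => /negbTE->.
by rewrite inE mem_cat !negb_or => /and3P[_ /hL-> /hM->].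
Qed.

(** At the bottom of the tree some node has two leaves as children; contracting it to its right leaf
    [b] gives [t']. Distinct labels ensure that grafting at [b] changes nothing elsewhere. *)
Lemma bt_cherry (T : eqType) (t : bt T) : uniq (labels t) -> nodes t != [::] ->
  exists t' a b q, [/\ t = graft b (Node q (Leaf a) (Leaf b)) t', b \in leaves t',
    uniq (labels t'), {subset labels t' <= labels t} &
    [/\ a \notin labels t', q \notin labels t', a != q, a \in labels t & q \in labels t]].
Proof.
elim: t => // v L hL M hM u _; have [uL uM vL vM d] := uniq_labelsP u.
case nL: (nodes L) => [|w ws].
  case nM: (nodes M) => [|w ws].
    case: L nL {hL} u uL vL d => // a _ u uL vL d; case: M nM {hM} u uM vM d => // b _ u uM vM d.
    exists (Leaf b), a, b, v; split; rewrite /= ?eqxx ?mem_head //.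
      by move=> k; rewrite !inE => ->; rewrite !orbT.
    have := d a; rewrite !inE eqxx => /(_ isT) ab; rewrite inE in vL; rewrite inE in vM.
    by rewrite ab vM (eq_sym a) vL ?eqxx ?orbT.
  have [|t' [a [b [q [e bl ut' sub [h1 h2 h3 h4 h5]]]]]] := hM uM; first by rewrite nM.
  have d' k : k \in labels M -> k \notin labels L by move=> kM; apply: contraL kM; apply: d.
  have nv k : k \in labels M -> k != v by move=> kM; apply: contraNneq vM => <-.
  exists (Node v L t'), a, b, q; split.
  - by rewrite /= -e graft_id // d' // sub // leaves_sub.
  - by rewrite /= mem_cat bl orbT.
  - rewrite /= mem_cat negb_or vL cat_uniq uL ut' !andbT; apply/andP; split.
      by apply: contra vM; apply: sub.
    by apply/hasPn => k /sub /d'.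
  - by move=> k; rewrite /= !inE !mem_cat => /or3P[->|->|/sub->]; rewrite ?orbT.
  by rewrite /= !inE !mem_cat !negb_or h1 h2 h3 h4 h5 !nv ?d' ?orbT.
have [|t' [a [b [q [e bl ut' sub [h1 h2 h3 h4 h5]]]]]] := hL uL; first by rewrite nL.
have nv k : k \in labels L -> k != v by move=> kM; apply: contraNneq vL => <-.
exists (Node v t' M), a, b, q; split.
- by rewrite /= -e graft_id // d // sub // leaves_sub.
- by rewrite /= mem_cat bl.
- rewrite /= mem_cat negb_or vM cat_uniq uM ut' !andbT; apply/andP; split.
    by apply: contra vL; apply: sub.
  by apply/hasPn => k kM; apply: contraL kM => /sub /d.
- by move=> k; rewrite /= !inE !mem_cat => /or3P[->|/sub->|->]; rewrite ?orbT.
by rewrite /= !inE !mem_cat !negb_or h1 h2 h3 h4 h5 !nv ?d ?orbT.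
Qed.

(** Injectivity is carried along for [outward_direction], since [conf] imposes nothing on the
    positions of two black points without white ones. *)
Lemma bt_realization (R : realFieldType) (T : eqType) r (t : bt T) : uniq (r :: labels t) ->
  exists p : T -> 'rV[R]_2, [/\ conf p (r :: leaves t) (nodes t), realizes p r t &
    {in r :: leaves t &, injective p}].
Proof.
elim: {t}(size (nodes t)) {-2}t (erefl (size (nodes t))) => [|n IH] t ht u.
  case: t ht u => // v _; rewrite /= inE andbT => rv.
  exists (fun k => if k == r then 0 else const_mx 1); split=> //.
  - split=> //.
    + by move=> x y z /size_subseq.
    + by rewrite /= inE rv.
    + move=> x y z; rewrite !inE => /orP[]/eqP-> /orP[]/eqP-> /orP[]/eqP->;
      by rewrite ?eqxx ?andbF //= => /and3P[].
  - move=> x y; rewrite !inE => /orP[]/eqP-> /orP[]/eqP->; rewrite ?eqxx // eq_sym (negbTE rv).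
      by move=> /rowP/(_ 0); rewrite !mxE => /esym/eqP; rewrite oner_eq0.
    by move=> /rowP/(_ 0); rewrite !mxE => /eqP; rewrite oner_eq0.
have [ru ut] : r \notin labels t /\ uniq (labels t) by move: u; rewrite cons_uniq => /andP[].
have [|t' [a [b [q [e bl ut' sub [h1 h2 h3 h4 h5]]]]]] := bt_cherry ut.
  by rewrite -size_eq0 ht.
have rt' : uniq (r :: labels t') by rewrite cons_uniq ut' andbT; apply: contra ru; apply: sub.
have ra : a \notin r :: labels t' by rewrite inE negb_or h1 andbT; apply: contraNneq ru => <-.
have rq : q \notin r :: labels t' by rewrite inE negb_or h2 andbT; apply: contraNneq ru => <-.
have ul' := uniq_labels_leaves ut'.
have pn := nodes_graft a q ul' bl.
have [|p [hc rp ip]] := IH t' _ rt'.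
  by have := perm_size pn; rewrite -e ht => -[].
have [s1 [s2 el]] : exists s1 s2, leaves t' = s1 ++ b :: s2.
  by case/splitPr: bl => s1 s2; exists s1, s2.
rewrite el in hc ip; set s := s2 ++ r :: s1.
have {}hc : conf p (b :: s) (nodes t') by exact: (conf_cat (s1 := r :: s1) (s2 := b :: s2) hc).
have mem k : (k \in r :: leaves t') = (k \in b :: s).
  by rewrite el -cat_cons mem_cat orbC -mem_cat.
have {}ip : {in b :: s &, injective p}.
  by move=> x y; rewrite -!mem el; apply: ip.
have memL k : k \in r :: leaves t' -> k \in r :: labels t'.
  by rewrite !inE => /orP[->|/leaves_sub->]; rewrite ?orbT.
have memN k : k \in nodes t' -> k \in r :: labels t'.
  by move=> /nodes_sub h; rewrite inE h orbT.
have aN : a \notin b :: s by rewrite -mem; apply: contra ra; apply: memL.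
have qN : q \notin b :: s by rewrite -mem; apply: contra rq; apply: memL.
have aW : a \notin nodes t' by apply: contra ra; apply: memN.
have qW : q \notin nodes t' by apply: contra rq; apply: memN.
have [p' [pE [abk ajk] abw aqk abq]] := cherry_extension hc ip aN qN aW qW h3.
have pE' k : k \in r :: labels t' -> p' k = p k.
  by move=> kl; apply: pE; apply: contraTneq kl => ->.
have hc' : conf p' (b :: s) (nodes t').
  apply: conf_ext hc => k hk; rewrite pE' //; last exact: memN.
  by apply: memL; rewrite mem.
have sl k : k \in r :: leaves t' -> k != b -> k \in s.
  by rewrite mem inE => /predU1P[->|//]; rewrite eqxx.
have eL : leaves t = s1 ++ [:: a, b & s2] by rewrite e (leaves_graft_cat _ el).
have cc : conf p' [:: a, b & s] (q :: nodes t').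
  exact: (extend_conf hc' aN qW abk ajk abw aqk abq).
exists p'; split.
- rewrite eL; apply: (conf_cat (s1 := [:: a, b & s2]) (s2 := r :: s1)).
  by apply: conf_perm cc; rewrite e perm_sym.
- rewrite e; apply: realizes_graft => //.
  + move=> w x y z wW xc yc zc; rewrite -(rp w x y z) //.
    by rewrite (pE' w (memN _ wW)) (pE' x (memL _ xc)) (pE' y (memL _ yc)) (pE' z (memL _ zc)).
  + by move=> k kc kb; apply: (extend_tr_q aqk abq (sl k kc kb)).
  + by move=> w j k wW jc kc jb kb; apply: (extend_tr abw wW (sl _ jc jb) (sl _ kc kb)).
  + by move=> w k wW; rewrite mem => kc; apply: (extend_only_q abk abw).
  + by move=> x y z; rewrite !mem; apply: (extend_notin_a aqk).
  have mem3 k : k \in a :: rem b (r :: leaves t') -> k \in a :: s.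
    rewrite !in_cons => /predU1P[->|]; first by rewrite eqxx.
    rewrite mem_rem_uniq => [/andP[/= kb kc]|]; first by rewrite sl ?orbT.
    have : uniq (b :: s) := conf_uniq hc.
    by rewrite el -[r :: _]/((r :: s1) ++ b :: s2) -[b :: s]/((b :: s2) ++ r :: s1) uniq_catC.
  by move=> x y z /mem3 xc /mem3 yc /mem3 zc; apply: (extend_notin_b aqk).
have nab k : k \in b :: s -> p' a <> p' k.
  rewrite in_cons => /predU1P[->|ks] e'.
    have [k0 k0s] : exists k, k \in s by exists r; rewrite mem_cat mem_head orbT.
    by have := abk k0 k0s; rewrite e' det3aa ltxx.
  by have := abk k ks; rewrite e' det3_eq02 ltxx.
have ab_mem k : k \in r :: leaves t -> k \in a :: b :: s.
  rewrite eL -cat_cons mem_cat orbC -mem_cat; exact.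
have ip' : {in b :: s &, injective p'}.
  move=> x y xc yc; rewrite -mem in xc; rewrite -mem in yc.
  by rewrite (pE' x (memL _ xc)) (pE' y (memL _ yc)); apply: ip; rewrite -mem.
move=> x y /ab_mem + /ab_mem; rewrite ![_ \in a :: _]in_cons.
move=> /predU1P[->|xc] /predU1P[->|yc] // e'; first by case: (nab y yc).
  by case: (nab x xc).
exact: ip'.
Qed.

(** * Rigidity of orientations *)

Lemma conf_map (R : realFieldType) (I J : eqType) (p : J -> 'rV[R]_2) (f : I -> J) c W :
  injective f -> conf p (map f c) (map f W) -> conf (p \o f) c W.
Proof.
move=> fi [h1 h2 h3 h4 h5 h6 h7 h8]; split.
- by move=> x y z hs; apply: (h1 (f x) (f y) (f z)); have := map_subseq f hs.
- by rewrite (map_inj_uniq fi) in h2.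
- by rewrite (map_inj_uniq fi) in h3.
- by move: h4; rewrite !size_map.
- by move=> w x y wW xc yc nxy; apply: h5; rewrite ?map_f // inj_eq.
- move=> w wW.
  have [_ [_ [_ [/mapP[x xc ->] /mapP[y yc ->] /mapP[z zc ->] t]]]] := h6 _ (map_f f wW).
  by exists x, y, z.
- move=> x y z xc yc zc u; have [|_ /mapP[w wW ->] t] :=
    h7 (f x) (f y) (f z) (map_f f xc) (map_f f yc) (map_f f zc).
    by rewrite !(inj_eq fi).
  by exists w.
- by move=> x y z w w' xc yc zc wW wW' t t'; apply/fi/(h8 (f x) (f y) (f z)) => //; apply: map_f.
Qed.

(** Turns clockwise lists into counterclockwise ones without changing containments, so that [conf],
    which fixes the direction, covers both. *)
Definition reflect_pt (R : realFieldType) (v : 'rV[R]_2) : 'rV[R]_2 :=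
  \row_i (if i == 0 then - v 0 0 else v 0 1).

Lemma det3_reflect (R : realFieldType) (u v w : 'rV[R]_2) :
  det3 (reflect_pt u) (reflect_pt v) (reflect_pt w) = - det3 u v w.
Proof. by rewrite /det3 !mxE /=; ring. Qed.

Lemma in_tri_reflect (R : realFieldType) (w x y z : 'rV[R]_2) :
  in_tri (reflect_pt w) (reflect_pt x) (reflect_pt y) (reflect_pt z) = in_tri w x y z.
Proof. by rewrite /in_tri !det3_reflect !mulrNN. Qed.

Lemma ccw_reflect (R : realFieldType) (I : eqType) (p : I -> 'rV[R]_2) c :
  ccw p (rev c) -> ccw (@reflect_pt R \o p) c.
Proof.
move=> h x y z hs; rewrite /= det3_reflect oppr_gt0.
have : 0 < det3 (p z) (p y) (p x) by apply: h; rewrite -[[:: z; y; x]]/(rev [:: x; y; z]) subseq_rev.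
by rewrite det3N oppr_gt0 det3C.
Qed.

Lemma conf_reflect (R : realFieldType) (I : eqType) (p : I -> 'rV[R]_2) c W :
  conf p (rev c) W -> conf (@reflect_pt R \o p) c W.
Proof.
case=> h1 h2 h3 h4 h5 h6 h7 h8; split => //=.
- exact: ccw_reflect.
- by rewrite rev_uniq in h2.
- by rewrite size_rev in h4.
- by move=> w x y wW xc yc nxy; rewrite det3_reflect oppr_eq0 h5 ?mem_rev.
- move=> w /h6[x [y [z []]]]; rewrite !mem_rev => xc yc zc t.
  by exists x, y, z; rewrite in_tri_reflect.
- move=> x y z xc yc zc u; have [||||w wW t] := h7 x y z; rewrite ?mem_rev //.
  by exists w; rewrite ?in_tri_reflect.
- by move=> x y z w w' xc yc zc wW wW'; rewrite !in_tri_reflect; apply: h8; rewrite ?mem_rev.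
Qed.

Section SameOrientations.
Variables (R : realFieldType) (I : eqType) (p p' : I -> 'rV[R]_2) (c W : seq I).
Hypotheses (hc : conf p c W) (hc' : conf p' c W) (st : same_tr p p' c W).
Hypothesis cW : forall i, (i \in c) || (i \in W).
Hypothesis gen : forall x y z, [&& x != y, y != z & z != x] -> det3 (p x) (p y) (p z) != 0.
Hypothesis gen' : forall x y z, [&& x != y, y != z & z != x] -> det3 (p' x) (p' y) (p' z) != 0.

(** Rigidity transfers positivity in both directions, and in general position this determines the
    sign. Up to swaps and rotations only the number of white points in the triple matters. *)
Lemma same_orientations x y z :
  Num.sg (det3 (p x) (p y) (p z)) = Num.sg (det3 (p' x) (p' y) (p' z)).
Proof.
have [->|xy] := eqVneq x y; first by rewrite !det3aa.
have [->|yz] := eqVneq y z; first by rewrite !det3_eq12.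
have [->|zx] := eqVneq z x; first by rewrite !det3_eq02.
have u : [&& x != y, y != z & z != x] by rewrite xy yz.
pose S x y z := [&& x != y, y != z & z != x] ->
  (0 < det3 (p x) (p y) (p z)) = (0 < det3 (p' x) (p' y) (p' z)).
have neg (r : R) : r != 0 -> (0 < - r) = ~~ (0 < r) by rewrite oppr_gt0; case: ltrgt0P.
have SN i j k : S i j k -> S j i k.
  move=> h v; have v' : [&& i != j, j != k & k != i].
    by case/and3P: v => v1 v2 v3; rewrite eq_sym v1 (eq_sym j) v3 eq_sym v2.
  by rewrite det3N (det3N (p' i)) !neg ?gen ?gen' // h.
have SC i j k : S i j k -> S j k i.
  by move=> h /and3P[v1 v2 v3]; rewrite (det3C (p i)) (det3C (p' i)) h // v1 v2 v3.
have iff (a b : bool) : (a -> b) -> (b -> a) -> a = b by move=> h1 h2; apply/idP/idP.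
have st' := same_tr_sym st.
have bbb i j k : i \in c -> j \in c -> k \in c -> S i j k.
  move=> ic jc kc v; move: i j k ic jc kc v (v); apply: (@perm3_ind _ c S) => // i j k hs v.
  by rewrite (conf_ccw hc hs) (conf_ccw hc' hs).
have bbw i j k : i \in c -> j \in c -> k \in W -> S i j k.
  by move=> ic jc kW _; apply: iff; [apply: (conf_bbw_rigid hc hc') | apply: (conf_bbw_rigid hc' hc)].
have bww i j k : i \in c -> j \in W -> k \in W -> S i j k.
  by move=> ic jc kW _; apply: iff; [apply: (conf_bww_rigid hc hc') | apply: (conf_bww_rigid hc' hc)].
have www i j k : i \in W -> j \in W -> k \in W -> S i j k.
  by move=> ic jc kW _; apply: iff; [apply: (conf_www_rigid hc hc') | apply: (conf_www_rigid hc' hc)].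
have : S x y z.
  case/orP: (cW x) => xc; case/orP: (cW y) => yc; case/orP: (cW z) => zc.
  - exact: bbb.
  - exact: bbw.
  - by apply/SC/bbw.
  - exact: bww.
  - by apply/SC/SC/bbw.
  - by apply/SC/SC/bww.
  - by apply/SC/bww.
  exact: www.
move=> /(_ u); have := gen u; have := gen' u.
case: (ltrgt0P (det3 (p x) (p y) (p z))) => // h;
  case: (ltrgt0P (det3 (p' x) (p' y) (p' z))) => // h' _ _ _.
  by rewrite !gtr0_sg.
by rewrite !ltr0_sg.
Qed.

End SameOrientations.

Lemma pairwise_unique (T : eqType) (e : rel T) (s s' : seq T) :
  (forall x y, e x y -> ~~ e y x) -> pairwise e s -> pairwise e s' -> perm_eq s s' -> s = s'.
Proof.
move=> asym; elim: s s' => [|x s IH] [|y s'] //.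
- by move=> _ _ /perm_size.
- by move=> _ _ /perm_size.
move=> /= /andP[xs ps] /andP[ys ps'] h.
have exy : x = y.
  apply/eqP; apply: contraT => nxy.
  have := perm_mem h x; have := perm_mem h y.
  rewrite !inE !eqxx (negbTE nxy) (eq_sym y) (negbTE nxy) /= => /(allP xs) e1 /esym/(allP ys) e2.
  by have := asym _ _ e1; rewrite e2.
by subst y; rewrite (IH s') //; move: h; rewrite perm_cons.
Qed.

(** Around [r] the relation of turning left is asymmetric and orders both lists, and a list so
    ordered is determined by its elements. *)
Lemma ccw_unique (R : realFieldType) (I : eqType) (p : I -> 'rV[R]_2) r s s' :
  perm_eq s s' -> ccw p (r :: s) -> ccw p (r :: s') -> s = s'.
Proof.
move=> h c1 c2; apply: (pairwise_unique (e := fun y z => 0 < det3 (p r) (p y) (p z))) h.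
- by move=> x y h; rewrite det3S oppr_gt0 -leNgt ltW.
all: apply/(pairwiseP r) => i j hi hj ij.
  by apply/c1/(@nth_subseq3 _ r (r :: s) 0 i.+1 j.+1).
by apply/c2/(@nth_subseq3 _ r (r :: s') 0 i.+1 j.+1).
Qed.

Local Open Scope classical_set_scope.
Local Open Scope ring_scope.

(** * Convex hulls and boundary orders *)

Section ConvHull.
Variables (R : realType) (D : nat).
Implicit Types (A B : set 'rV[R]_D) (x y z : 'rV[R]_D).

Lemma conv_hull_sub A B : A `<=` B -> conv_hull A `<=` conv_hull B.
Proof.
by move=> AB _ [n [y [w [Ay w0 w1 ->]]]]; exists n, y, w; split=> // i; apply/AB.
Qed.

Lemma conv_hull1 A x : A x -> conv_hull A x.
Proof.
move=> Ax; exists 1%N, (fun=> x), (fun=> 1); split=> //.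
  by rewrite big_ord1.
by rewrite big_ord1 scale1r.
Qed.

Lemma conv_hull3 A x y z (s t u : R) : A x -> A y -> A z -> 0 <= s -> 0 <= t -> 0 <= u ->
  s + t + u = 1 -> conv_hull A (s *: x + t *: y + u *: z).
Proof.
move=> Ax Ay Az s0 t0 u0 e.
exists 3%N, (fun i : 'I_3 => nth x [:: x; y; z] i), (fun i : 'I_3 => nth 0 [:: s; t; u] i).
split; [by case=> [[|[|[|]]]] | by case=> [[|[|[|]]]] | |].
  by rewrite !big_ord_recl big_ord0 /= addr0 addrA.
by rewrite !big_ord_recl big_ord0 /= addr0 addrA.
Qed.

Lemma conv_hull2 A x y (s t : R) : A x -> A y -> 0 <= s -> 0 <= t ->
  s + t = 1 -> conv_hull A (s *: x + t *: y).
Proof.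
move=> Ax Ay s0 t0 e; have := conv_hull3 Ax Ay Ay s0 t0 (lexx 0).
by rewrite scale0r !addr0; apply.
Qed.

Lemma sum_scale_mulmx n (w : 'I_n -> R) (y : 'I_n -> 'rV[R]_D) (c : 'cV[R]_D) :
  ((\sum_i w i *: y i) *m c) 0 0 = \sum_i w i * (y i *m c) 0 0.
Proof.
by rewrite mulmx_suml summxE; apply: eq_bigr => i _; rewrite -scalemxAl mxE.
Qed.

(** The slacks of the generators are nonnegative and their weighted sum vanishes, so every point
    with nonzero weight is on the hyperplane. *)
Lemma conv_hull_face A (c : 'cV[R]_D) (b : R) x :
  (forall y, A y -> (y *m c) 0 0 <= b) -> conv_hull A x -> (x *m c) 0 0 = b ->
  conv_hull (A `&` [set y | (y *m c) 0 0 = b]) x.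
Proof.
move=> hA [n [y [w [Ay w0 w1 ->]]]] hb.
have slack0 : \sum_i w i * (b - (y i *m c) 0 0) = 0.
  under eq_bigr => i _ do rewrite mulrBr.
  by rewrite sumrB -sum_scale_mulmx hb -mulr_suml w1 mul1r subrr.
have each i : w i * (b - (y i *m c) 0 0) = 0.
  move/eqP: slack0; rewrite psumr_eq0; last by move=> j _; rewrite mulr_ge0 ?subr_ge0 ?hA.
  by move/allP/(_ i); rewrite mem_index_enum => /(_ isT) /eqP.
have [i0 wi0] : exists i, w i != 0.
  apply/not_existsP => h; move: w1; rewrite big1 => [/esym/eqP|i _].
    by rewrite oner_eq0.
  by apply/eqP/negP => hh; apply: (h i); apply/negP.
have on i : w i != 0 -> (A `&` [set y | (y *m c) 0 0 = b]) (y i).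
  move=> wi; split; first exact: Ay.
  move/eqP: (each i); rewrite mulf_eq0 (negbTE wi) /= subr_eq0 => /eqP.
  by move->.
(* Points of weight 0 may be off the hyperplane and are replaced by [y i0], which is on it. *)
exists n, (fun i => if w i == 0 then y i0 else y i), w; split=> //.
  by move=> i; case: eqP => [_|/eqP]; apply: on.
by apply: eq_bigr => i _; case: eqP => // ->; rewrite !scale0r.
Qed.

Lemma conv_hull_le A (c : 'cV[R]_D) (b : R) x :
  (forall y, A y -> (y *m c) 0 0 <= b) -> conv_hull A x -> (x *m c) 0 0 <= b.
Proof.
move=> hA [n [y [w [Ay w0 w1 ->]]]]; rewrite sum_scale_mulmx.
rewrite -[leRHS]mul1r -w1 mulr_suml; apply: ler_sum => i _.
by rewrite ler_wpM2l // hA.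
Qed.

Lemma conv_hull_eq A (c : 'cV[R]_D) (b : R) x :
  (forall y, A y -> (y *m c) 0 0 = b) -> conv_hull A x -> (x *m c) 0 0 = b.
Proof.
move=> hA [n [y [w [Ay w0 w1 ->]]]]; rewrite sum_scale_mulmx.
under eq_bigr => i _ do rewrite hA //.
by rewrite -mulr_suml w1 mul1r.
Qed.

End ConvHull.

Section Planar.
Variables (R : realType).
Implicit Types (a b c p x y z : 'rV[R]_2).

Lemma row2P a b : a 0 0 = b 0 0 -> a 0 1 = b 0 1 -> a = b.
Proof.
move=> h0 h1; apply/rowP; case=> [[|[|//]]] hi.
  by rewrite (_ : Ordinal hi = 0) //; apply: val_inj.
by rewrite (_ : Ordinal hi = 1) //; apply: val_inj.
Qed.

Lemma det3_baryE a b c p : det3 a b c *: p =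
  det3 b c p *: a + det3 c a p *: b + det3 a b p *: c.
Proof. by apply: row2P; rewrite !mxE /det3; ring. Qed.

Lemma in_tri_in_triangle p a b c : in_tri p a b c -> in_triangle p a b c.
Proof.
have pos a' b' c' : 0 < det3 a' b' c' -> in_tri p a' b' c' -> in_triangle p a' b' c'.
  move=> h; rewrite in_tri_pos // => /and3P[h1 h2 h3]; set d := det3 a' b' c' in h *.
  exists (det3 b' c' p / d), (det3 c' a' p / d), (det3 a' b' p / d).
  split; rewrite ?divr_gt0 //.
    rewrite -!mulrDl (_ : _ + _ = d) ?divff ?gt_eqF //.
    by rewrite /d (det3_4 a' b' c' p) (det3N c' a'); ring.
  apply: (scalerI (lt0r_neq0 h)); rewrite det3_baryE !scalerDr !scalerA.
  by rewrite !mulrA ![d * _]mulrC !mulfK ?gt_eqF.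
case: (ltrgt0P (det3 a b c)) => h; first exact: pos.
  rewrite -in_triN => /pos; rewrite det3N oppr_gt0 => /(_ h).
  case=> s [t [u [s0 t0 u0 e ->]]]; exists t, s, u; split=> //; first by rewrite (addrC t).
  by rewrite (addrC (s *: b)).
by move=> /in_tri_neq0; rewrite h eqxx.
Qed.

Lemma in_triangle_in_tri p a b c : det3 a b c != 0 ->
  in_triangle p a b c -> in_tri p a b c.
Proof.
move=> nz [s [t [u [s0 t0 u0 e ->]]]]; rewrite /in_tri.
set q := _ + _ + _.
have s1 : s = 1 - t - u by lra.
have -> : det3 a b q = u * det3 a b c by rewrite /q s1 /det3 !mxE; ring.
have -> : det3 b c q = s * det3 a b c by rewrite /q s1 /det3 !mxE; ring.
have -> : det3 c a q = t * det3 a b c by rewrite /q s1 /det3 !mxE; ring.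
have sq : 0 < det3 a b c * det3 a b c by rewrite -expr2 exprn_even_gt0.
by rewrite ![_ * det3 a b c * _]mulrACA !(mulr_gt0 (mulr_gt0 _ _) sq).
Qed.

Lemma in_triangleP p a b c : det3 a b c != 0 ->
  in_triangle p a b c <-> in_tri p a b c.
Proof. by move=> nz; split; [apply: in_triangle_in_tri | apply: in_tri_in_triangle]. Qed.

Lemma orientationE a b c : orientation a b c = Num.sg (det3 a b c).
Proof. by []. Qed.

(** With [det3_cst] below, [p *m det3_col a b] is [det3_cst a b - det3 a b p], so the inequality in
    [face] says that [p] is not to the right of the line [a b]. *)
Definition det3_col a b : 'cV[R]_2 :=
  \col_i (if i == 0 then b 0 1 - a 0 1 else - (b 0 0 - a 0 0)).

Definition det3_cst a b : R :=
  (b 0 1 - a 0 1) * a 0 0 - (b 0 0 - a 0 0) * a 0 1.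

Lemma mul_row2 a (c : 'cV[R]_2) : (a *m c) 0 0 = a 0 0 * c 0 0 + a 0 1 * c 1 0.
Proof.
rewrite mxE !big_ord_recl big_ord0 addr0.
by rewrite (_ : lift ord0 ord0 = 1) //; apply: val_inj.
Qed.

Lemma det3_colE a b p : (p *m det3_col a b) 0 0 = det3_cst a b - det3 a b p.
Proof. by rewrite mul_row2 !mxE /= /det3 /det3_cst; ring. Qed.

(** A functional with the same value at [x] and [y] has slack proportional to [det3 x y]; the
    identity clears denominators. *)
Lemma affine_det3 (c : 'cV[R]_2) (b : R) x y k l :
  (x *m c) 0 0 = b -> (y *m c) 0 0 = b ->
  (b - (l *m c) 0 0) * det3 x y k = (b - (k *m c) 0 0) * det3 x y l.
Proof.
rewrite !mul_row2; set c0 := c 0 0; set c1 := c 1 0 => hx hy.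
have : det3 x y k * (b - (l 0 0 * c0 + l 0 1 * c1)) =
  det3 y k l * (b - (x 0 0 * c0 + x 0 1 * c1)) +
  det3 k x l * (b - (y 0 0 * c0 + y 0 1 * c1)) +
  det3 x y l * (b - (k 0 0 * c0 + k 0 1 * c1)) by rewrite /det3; ring.
by rewrite hx hy !subrr !mulr0 !add0r => h; rewrite mulrC h mulrC.
Qed.

Lemma between_det3 p q r : between p q r -> det3 p r q = 0.
Proof.
move=> h; have := conv_hull_eq (c := det3_col p r) (b := det3_cst p r) _ h.
rewrite det3_colE => h'; apply/eqP; rewrite -oppr_eq0 -(addKr (det3_cst p r) (- _)) h' ?addNr //.
by move=> y [->|->]; rewrite det3_colE ?det3_eq02 ?det3_eq12 subr0.
Qed.

End Planar.

(** * Counterclockwise lists and their edges *)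

Section CcwLists.
Variables (R : realFieldType) (I : eqType) (p : I -> 'rV[R]_2).
Implicit Types (c s : seq I) (x y z k n : I).
Local Notation D x y z := (det3 (p x) (p y) (p z)).

(** The angular order around [x] is transitive on a half-plane, here the one to the left of the ray
    from [x] to [n]. *)
Lemma fan_trans (P : {pred I}) x n :
  {in P, forall y, 0 <= D x n y} -> {in P, forall y, y != n -> 0 < D x n y} ->
  {in P & &, transitive (fun y z => 0 < D x y z)}.
Proof.
move=> ge gt z y w zP yP wP yz zw.
have nz : z != n.
  by apply: contraTneq yz => ->; rewrite det3S oppr_gt0 -leNgt ge.
have nw : w != n.
  by apply: contraTneq zw => ->; rewrite det3S oppr_gt0 -leNgt ge.
rewrite -(pmulr_rgt0 _ (gt z zP nz)) det3_GP.
by rewrite ltr_wpDl ?mulr_ge0 ?ge // ?mulr_gt0 ?gt // ltW.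
Qed.

Lemma ccw_fan x s : (forall y z, subseq [:: y; z] s -> 0 < D x y z) ->
  (forall y z w, subseq [:: y; z; w] s -> 0 < D y z w) -> ccw p (x :: s).
Proof.
move=> h2 h3 u v w /=; case: eqP => [->|_]; first exact: h2.
exact: h3.
Qed.

Lemma path_edge_fan c x n s : uniq (n :: s) -> x \notin n :: s ->
  {subset x :: n :: s <= c} ->
  edge p c x n -> path (fun y z => `[< edge p c y z >]) n s ->
  forall y z, subseq [:: y; z] (n :: s) -> 0 < D x y z.
Proof.
move=> us xs sc exn ps.
have tr : {in n :: s & &, transitive (fun y z => 0 < D x y z)}.
  apply: (fan_trans (n := n)) => y ys.
    by apply: edge_ge0 exn _; apply: sc; rewrite inE ys orbT.
  move=> yn; apply: exn.2 => //; first by apply: sc; rewrite inE ys orbT.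
  by apply: contraNneq xs => <-.
have srt : sorted (fun y z => 0 < D x y z) (n :: s).
  move=> /=; have sub2 : {subset n :: s <= c} by move=> y ys; apply: sc; rewrite inE ys orbT.
  have xc : x \in c by apply: sc; rewrite mem_head.
  elim: s n {us tr exn sc} xs ps sub2 => //= y s IH m xs /andP[/asboolP emy ps] sub2.
  move: xs; rewrite !inE !negb_or => /and3P[xm xy xs].
  rewrite (IH y) ?andbT //; first last.
  - by move=> z zs; apply: sub2; rewrite inE zs orbT.
  - by rewrite inE negb_or xy.
  by rewrite -det3C; apply: emy.2.
move=> y z yz; have := subseq_sorted_in tr yz srt.
by rewrite /= andbT.
Qed.

(** For a triple starting at [x], the cycle is rotated to start there. Each edge then compares two
    consecutive points in the angular order around [x], and transitivity gives the rest. *)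
Lemma cycle_edge_ccw c : uniq c -> cycle (fun y z => `[< edge p c y z >]) c -> ccw p c.
Proof.
move=> uc cc x y z hs.
have xc : x \in c by apply: (mem_subseq hs); rewrite mem_head.
have [s1 [s2 e]] : exists s1 s2, c = s1 ++ x :: s2.
  by case/splitPr: xc => s1 s2; exists s1, s2.
have yz : subseq [:: y; z] s2.
  have : x \notin s1 by move: uc; rewrite e cat_uniq /= => /and3P[_ /norP[]].
  move: hs; rewrite e; elim: (s1) => [|a s IH] /=; first by rewrite eqxx.
  by rewrite inE negb_or => + /andP[/negbTE nxa xs]; rewrite nxa => /IH; apply.
have ec : rot (size s1) c = x :: s2 ++ s1 by rewrite e rot_size_cat.
have uc' : uniq (x :: s2 ++ s1) by rewrite -ec rot_uniq.
have mc k : k \in x :: s2 ++ s1 -> k \in c by rewrite -ec mem_rot.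
move: cc; rewrite -(rot_cycle (size s1)) ec.
have : subseq [:: y; z] (s2 ++ s1) by apply: subseq_trans yz (prefix_subseq _ _).
move: uc' mc; case: (s2 ++ s1) => [|n s] //= /and3P[xns ns us] mc hyz.
rewrite rcons_path => /and3P[/asboolP exn ps _].
apply: (path_edge_fan (n := n) (s := s) (c := c)) => //.
by rewrite /= ns.
Qed.

Lemma ccw_edge_next c x : uniq c -> ccw p c -> (1 < size c)%N -> x \in c ->
  edge p c x (next c x).
Proof.
move=> uc cc sc xc; case: (rot_to xc) => i s es.
rewrite -(next_rot i uc) es; case: s es => [|y s] es.
  by move: sc; rewrite -(size_rot i) es.
rewrite /= eqxx; have u : uniq (x :: y :: s) by rewrite -es rot_uniq.
have cc' : ccw p (x :: y :: s) by rewrite -es; apply: ccw_rot.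
by apply: edge_eq_mem (ccw_edge u cc') => k; rewrite -es mem_rot.
Qed.

End CcwLists.

Lemma min_in_seq (T : eqType) (le : rel T) (x : T) (s : seq T) : total le -> transitive le ->
  exists2 y, y \in x :: s & {in x :: s, forall z, le y z}.
Proof.
move=> tot tr; elim: s x => [|z s IH] x.
  by exists x => [|y]; rewrite inE // => /eqP->; have := tot x x; rewrite orbb.
have [y yin hy] := IH z; case: (boolP (le y x)) => h.
  by exists y => [|w]; rewrite inE ?yin ?orbT // => /predU1P[->//|]; exact: hy.
have {}h : le x y by have := tot x y; rewrite (negbTE h) orbF.
exists x => [|w]; first by rewrite mem_head.
rewrite inE => /predU1P[->|/hy]; last exact: tr.
by have := tot x x; rewrite orbb.
Qed.

Section Lexicographic.
Variable R : realType.

Definition lexle (a b : 'rV[R]_2) := (a 0 0 < b 0 0) || ((a 0 0 == b 0 0) && (a 0 1 <= b 0 1)).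

Lemma lexle_total : total lexle.
Proof.
move=> a b; rewrite /lexle; case: (ltrgtP (a 0 0) (b 0 0)) => //= _.
exact: le_total.
Qed.

Lemma lexle_trans : transitive lexle.
Proof.
move=> b a c; rewrite /lexle => /orP[h|/andP[/eqP h h']] /orP[g|/andP[/eqP g g']].
- by rewrite (lt_trans h g).
- by rewrite -g h.
- by rewrite h g.
by rewrite h g eqxx (le_trans h' g') orbT.
Qed.

Definition lexpos (u0 u1 : R) := (0 < u0) || ((u0 == 0) && (0 < u1)).

(** Directions from the lexicographically least point fill a half-open half-plane, on which the
    angular order is transitive. *)
Lemma lexpos_trans (u0 u1 v0 v1 w0 w1 : R) :
  lexpos u0 u1 -> lexpos v0 v1 -> lexpos w0 w1 ->
  0 < u0 * v1 - u1 * v0 -> 0 < v0 * w1 - v1 * w0 -> 0 < u0 * w1 - u1 * w0.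
Proof.
rewrite /lexpos => hu /orP[v0p|/andP[/eqP-> v1p]] hw h1 h2; last first.
  move: h2 hw; rewrite mul0r add0r oppr_gt0 pmulr_rlt0 // => h.
  by rewrite ltNge ltW //= lt_eqF.
have key : v0 * (u0 * w1 - u1 * w0) =
  u0 * (v0 * w1 - v1 * w0) + w0 * (u0 * v1 - u1 * v0) by ring.
rewrite -(pmulr_rgt0 _ v0p) key.
case/orP: hu => [u0p|/andP[/eqP u00 u1p]].
  rewrite ltr_pwDl ?mulr_gt0 //; apply: mulr_ge0; last exact: ltW.
  by case/orP: hw => [/ltW//|/andP[/eqP->]].
by move: h1; rewrite u00 mul0r add0r oppr_gt0 pmulr_rlt0 // ltNge ltW.
Qed.

End Lexicographic.

(** * Sorting the black points by angle *)

Section Boundary.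
Variables (R : realType) (n : nat) (X : diagram R n 2).
Local Notation p := (pt X).
Local Notation D x y z := (det3 (pt X x) (pt X y) (pt X z)).
Implicit Types (x y z k r : 'I_n) (c s : seq 'I_n).

Definition black_generic := forall x y z, black X x -> black X y -> black X z ->
  [&& x != y, y != z & z != x] -> D x y z != 0.

Hypothesis cvx : black_convex_position X.
Hypothesis gen : black_generic.
Hypothesis big : (2 < #|black X|)%N.

Lemma third_black x y : exists z, [/\ black X z, z != x & z != y].
Proof.
have : (0 < #|[predD1 [predD1 (black X) & x] & y]|)%N.
  have := cardD1 x (black X); have := cardD1 y [predD1 (black X) & x].
  move=> e2 e1; move: big; rewrite e1 e2.
  rewrite addnA => h; rewrite lt0n; apply/eqP => m0; move: h.
  have m2 := leq_add (leq_b1 (x \in black X)) (leq_b1 (y \in [predD1 black X & x])).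
  by rewrite m0 addn0 ltnNge m2.
by case/card_gt0P => z; rewrite !inE => /and3P[h1 h2 h3]; exists z.
Qed.

Lemma black_pt_inj x y : black X x -> black X y -> p x = p y -> x = y.
Proof.
move=> bx yb e; apply/eqP; apply: contraT => nxy.
have [z [bz zx zy]] := third_black x y.
have := gen bx yb bz; rewrite nxy eq_sym zy zx => /(_ isT).
by rewrite e det3aa eqxx.
Qed.

Lemma black_not_in_tri z x y w : black X z -> black X x -> black X y -> black X w ->
  z != x -> z != y -> z != w -> in_tri (p z) (p x) (p y) (p w) = false.
Proof.
move=> bz bx by_ bw zx zy zw; apply/negP => /in_tri_in_triangle[s [t [u [s0 t0 u0 e ez]]]].
apply: (cvx bz); rewrite ez; apply: conv_hull3; rewrite ?ltW //.
- by exists x => //=; rewrite bx eq_sym.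
- by exists y => //=; rewrite by_ eq_sym.
- by exists w => //=; rewrite bw eq_sym.
Qed.

(** Sorting by angle around the lexicographically least point [r] settles the triples through [r]. A
    wrong turn at [y z w] would put [z] into the triangle [r y w], against convex position. *)
Lemma exists_ccw : exists c, [/\ uniq c, c =i black X & ccw p c].
Proof.
have bB x : (x \in enum (black X)) = black X x by rewrite mem_enum.
have [x0 bx0] : exists x, black X x.
  by have /card_gt0P[x hx] := leq_trans (isT : 0 < 3)%N big; exists x.
have tot : total (fun x y => lexle (p x) (p y)) by move=> x y; apply: lexle_total.
have tr : transitive (fun x y => lexle (p x) (p y)).
  by move=> y x z; apply: lexle_trans.
have [r rin rmin] := min_in_seq x0 (enum (black X)) tot tr.
have br : black X r by move: rin; rewrite inE bB => /predU1P[->|].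
have {}rmin y : black X y -> y != r -> lexpos (p y 0 0 - p r 0 0) (p y 0 1 - p r 0 1).
  move=> yb yr; have := rmin y; rewrite inE bB yb orbT => /(_ isT).
  rewrite /lexle /lexpos subr_gt0 subr_eq0 => /orP[->//|/andP[/eqP e h]].
  rewrite e eqxx ltxx /= subr_gt0 lt_neqAle h andbT.
  apply: contra yr => /eqP h'; apply/eqP; apply: black_pt_inj => //.
  exact: row2P.
pose s := [seq x <- enum (black X) | x != r].
pose leT := fun y z => (y == z) || (0 < D r y z).
have sP y : y \in s = (black X y && (y != r)) by rewrite mem_filter bB andbC.
have us : uniq s by rewrite filter_uniq // enum_uniq.
have trT : {in s & &, transitive leT}.
  move=> z y w; rewrite !sP => /andP[zb zr] /andP[yb yr] /andP[wb wr].
  rewrite /leT => /predU1P[->//|h1] /predU1P[<-|h2]; first by rewrite h1 orbT.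
  by rewrite (lexpos_trans _ (rmin z zb zr) _ h1 h2) ?orbT ?rmin.
have totT : {in s &, total leT}.
  move=> y z; rewrite !sP => /andP[yb yr] /andP[zb zr]; rewrite /leT.
  case: (eqVneq y z) => //= nyz; have := gen br yb zb.
  rewrite eq_sym yr nyz zr => /(_ isT); rewrite (det3S (p r) (p y)) oppr_gt0.
  by case: (ltrgtP (D r y z)).
pose ls := sort leT s.
have lsP : ls =i s by move=> y; rewrite mem_sort.
have uls : uniq ls by rewrite sort_uniq.
have srt : sorted leT ls by apply: (@sort_sorted_in _ (mem s) leT totT s); apply/allP.
have trT' : {in ls & &, transitive leT}.
  by move=> z y w; rewrite !lsP; apply: trT.
have h2 y z : subseq [:: y; z] ls -> 0 < D r y z.
  move=> h; have := subseq_sorted_in trT' h srt; rewrite /= andbT /leT.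
  by have := subseq_uniq h uls; rewrite /= inE andbT => /negbTE->.
have lsb y : y \in ls -> black X y /\ y != r by rewrite lsP sP => /andP.
exists (r :: ls); split.
- rewrite /= uls andbT; apply/negP => /lsb[]; by rewrite eqxx.
- move=> y; rewrite inE lsP sP; case: eqP => [->|_]; first by rewrite orTb -topredE /= br.
  by rewrite andbT.
apply: (ccw_fan h2) => y z w h.
have hyz : 0 < D r y z by apply/h2/(subseq_trans _ h); rewrite /= !eqxx.
have hzw : 0 < D r z w by apply/h2/(subseq_trans _ h); apply: subseq_cons.
have hyw : 0 < D r y w.
  apply/h2/(subseq_trans _ h); rewrite /= eqxx.
  by case: eqP => //; rewrite eqxx.
have [[yb yr] [zb zr] [wb wr]] : [/\ black X y /\ y != r, black X z /\ z != r & black X w /\ w != r].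
  by split; apply: lsb; apply: (mem_subseq h); rewrite !inE eqxx ?orbT.
have := subseq_uniq h uls; rewrite /= !inE negb_or andbT => /andP[/andP[nyz nyw] nzw].
have := gen yb zb wb; rewrite nyz nzw eq_sym nyw => /(_ isT).
case: ltrgtP => // neg _.
have := black_not_in_tri zb br yb wb zr _ nzw; rewrite eq_sym nyz => /(_ isT).
rewrite tr_posI //; first by rewrite det3S oppr_gt0.
by rewrite -det3C.
Qed.

End Boundary.

(** * Boundary orders are counterclockwise lists up to reversal *)

Section BoundaryOrder.
Variables (R : realType) (n : nat) (X : diagram R n 2).
Local Notation p := (pt X).
Local Notation D x y z := (det3 (pt X x) (pt X y) (pt X z)).
Implicit Types (x y z k r : 'I_n) (c s : seq 'I_n).

Hypothesis cvx : black_convex_position X.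
Hypothesis gen : black_generic X.
Hypothesis big : (2 < #|black X|)%N.

Local Notation bface x y := (face (conv_hull (black_points X))
                                  (conv_hull [set p x; p y])).

Lemma edge_face c x y : c =i black X -> x \in c -> y \in c -> edge p c x y -> bface x y.
Proof.
move=> hc xc yc e; exists (det3_col (p x) (p y)), (det3_cst (p x) (p y)).
have hb q : black_points X q -> (q *m det3_col (p x) (p y)) 0 0 <= det3_cst (p x) (p y).
  case=> k bk <-; rewrite det3_colE lerBlDr lerDl; apply: edge_ge0 e _.
  by rewrite hc.
have bp z : z \in c -> black_points X (p z) by rewrite hc => bz; exists z.
split; first by move=> q; apply: conv_hull_le.
apply/seteqP; split=> q.
  move=> hq; split.
    by apply: conv_hull_sub hq => _ [->|->]; apply: bp.
  apply: conv_hull_eq hq => _ [->|->]; rewrite det3_colE ?det3_eq02 ?det3_eq12 subr0 //.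
case=> hq /= eq0; have := conv_hull_face hb hq eq0; apply: conv_hull_sub.
move=> _ [[k bk <-]] /=; rewrite det3_colE => /eqP.
rewrite subr_eq addrC -subr_eq subrr => /eqP h.
case: (eqVneq k x) => [->|kx]; first by left.
case: (eqVneq k y) => [->|ky]; first by right.
by have := e.2 k; rewrite hc -h ltxx => /(_ bk kx ky).
Qed.

(** A functional exposing the segment is constant on [x] and [y], hence proportional to
    [det3 (p x) (p y)], and no other black point reaches the maximum since it would lie in that
    segment. A face has no direction, hence the alternative. *)
Lemma face_edge c x y : c =i black X -> x \in c -> y \in c -> x != y -> bface x y ->
  edge p c x y \/ edge p c y x.
Proof.
move=> hc xc yc nxy [f [b [hle hF]]].
have hx : (p x *m f) 0 0 = b.
  have : (conv_hull [set p x; p y]) (p x) by apply: conv_hull1; left.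
  by rewrite hF => -[].
have hy : (p y *m f) 0 0 = b.
  have : (conv_hull [set p x; p y]) (p y) by apply: conv_hull1; right.
  by rewrite hF => -[].
have gt k : k \in c -> k != x -> k != y -> 0 < b - (p k *m f) 0 0.
  move=> kc kx ky; have bk : black X k by rewrite -[black X k]hc.
  have hk : conv_hull (black_points X) (p k) by apply: conv_hull1; exists k.
  rewrite subr_gt0 lt_neqAle hle // andbT; apply/eqP => hkb.
  apply: (cvx bk); have : (conv_hull [set p x; p y]) (p k) by rewrite hF.
  apply: conv_hull_sub => _ [->|->].
    by exists x => //=; rewrite eq_sym kx andbT -[black X x]hc.
  by exists y => //=; rewrite eq_sym ky andbT -[black X y]hc.
have [z [bz zx zy]] := third_black big x y.
have zc : z \in c by rewrite hc.
have same k : k \in c -> k != x -> k != y -> (0 < D x y k) = (0 < D x y z).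
  move=> kc kx ky; have := affine_det3 (p k) (p z) hx hy.
  move=> e; rewrite -(pmulr_rgt0 (D x y k) (gt z zc zx zy)) e.
  by rewrite pmulr_rgt0 // gt.
have nz k : k \in c -> k != x -> k != y -> D x y k != 0.
  move=> kc kx ky; apply: gen; rewrite -?[black X _]hc //.
  by rewrite nxy eq_sym ky kx.
case: (boolP (0 < D x y z)) => hz; [left | right]; split=> //.
- by move=> k kc kx ky; rewrite same.
- by rewrite eq_sym.
move=> k kc ky kx; rewrite det3N oppr_gt0 lt_neqAle nz //= leNgt same //.
Qed.

(** If the second edge ran backwards, from [z] to [y], the two edges would give opposite signs to
    the same triple [x y z]. *)
Lemma edge_step c x y z : z \in c -> x \in c -> edge p c x y -> edge p c y z \/ edge p c z y ->
  z != x -> edge p c y z.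
Proof.
move=> zc xc e [//|e'] zx; have yz : y != z by rewrite eq_sym; case: e'.
have h1 := e.2 z zc zx; have xy : x != y by case: e.
have := e'.2 x xc; rewrite eq_sym zx => /(_ isT xy).
rewrite det3N det3C oppr_gt0 => h2; have := h1; rewrite eq_sym yz => /(_ isT).
by move/(lt_trans h2); rewrite ltxx.
Qed.

Lemma path_edge_step c x y s : uniq [:: x, y & s] -> {subset [:: x, y & s] <= c} ->
  edge p c x y ->
  path (fun u v => `[< edge p c u v \/ edge p c v u >]) y s ->
  path (fun u v => `[< edge p c u v >]) y s.
Proof.
elim: s x y => //= z s IH x y u sub e /andP[/asboolP e' ps].
have [zx u'] : z != x /\ uniq [:: y, z & s].
  case/andP: u => h u'; split=> //; rewrite eq_sym.
  by move: h; rewrite !inE !negb_or => /and3P[].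
have eyz : edge p c y z.
  by apply: edge_step e e' zx; apply: sub; rewrite !inE eqxx ?orbT.
rewrite (IH y) ?andbT //; first exact/asboolP.
by move=> w hw; apply: sub; rewrite inE hw orbT.
Qed.

Local Notation sym_edge c := (fun u v => `[< edge p c u v \/ edge p c v u >]).

Lemma cycle_edge_from c x y z s : uniq [:: x, y, z & s] -> [:: x, y, z & s] =i c ->
  edge p c x y -> cycle (sym_edge c) [:: x, y, z & s] ->
  cycle (fun u v => `[< edge p c u v >]) [:: x, y, z & s].
Proof.
move=> u hc exy /= /and3P[_ /asboolP hyz hp].
have inc k : k \in [:: x, y, z & s] -> k \in c by rewrite hc.
have zx : z != x.
  by rewrite eq_sym; case/andP: u; rewrite !inE !negb_or => /and3P[].
have eyz : edge p c y z by apply: edge_step exy hyz zx; apply: inc; rewrite !inE eqxx ?orbT.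
have -> /= : `[< edge p c x y >] by exact/asboolP.
have -> /= : `[< edge p c y z >] by exact/asboolP.
apply: path_edge_step eyz hp.
  rewrite -[[:: y, z & _]]/(rcons [:: y, z & s] x) rcons_uniq.
  exact: u.
move=> k; rewrite -[[:: y, z & _]]/(rcons [:: y, z & s] x) mem_rcons => hk.
exact: inc.
Qed.

(** The direction of the first edge propagates around the cycle; in the backward case the reversed
    list is rotated to start at that edge. *)
Lemma cycle_edges c : uniq c -> (2 < size c)%N -> cycle (sym_edge c) c ->
  cycle (fun u v => `[< edge p c u v >]) c \/
  cycle (fun u v => `[< edge p c u v >]) (rev c).
Proof.
case: c => [|x [|y [|z s]]] //; set c := [:: x, y, z & s] => uc _ cc.
have exy : `[< edge p c x y \/ edge p c y x >] by case/andP: cc.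
case/asboolP: exy => exy; first by left; apply: cycle_edge_from.
right; have ec : rot (size (rev (z :: s))) (rev c) = [:: y, x & rev (z :: s)].
  by rewrite /c -[[:: x, y, z & s]]/([:: x; y] ++ z :: s) rev_cat rot_size_cat.
rewrite -(rot_cycle (size (rev (z :: s)))) ec.
have hm : [:: y, x & rev (z :: s)] =i c by move=> k; rewrite -ec mem_rot mem_rev.
have u' : uniq [:: y, x & rev (z :: s)] by rewrite -ec rot_uniq rev_uniq.
have cc' : cycle (sym_edge c) [:: y, x & rev (z :: s)].
  rewrite -ec rot_cycle rev_cycle; apply: sub_cycle cc => u v /asboolP h.
  by apply/asboolP; case: h; [right | left].
case: (rev (z :: s)) hm u' cc' (size_rev (z :: s)) => // w s' hm u' cc' _.
exact: cycle_edge_from.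
Qed.

Lemma boundary_order_ccw c : boundary_order X c -> ccw p c \/ ccw p (rev c).
Proof.
case=> uc hc cc.
have sc : (2 < size c)%N by rewrite -(card_uniqP uc) (eq_card hc).
have : cycle (sym_edge c) c.
  apply: cycle_from_next => // x xc; apply/asboolP.
  have yc : next c x \in c by rewrite mem_next.
  apply: face_edge => //; last by apply/asboolP/(next_cycle cc).
  apply/eqP => e; case: (rot_to xc) => i s es.
  move: (esym e); rewrite -(next_rot i uc) es.
  have : uniq (x :: s) by rewrite -es rot_uniq.
  case: s es => [|y s] es; first by move: sc; rewrite -(size_rot i) es.
  by rewrite /= eqxx inE negb_or => /andP[/andP[/eqP nxy _] _] exy; case: nxy.
have uc' : uniq (rev c) by rewrite rev_uniq.
case/(cycle_edges uc sc) => h; [left | right]; apply: cycle_edge_ccw => //.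
apply: sub_cycle h => u v /asboolP h; apply/asboolP.
by apply: edge_eq_mem h => k; rewrite mem_rev.
Qed.

Lemma ccw_boundary_order c : uniq c -> c =i black X -> ccw p c -> boundary_order X c.
Proof.
move=> uc hc cc; split=> //.
have sc : (2 < size c)%N by rewrite -(card_uniqP uc) (eq_card hc).
apply: cycle_from_next => // x xc; apply/asboolP.
have yc : next c x \in c by rewrite mem_next.
exact: edge_face hc xc yc (ccw_edge_next uc cc (ltnW sc) xc).
Qed.

End BoundaryOrder.

(** The line through the two neighbours [u], [v] of a point cuts it off: all the others are on the
    line or beyond it. *)
Lemma ccw_convex_position (R : realType) n (X : diagram R n 2) (c : seq 'I_n) :
  uniq c -> c =i black X -> ccw (pt X) c -> (2 < size c)%N -> black_convex_position X.
Proof.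
move=> uc hc cc sc i bi; rewrite -[black X i]/(i \in black X) -hc in bi.
have [j s es] := rot_to bi.
have hs : c =i i :: s by move=> k; rewrite -es mem_rot.
have {}uc : uniq (i :: s) by rewrite -es rot_uniq.
have {}cc : ccw (pt X) (i :: s) by rewrite -es; apply: ccw_rot.
have {}sc : (1 < size s)%N by move: sc; rewrite -(size_rot j) es.
case/lastP: s => [|s u] in es hs uc cc sc *; first by [].
case: s => [|v s] in es hs uc cc sc *; first by [].
have viu : det3 (pt X u) (pt X v) (pt X i) < 0.
  by rewrite det3N oppr_lt0 det3C; apply: cc; rewrite /= !eqxx sub1seq mem_rcons mem_head.
move=> h; suff hb y : [set pt X j | j in [set j | black X j && (j != i)]] y ->
    (y *m det3_col (pt X u) (pt X v)) 0 0 <= det3_cst (pt X u) (pt X v).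
  by have := conv_hull_le hb h; rewrite det3_colE lerBlDr lerDl leNgt viu.
case=> k /= /andP[bk ki] <-.
rewrite det3_colE lerBlDr lerDl.
have : k \in c by rewrite hc.
rewrite hs !inE (negbTE ki) /= mem_rcons inE => /or3P[/eqP->|/eqP->|ks].
- by rewrite det3_eq12.
- by rewrite det3_eq02.
rewrite -det3C ltW //; apply: cc; apply: subseq_trans (subseq_cons _ _).
rewrite -cats1 -[[:: v; k; u]]/([:: v; k] ++ [:: u]).
by apply: cat_subseq => //=; rewrite eqxx ?sub1seq.
Qed.

(** * Gale duality *)

Lemma card_image_finset (I : finType) (T : Type) (x : I -> T) (A : {set I}) k :
  injective x -> #|A| = k -> (x @` [set i | i \in A] #= `I_k)%card.
Proof.
move=> xi <-.
have -> : x @` [set i | i \in A] = (fun i : 'I_#|A| => x (enum_val i)) @` setT.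
  apply/seteqP; split=> [_ [i iA <-]|_ [j _ <-]]; last first.
    by exists (enum_val j) => //=; apply: enum_valP.
  by exists (enum_rank_in iA i) => //=; rewrite enum_rankK_in.
apply: card_eq_trans (inj_card_eq _) _; first by move=> i j _ _ /xi/enum_val_inj.
by rewrite card_eq_sym card_II.
Qed.

Section Vertices.
Variables (R : realType) (D : nat).
Implicit Types (P F A : set 'rV[R]_D) (v : 'rV[R]_D).

Lemma vertices_sub P v : vertices P v -> P v.
Proof.
case=> c [b [_ e]]; have : [set v] v by [].
by rewrite e => -[].
Qed.

Lemma vertices_face P F v : face P F -> vertices P v -> F v -> vertices F v.
Proof.
case=> c [b [h eF]] [c' [b' [h' e]]] Fv; exists c', b'; split.
  by move=> p; rewrite eF => -[Pp _]; apply: h'.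
apply/seteqP; split=> [_ ->|p [Fp hp]].
  by split=> //; have : [set v] v by []; rewrite e => -[].
by rewrite e; split=> //; move: Fp; rewrite eF => -[].
Qed.

Lemma vertices_conv_hull A v : vertices (conv_hull A) v -> A v.
Proof.
move=> hv; have hPv := vertices_sub hv; case: hv => c [b [h e]].
have hA y : A y -> (y *m c) 0 0 <= b by move=> Ay; apply/h/conv_hull1.
have vb : (v *m c) 0 0 = b by have : [set v] v by []; rewrite e => -[].
have [m [y [w [Ay w0 w1 ev]]]] := conv_hull_face hA hPv vb.
case: m y w Ay w0 w1 ev => [|m] y w Ay w0 w1 ev.
  by move: w1; rewrite big_ord0 => /esym/eqP; rewrite oner_eq0.
have [Ay0 hy0] := Ay ord0.
have : (conv_hull A `&` [set p | (p *m c) 0 0 = b]) (y ord0).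
  by split=> //; apply: conv_hull1.
by rewrite -e => <-.
Qed.

End Vertices.

Section GaleRelation.
Variables (R : realType) (d : nat) (X : diagram R (2 * d + 4) 2).
Hypothesis TX : T_diagram X.
Local Notation I := 'I_(2 * d + 4).

(* A positive combination of the Gale vectors outside [A] that vanishes comes
   from the slacks of a functional exposing the face with vertex set [A]. *)
Lemma T_diagram_relation (A : {set I}) : #|A| = d ->
  exists u : I -> R, [/\ forall i, i \in A -> u i = 0,
    forall i, i \notin A -> if black X i then 0 < u i else u i < 0,
    \sum_i u i = 0 & \sum_i u i *: pt X i = 0].
Proof.
move=> cA; case: TX => [[P [x [polyP nP xi rx [G [o [B [[sp rf dep nz] rB oB parB hX]]]]]]] _].
have VA : x @` [set i | i \in A] `<=` vertices P.
  by move=> _ [i _ <-]; rewrite -rx; exists i.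
have cardA : (x @` [set i | i \in A] #= `I_d)%card.
  exact: card_image_finset.
have [F fF vF] := nP _ VA cardA.
have vx i : vertices P (x i) by rewrite -rx; exists i.
have [c [b [hle eF]]] := fF.
pose s i := b - (x i *m c) 0 0.
have s0 i : 0 <= s i by rewrite subr_ge0 hle //; apply: vertices_sub.
have sA i : (s i == 0) = (i \in A).
  rewrite subr_eq0; apply/eqP/idP => [h|iA].
    have Fx : F (x i) by rewrite eF; split=> //; apply: vertices_sub.
    have := vertices_face fF (vx i) Fx; rewrite vF => -[j jA /xi e].
    by rewrite -e.
  have : vertices F (x i) by rewrite vF; exists i.
  by move/vertices_sub; rewrite eF => -[_ ->].
have [t ht] : exists t : I -> R, forall i,
    o + pt X i *m B = t i *: (col i G)^T /\ black X i = (0 < t i).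
  have : forall i, exists t, o + pt X i *m B = t *: (col i G)^T /\ black X i = (0 < t).
    by move=> i; have [ti] := hX i; exists ti.
  by move/fin_all_exists.
have tn i : t i != 0.
  apply/eqP => ti; move/negP: oB; apply.
  have [] := ht i; rewrite ti scale0r => /eqP; rewrite addr_eq0 => /eqP -> _.
  by rewrite -mulNmx submxMl.
(* Rows of [G] are affine dependencies of [x], and the slack is an affine function of [x i], so each
   row annihilates it. *)
have sG : \sum_i s i *: (col i G)^T = 0.
  apply/rowP => j; rewrite summxE !mxE.
  have /dep[h1 h2] : (row j G <= G)%MS by apply: row_sub.
  have -> : \sum_i (s i *: (col i G)^T) 0 j = \sum_i (b * G j i - G j i * (x i *m c) 0 0).
    by apply: eq_bigr => i _; rewrite /s; move: ((x i *m c) 0 0) => y; rewrite !mxE; ring.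
  rewrite sumrB -mulr_sumr.
  have -> : \sum_i G j i = 0 by rewrite -[RHS]h2; apply: eq_bigr => i _; rewrite mxE.
  have -> : \sum_i G j i * (x i *m c) 0 0 = 0.
    rewrite -sum_scale_mulmx (_ : \sum_i G j i *: x i = 0) ?mul0mx ?mxE //.
    by rewrite -[RHS]h1; apply: eq_bigr => i _; rewrite mxE.
  by rewrite mulr0 subrr.
pose u i := s i / t i.
have uG : (\sum_i u i) *: o + (\sum_i u i *: pt X i) *m B = 0.
  rewrite scaler_suml mulmx_suml -big_split /= -[RHS]sG.
  apply: eq_bigr => i _; rewrite -scalemxAl -scalerDr (ht i).1 scalerA.
  by rewrite /u divfK.
(* If the sum were nonzero, [uG] would express [o] through the rows of [B], that is, the plane of
   the diagram would pass through 0. *)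
have u0 : \sum_i u i = 0.
  apply/eqP; apply: contraT => un; move/negP: oB; case.
  have : o = (- (\sum_i u i)^-1 *: (\sum_i u i *: pt X i)) *m B.
    apply: (scalerI un); rewrite -scalemxAl scalerA mulrN divff // scaleN1r.
    by apply/eqP; rewrite -addr_eq0 uG.
  by move->; apply: submxMl.
exists u; split=> //.
- by move=> i; rewrite -sA /u => /eqP->; rewrite mul0r.
- move=> i; rewrite -sA => si; rewrite (ht i).2 /u.
  have sp0 : 0 < s i by rewrite lt_neqAle eq_sym si s0.
  case: (ltrgt0P (t i)) (tn i) => // h _; first by rewrite divr_gt0.
  by rewrite pmulr_rlt0 // invr_lt0.
apply: (row_free_inj rB); rewrite mul0mx; move: uG.
by rewrite u0 scale0r add0r.
Qed.

End GaleRelation.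

Local Close Scope classical_set_scope.

Lemma finset_extend (I : finType) (S : {set I}) k : (#|S| <= k)%N -> (k <= #|I|)%N ->
  exists2 A : {set I}, S \subset A & #|A| = k.
Proof.
elim: k => [|k IH]; rewrite leq_eqVlt => /predU1P[h|h] kI; try by exists S.
have [A SA cA] := IH h (ltnW kI).
have /card_gt0P[x] : (0 < #|~: A|)%N by rewrite cardsCs finset.setCK cA subn_gt0.
rewrite inE => xA; exists (x |: A); last by rewrite cardsU1 xA cA.
by apply: fintype.subset_trans SA (finset.subsetU1 _ _).
Qed.

Lemma middle_of_collinear (R : realType) (a b c : 'rV[R]_2) : det3 a b c = 0 -> a != b ->
  exists t : R, c = a + t *: (b - a).
Proof.
move=> h nab; have [u0|u0] := eqVneq (b 0 0 - a 0 0) 0.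
  have u1 : b 0 1 - a 0 1 != 0.
    apply: contra nab => /eqP u1; apply/eqP/row2P; apply/eqP; rewrite eq_sym -subr_eq0.
      by rewrite u0.
    by rewrite u1.
  exists ((c 0 1 - a 0 1) / (b 0 1 - a 0 1)); apply: row2P; rewrite !mxE.
    rewrite u0 mulr0 addr0; move: h; rewrite /det3 u0 mul0r add0r => /eqP.
    rewrite oppr_eq0 mulf_eq0 (negbTE u1) /= subr_eq0 => /eqP->; by [].
  by rewrite divfK // addrC subrK.
exists ((c 0 0 - a 0 0) / (b 0 0 - a 0 0)); apply: row2P; rewrite !mxE.
  by rewrite divfK // addrC subrK.
have : c 0 1 - a 0 1 = (c 0 0 - a 0 0) / (b 0 0 - a 0 0) * (b 0 1 - a 0 1).
  apply: (mulfI u0); rewrite mulrA [_ * (_ / _)]mulrC divfK //.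
  by move: h; rewrite /det3 => /eqP; rewrite subr_eq0 => /eqP->; rewrite mulrC.
by move=> <-; rewrite addrC subrK.
Qed.

Lemma card_sum_pred (I : finType) (Q : {pred I}) : #|Q| = (\sum_i (Q i : nat))%N.
Proof.
by rewrite -sum1_card big_mkcond; apply: eq_bigr => i _; rewrite -topredE /=; case: (Q i).
Qed.

(** * Counting points on the sides of a line *)

Section Counting.
Variables (R : realType) (d : nat) (X : diagram R (2 * d + 4) 2).
Local Notation I := 'I_(2 * d + 4).
Local Notation p := (pt X).
Local Notation D x y z := (det3 (pt X x) (pt X y) (pt X z)).
Implicit Types (x y z w k : I) (al be ga : R).

(** Of three collinear points one lies between the other two; which one is read off from the
    parameter [t]: below 0, above 1 or in between. *)
Lemma convex_black_generic : black_convex_position X -> black_generic X.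
Proof.
move=> cvx x y z bx yb bz /and3P[xy yz zx]; apply/eqP => h.
have two a b c (t : R) : black X a -> black X b -> black X c -> c != a -> c != b ->
    0 <= t -> t <= 1 -> p c = p a + t *: (p b - p a) -> False.
  move=> ba bb bc ca cb t0 t1 e; apply: (cvx c bc).
  have -> : p c = (1 - t) *: p a + t *: p b.
    by rewrite e; apply: row2P; rewrite !mxE; ring.
  apply: conv_hull2; rewrite ?subr_ge0 ?subrK //.
    by exists a => //=; rewrite ba eq_sym.
  by exists b => //=; rewrite bb eq_sym.
case: (eqVneq (p x) (p y)) => [e|nxy].
  apply: (two x x y 0) => //; rewrite ?(eq_sym y) // scale0r addr0 //.
have [t e] := middle_of_collinear h nxy.
have [t0|t0] := ltrP t 0.
  have tp : 0 < 1 - t by lra.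
  have ti : 0 <= (1 - t)^-1 by rewrite invr_ge0 ltW.
  have ti1 : (1 - t)^-1 <= 1 by rewrite invf_le1 //; lra.
  apply: (two y z x ((1 - t)^-1)) => //; rewrite ?(eq_sym x z) //.
  apply: (scalerI (lt0r_neq0 tp)); rewrite scalerDr scalerA divff ?gt_eqF // scale1r e.
  by apply: row2P; rewrite !mxE; ring.
have [t1|t1] := ltrP 1 t.
  have tp : 0 < t by lra.
  have ti : 0 <= t^-1 by rewrite invr_ge0 ltW.
  have ti1 : t^-1 <= 1 by rewrite invf_le1 //; lra.
  apply: (two x z y (t^-1)) => //; rewrite ?(eq_sym y x) //.
  apply: (scalerI (lt0r_neq0 tp)); rewrite scalerDr scalerA divff ?gt_eqF // scale1r e.
  by apply: row2P; rewrite !mxE; ring.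
by apply: (two x y z t) => //; rewrite (eq_sym z y).
Qed.

(** A black point is a positive multiple of its Gale vector and a white one a negative multiple. For
    affine [f] these are thus the indices whose Gale vectors lie in the open half-space where the
    linear extension of [f] is positive. *)
Definition gale_side (f : I -> R) : {pred I} :=
  [pred i | if black X i then 0 < f i else f i < 0].

Hypothesis TX : T_diagram X.

Lemma T_cvx : black_convex_position X. Proof. by case: TX => _ []. Qed.
Lemma T_black : #|black X| = (d + 3)%N. Proof. by case: TX => _ []. Qed.
Lemma T_gen : black_generic X. Proof. exact: convex_black_generic T_cvx. Qed.

Lemma T_white : #|[pred i | ~~ black X i]| = (d + 1)%N.
Proof.
have := cardC (black X); rewrite T_black card_ord.
rewrite (eq_card (_ : predC (black X) =i [pred i | ~~ black X i])) => [h|i]; last by [].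
lia.
Qed.

Definition aff (al be ga : R) i := al + be * p i 0 0 + ga * p i 0 1.

Lemma aff_det3 al be ga x y z : aff al be ga x = 0 -> aff al be ga y = 0 ->
  aff al be ga z = 0 -> (be != 0) || (ga != 0) -> D x y z = 0.
Proof.
move=> hx hy hz nz; have [e1 e2] := affine_zero3 hx hy hz.
by case/orP: nz => nz; apply: (mulfI nz); rewrite mulr0.
Qed.

(* Gale's criterion for neighborliness, in the affine diagram. *)
Lemma halfplane_count al be ga : (be != 0) || (ga != 0) ->
  (d < #|gale_side (aff al be ga)|)%N.
Proof.
move=> nz; rewrite ltnNge; apply/negP => hS.
set f := aff al be ga in hS.
pose S := [set i | if black X i then 0 < f i else f i < 0].
have [||A SA cA] := @finset_extend _ S d; first by rewrite cardsE.
  by rewrite card_ord; lia.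
have [u [uA usg u0 up]] := T_diagram_relation TX cA.
have uf : \sum_i u i * f i = 0.
  have e0 : \sum_i u i * p i 0 0 = 0.
    have := congr1 (fun m : 'rV[R]_2 => m 0 0) up; rewrite summxE mxE => e; rewrite -[RHS]e.
    by apply: eq_bigr => i _; rewrite mxE.
  have e1 : \sum_i u i * p i 0 1 = 0.
    have := congr1 (fun m : 'rV[R]_2 => m 0 1) up; rewrite summxE mxE => e; rewrite -[RHS]e.
    by apply: eq_bigr => i _; rewrite mxE.
  have -> : \sum_i u i * f i = al * (\sum_i u i) + be * (\sum_i u i * p i 0 0) +
      ga * (\sum_i u i * p i 0 1).
    rewrite !mulr_sumr -!big_split /=; apply: eq_bigr => i _; rewrite /f /aff; ring.
  by rewrite u0 e0 e1 !mulr0 !addr0.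
(* Outside [A], which contains [S], the coefficient [u i] has the sign of the colour and [f i]
   weakly the opposite sign. *)
have neg i : u i * f i <= 0.
  case: (boolP (i \in A)) => iA; first by rewrite uA // mul0r.
  have : i \notin S by apply: contra iA => /(fintype.subsetP SA).
  rewrite inE; have := usg i iA; case: ifP => _ ui.
    by rewrite -leNgt => fi; rewrite mulr_ge0_le0 // ltW.
  by rewrite -leNgt => fi; rewrite mulr_le0_ge0 // ltW.
have f0 i : i \notin A -> f i = 0.
  move=> iA; have : u i * f i = 0.
    have := uf => /eqP; rewrite -oppr_eq0 -sumrN psumr_eq0; last first.
      by move=> j _; rewrite oppr_ge0.
    by move/allP/(_ i); rewrite mem_index_enum oppr_eq0 => /(_ isT)/eqP.
  move/eqP; rewrite mulf_eq0 => /orP[/eqP ui|/eqP//].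
  by have := usg i iA; rewrite ui ltxx if_same.
(* Outside [A] there are d + 4 points, and only d + 1 points are white at all, so three black ones
   remain; they would lie on the line [f = 0]. *)
have : (2 < #|[pred i | black X i & i \notin A]|)%N.
  have h1 := cardsC A; have h2 := T_white; have h3 : (#|~: A| <=
    #|[pred i | black X i & i \notin A]| + #|[pred i | ~~ black X i]|)%N.
    rewrite -cardUI; apply: leq_trans (leq_addr _ _); apply: subset_leq_card.
    apply/fintype.subsetP => i; rewrite !inE => ->; rewrite andbT; exact: orbN.
  by move: h1; rewrite card_ord cA; lia.
case/card_gt2P => x [y [z [[hx hy hz] [xy yz zx]]]].
move: hx hy hz; rewrite !inE => /andP[bx xA] /andP[yb yA] /andP[bz zA].
have := T_gen bx yb bz; rewrite xy yz zx => /(_ isT) /eqP; apply.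
exact: aff_det3 (f0 _ xA) (f0 _ yA) (f0 _ zA) nz.
Qed.

(** Applied to [f] and to [- f], [halfplane_count] finds at least d + 1 points in each of two
    disjoint sets, out of 2d + 4. *)
Lemma count_zero al be ga : (be != 0) || (ga != 0) ->
  (#|[pred i | aff al be ga i == 0%R]| <= 2)%N /\
  (#|[pred i | aff al be ga i == 0%R]| = 2 ->
   #|gale_side (aff al be ga)| = d.+1)%N.
Proof.
move=> nz; have h1 := halfplane_count al nz.
have nz' : (- be != 0) || (- ga != 0) by rewrite !oppr_eq0.
have h2 := halfplane_count (- al) nz'.
set f := aff al be ga in h1 *.
have fN i : aff (- al) (- be) (- ga) i = - f i by rewrite /f /aff; ring.
set Z := [pred i | f i == 0]; set P := gale_side f in h1 *.
set N := [pred i | if black X i then f i < 0 else 0 < f i].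
have eN : #|gale_side (aff (- al) (- be) (- ga))| = #|N|.
  by apply: eq_card => i; rewrite !inE fN oppr_gt0 oppr_lt0.
rewrite eN in h2.
have tot : (#|P| + #|N| + #|Z| = 2 * d + 4)%N.
  rewrite !card_sum_pred -!big_split /=.
  rewrite (eq_bigr (fun=> 1%N)) ?sum_nat_const ?card_ord ?muln1 // => i _.
  by rewrite /P /gale_side /=; case: (black X i); case: (ltrgt0P (f i)).
by split=> [|hZ]; move: tot h1 h2; rewrite ?hZ; move: #|P| #|N| #|Z| => *; lia.
Qed.

Lemma card3 (P : pred I) x y z : [&& x != y, y != z & z != x] -> P x -> P y -> P z ->
  (2 < #|P|)%N.
Proof.
by move=> /and3P[xy yz zx] hx hy hz; apply/card_gt2P; exists x, y, z.
Qed.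

Lemma aff_of_det3 x y i :
  D x y i = aff (det3_cst (p x) (p y)) (- (p y 0 1 - p x 0 1)) (p y 0 0 - p x 0 0) i.
Proof. by rewrite /aff /det3 /det3_cst; ring. Qed.

Lemma det3_nz x y : p x != p y ->
  (- (p y 0 1 - p x 0 1) != 0) || (p y 0 0 - p x 0 0 != 0).
Proof.
move=> nxy; rewrite -negb_and; apply: contra nxy => /andP[]; rewrite oppr_eq0 !subr_eq0.
by move=> /eqP h1 /eqP h0; apply/eqP/row2P.
Qed.

(** A line through all three would contain more than two points of the diagram. Coincident points
    are covered too: the line is taken through the double point and the third, or arbitrarily if all
    three coincide. *)
Lemma T_generic x y z : [&& x != y, y != z & z != x] -> D x y z != 0.
Proof.
move=> u; apply/eqP => h.
have [al [be [ga [nz hx hy hz]]]] : exists al be ga, [/\ (be != 0) || (ga != 0),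
    aff al be ga x = 0, aff al be ga y = 0 & aff al be ga z = 0].
  case: (eqVneq (p x) (p y)) => [exy|nxy].
    case: (eqVneq (p x) (p z)) => [exz|nxz].
      exists (- p x 0 0), 1, 0; rewrite oner_neq0 /aff !mul0r !addr0 !mul1r -exy -exz.
      by rewrite addNr.
    exists (det3_cst (p x) (p z)), (- (p z 0 1 - p x 0 1)), (p z 0 0 - p x 0 0).
    rewrite -!aff_of_det3 -exy !det3_eq02 det3_eq12; split=> //; exact: det3_nz.
  exists (det3_cst (p x) (p y)), (- (p y 0 1 - p x 0 1)), (p y 0 0 - p x 0 0).
  rewrite -!aff_of_det3 !det3_eq02 det3_eq12 h; split=> //; exact: det3_nz.
have [hle _] := count_zero al nz; move: hle; rewrite leqNgt; apply/negP/negPn.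
by apply: (card3 u) => /=; rewrite ?hx ?hy ?hz.
Qed.

Lemma exists_third x y : exists z, (z != x) && (z != y).
Proof.
have : (0 < #|~: [set x; y]|)%N.
  have := cardsC [set x; y]; rewrite card_ord cards2; case: (x != y) => /=; lia.
by case/card_gt0P => z; rewrite !inE negb_or => h; exists z.
Qed.

Lemma T_inj : injective p.
Proof.
move=> x y e; apply/eqP; apply: contraT => nxy.
have [z /andP[zx zy]] := exists_third x y.
have : D x y z != 0 by apply: T_generic; rewrite nxy eq_sym zy zx.
by rewrite e det3aa eqxx.
Qed.

(** On the line are exactly [x] and [y], so the black points on its left together with the white
    ones on its right number d + 1. The black points off the line also number d + 1; removing those
    on the left from both counts gives the equality. *)
Lemma T_balanced x y : black X x -> black X y -> x != y ->
  (\sum_(i | ~~ black X i) (D x y i < 0)%R = \sum_(i | black X i) (D x y i < 0)%R)%N.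
Proof.
move=> bx yb nxy; pose f i := D x y i.
have nz := det3_nz (contra_neq (@T_inj x y) nxy).
have [_ hN] := count_zero (det3_cst (p x) (p y)) nz.
have ef : f =1 aff (det3_cst (p x) (p y)) (- (p y 0 1 - p x 0 1)) (p y 0 0 - p x 0 0).
  by move=> i; apply: aff_of_det3.
have D0 i : (f i == 0) = (i \in [set x; y]).
  rewrite !inE; apply/idP/orP => [|[]/eqP->]; last by rewrite /f det3_eq12.
    move=> h; apply/orP; apply: contraLR h; rewrite negb_or => /andP[ix iy].
    by apply: T_generic; rewrite nxy eq_sym iy ix.
  by rewrite /f det3_eq02.
have hz : #|[pred i | f i == 0]| = 2%N.
  by rewrite (eq_card (B := mem [set x; y])) ?cards2 ?nxy // => i; rewrite !inE D0 !inE.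
have {}hN : #|gale_side f| = d.+1.
  rewrite -hN; first by apply: eq_card => i; rewrite !inE !ef.
  by apply: etrans hz; apply: eq_card => i; rewrite !inE ef.
have e1 : (\sum_(i | black X i) (0 < f i)%R + \sum_(i | ~~ black X i) (f i < 0)%R = d.+1)%N.
  apply: etrans hN; rewrite card_sum_pred [RHS](bigID (black X)) /=; congr (_ + _)%N.
    by apply: eq_bigr => i bi; rewrite /gale_side /= bi.
  by apply: eq_bigr => i /negbTE nb; rewrite /gale_side /= nb.
have e3 : (\sum_(i | black X i) (f i == 0%R) = 2)%N.
  apply: etrans hz; rewrite card_sum_pred [RHS](bigID (black X)) /=.
  rewrite [X in _ = (_ + X)%N]big1 ?addn0 // => i nb.
  apply/eqP; rewrite eqb0 D0; apply: contra nb.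
  by rewrite !inE => /orP[]/eqP->.
have e2 : (\sum_(i | black X i) (0 < f i)%R + \sum_(i | black X i) (f i < 0)%R +
    \sum_(i | black X i) (f i == 0%R) = d + 3)%N.
  rewrite -[RHS]T_black -sum1_card -!big_split /=; apply: eq_bigr => i _.
  by case: ltrgt0P.
apply: (@addnI (\sum_(i | black X i) (0 < f i)%R)%N); rewrite [LHS]e1.
by move: e2; rewrite e3 addn2 addn3 => -[<-].
Qed.

(** No black point is beyond an edge, so by balance no white one is either. *)
Lemma T_edge c x y w : c =i black X -> x \in c -> y \in c -> edge p c x y ->
  ~~ black X w -> 0 < D x y w.
Proof.
move=> hc xc yc e nw; have bx := xc; have yb := yc; rewrite hc in bx; rewrite hc in yb.
have wx : w != x by apply: contraNneq nw => ->.
have wy : w != y by apply: contraNneq nw => ->.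
have D0 : D x y w != 0 by apply: T_generic; rewrite e.1 eq_sym wy wx.
rewrite lt0r D0 /= leNgt; apply/negP => hw.
have := T_balanced bx yb e.1; rewrite [RHS]big1 => [|k bk].
  by rewrite (bigD1 w) //= hw.
by apply/eqP; rewrite eqb0 -leNgt; apply: edge_ge0 e _; rewrite hc.
Qed.

Lemma T_edge_ge0 c x y i : c =i black X -> x \in c -> y \in c -> edge p c x y ->
  0 <= D x y i.
Proof.
move=> hc xc yc e; case: (boolP (black X i)) => bi; last exact/ltW/(T_edge hc).
by apply: edge_ge0 e _; rewrite hc.
Qed.

(** Let [k] follow [y] on the polygon. In the three-term relation at [y] two terms are at most 0 and
    their sum is a nonnegative product, so both vanish; this forces [k] to be both [x] and [z]. *)
Lemma outside_once c x y z i : uniq c -> c =i black X -> ccw p c ->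
  x \in c -> y \in c -> z \in c -> 0 < D x y z -> D x y i < 0 -> D y z i < 0 -> False.
Proof.
move=> uc hc cc xc yc zc xyz h1 h2.
have sc : (1 < size c)%N by rewrite -(card_uniqP uc) (eq_card hc) T_black; lia.
have /and3P[xy yz zx] : [&& x != y, y != z & z != x].
  apply/and3P; split; apply/eqP => e; move: xyz; rewrite e ?det3aa ?ltxx //.
    by rewrite det3_eq12 ltxx.
  by rewrite det3_eq02 ltxx.
have [k [kc e]] := ccw_next sc uc cc yc.
have hx := edge_ge0 e xc; have hz := edge_ge0 e zc; have hi := T_edge_ge0 i hc yc kc e.
have e2 : D y k x * D y z i + D y k z * D x y i - D y k i * D x y z = 0.
  by rewrite /det3; ring.
have g1 := mulr_ge0_le0 hx (ltW h2); have g2 := mulr_ge0_le0 hz (ltW h1).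
have g3 := mulr_ge0 hi (ltW xyz).
have z1 : D y k x * D y z i = 0 by lra.
have z2 : D y k z * D x y i = 0 by lra.
have xk : x = k.
  apply/eqP; apply: contraT => nk; have := e.2 x xc xy nk.
  by move/eqP: z1; rewrite mulf_eq0 (lt_eqF h2) orbF => /eqP->; rewrite ltxx.
have zk : z = k.
  apply/eqP; apply: contraT => nk; rewrite eq_sym in yz; have := e.2 z zc yz nk.
  by move/eqP: z2; rewrite mulf_eq0 (lt_eqF h1) orbF => /eqP->; rewrite ltxx.
by rewrite xk zk eqxx in zx.
Qed.

Definition beyond x y z i : nat := (D x y i < 0)%R + (D y z i < 0)%R + (D z x i < 0)%R.

Lemma beyond_in_tri c x y z i : uniq c -> c =i black X -> ccw p c ->
  x \in c -> y \in c -> z \in c -> 0 < D x y z -> i \notin [:: x; y; z] ->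
  (in_tri (p i) (p x) (p y) (p z) + beyond x y z i)%N = 1%N.
Proof.
move=> uc hc cc xc yc zc xyz; rewrite !inE !negb_or => /and3P[ix iy iz].
have yzx : 0 < D y z x by rewrite det3C.
have zxy : 0 < D z x y by rewrite -det3C.
have /and3P[xy yz zx] : [&& x != y, y != z & z != x].
  apply/and3P; split; apply/eqP => e; move: xyz; rewrite e ?det3aa ?ltxx //.
    by rewrite det3_eq12 ltxx.
  by rewrite det3_eq02 ltxx.
rewrite in_tri_pos // /beyond.
have n1 : D x y i != 0 by apply: T_generic; rewrite xy (eq_sym y) iy ix.
have n2 : D y z i != 0 by apply: T_generic; rewrite yz (eq_sym z) iz iy.
have n3 : D z x i != 0 by apply: T_generic; rewrite zx (eq_sym x) ix iz.
have o1 := outside_once uc hc cc xc yc zc xyz (i := i).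
have o2 := outside_once uc hc cc yc zc xc yzx (i := i).
have o3 := outside_once uc hc cc zc xc yc zxy (i := i).
move: n1 n2 n3 o1 o2 o3.
case: (ltrgt0P (D x y i)) => // _; case: (ltrgt0P (D y z i)) => // _;
  case: (ltrgt0P (D z x i)) => // _ _ _ _ o1 o2 o3.
all: by [case: (o1 isT isT) | case: (o2 isT isT) | case: (o3 isT isT)].
Qed.

Hypothesis d1 : (1 <= d)%N.

(** Each of the d other black points is beyond exactly one side, so by balance the white points are
    beyond sides d times in all. Each of the d + 1 white points is either inside or beyond exactly
    one side, which leaves one inside. *)
Lemma T_triangle c x y z : uniq c -> c =i black X -> ccw p c ->
  x \in c -> y \in c -> z \in c -> 0 < D x y z ->
  #|[pred w | ~~ black X w & in_tri (p w) (p x) (p y) (p z)]| = 1%N.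
Proof.
move=> uc hc cc xc yc zc xyz.
have /and3P[xy yz zx] : [&& x != y, y != z & z != x].
  apply/and3P; split; apply/eqP => e; move: xyz; rewrite e ?det3aa ?ltxx //.
    by rewrite det3_eq12 ltxx.
  by rewrite det3_eq02 ltxx.
have bx := xc; have yb := yc; have bz := zc; rewrite !hc in bx yb bz.
have bal : (\sum_(i | ~~ black X i) beyond x y z i = \sum_(i | black X i) beyond x y z i)%N.
  rewrite !big_split /= (T_balanced bx yb xy) (T_balanced yb bz yz).
  by rewrite (T_balanced bz bx zx).
have eB : (\sum_(i | black X i) beyond x y z i = d)%N.
  have e : (\sum_(i | black X i) beyond x y z i +
      \sum_(i | black X i) (i \in [:: x; y; z]) = d + 3)%N.
    rewrite -[RHS]T_black -sum1_card -big_split /=; apply: eq_bigr => i bi.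
    case: (boolP (i \in [:: x; y; z])) => hi; last first.
      rewrite addn0 -(beyond_in_tri uc hc cc xc yc zc xyz hi).
      move: hi; rewrite !inE !negb_or => /and3P[h1 h2 h3].
      by rewrite (black_not_in_tri T_cvx).
    rewrite /beyond; move: hi; rewrite !inE => /or3P[]/eqP->.
    - by rewrite !det3_eq02 !det3_eq12 !ltxx [D y z x]det3C ltNge (ltW xyz).
    - by rewrite !det3_eq02 !det3_eq12 !ltxx -[D z x y]det3C ltNge (ltW xyz).
    by rewrite !det3_eq02 !det3_eq12 !ltxx ltNge (ltW xyz).
  have e' : (\sum_(i | black X i) (i \in [:: x; y; z]) = 3)%N.
    have u3 : uniq [:: x; y; z] by rewrite /= !inE negb_or xy (eq_sym x) zx yz.
    transitivity #|[pred i | i \in [:: x; y; z]]|; last by rewrite (card_uniqP u3).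
    rewrite card_sum_pred [RHS](bigID (black X)) /= [X in _ = (_ + X)%N]big1 ?addn0 // => i nb.
    by apply/eqP; rewrite eqb0; apply: contra nb; rewrite !inE => /or3P[]/eqP->.
  by move: e; rewrite e' => /addIn.
have : (\sum_(i | ~~ black X i) (in_tri (p i) (p x) (p y) (p z) + beyond x y z i) = d + 1)%N.
  rewrite -[RHS]T_white -sum1_card; apply: eq_bigr => i nb.
  apply: (beyond_in_tri uc hc cc) => //; apply: contra nb.
  by rewrite !inE => /or3P[]/eqP->.
rewrite big_split /= bal eB [(d + 1)%N]addnC => /addIn h; apply: etrans h.
rewrite card_sum_pred (bigID (black X)) /= big1 ?add0n; last by move=> i ->.
by apply: eq_bigr => i ->.
Qed.

Lemma T_conf c : uniq c -> c =i black X -> ccw p c ->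
  conf p c (enum [pred w | ~~ black X w]).
Proof.
move=> uc hc cc; set W := enum _.
have hW w : (w \in W) = ~~ black X w by rewrite mem_enum.
have sc : size c = (d + 3)%N by rewrite -(card_uniqP uc) (eq_card hc) T_black.
have tri1 x y z : x \in c -> y \in c -> z \in c -> [&& x != y, y != z & z != x] ->
    #|[pred w | ~~ black X w & in_tri (p w) (p x) (p y) (p z)]| = 1%N.
  move=> xc yc zc u; have := T_generic u; rewrite neq_lt => /orP[h|h]; last first.
    exact: (T_triangle uc hc cc xc yc zc h).
  have h' : 0 < D y x z by rewrite det3N oppr_gt0.
  apply: etrans (T_triangle uc hc cc yc xc zc h'); apply: eq_card => w.
  by rewrite !inE in_triN.
split => //.
- exact: enum_uniq.
- by rewrite sc -cardE T_white; lia.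
- move=> w x y; rewrite hW !hc => nw bx yb xy; apply: T_generic.
  have wx : w != x by apply: contraNneq nw => ->.
  have wy : w != y by apply: contraNneq nw => ->.
  by rewrite xy eq_sym wy wx.
- move=> w; rewrite hW => nw.
  case: c uc hc cc sc tri1 => [|x [|l ls]] uc hc cc sc tri1; try by move: sc; rewrite /=; lia.
  have [|y yl|s1 [u [v [s2 [e _ _ t]]]]] := @wedge_of_edges _ _ p x l ls w uc cc.
  - by move=> y z yc zc e; apply: (T_edge hc).
  - have bx : x \in black X by rewrite -hc mem_head.
    have yb : y \in black X by rewrite -hc in_cons yl orbT.
    have wx : w != x by apply: contraNneq nw => e; rewrite e; exact: bx.
    have wy : w != y by apply: contraNneq nw => e; rewrite e; exact: yb.
    apply: T_generic; rewrite (eq_sym y) wy wx !andbT.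
    by apply: contraTneq yl => <-; move: uc; rewrite cons_uniq => /andP[].
  by exists x, u, v; rewrite e !(inE, mem_cat) !eqxx !orbT.
- move=> x y z xc yc zc u.
  have /card_gt0P[w] : (0 < #|[pred w | ~~ black X w & in_tri (p w) (p x) (p y) (p z)]|)%N.
    by rewrite tri1.
  by rewrite inE => /andP[nw t]; exists w; rewrite ?hW.
- move=> x y z w w' xc yc zc; rewrite !hW => nw nw' t t'.
  have /eqP/card1P[w0 hw0] := tri1 x y z xc yc zc (tr_uniq t).
  have := hw0 w; have := hw0 w'; rewrite !inE nw nw' t t' /=.
  by move=> /esym/eqP-> /esym/eqP->.
Qed.

End Counting.

(** * Signed affine relations of a configuration *)

Section SignedRelation.
Variables (R : realType) (I : finType) (p : I -> 'rV[R]_2).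
Implicit Types (c s W : seq I) (x y z w q a b k : I).
Local Notation D x y z := (det3 (p x) (p y) (p z)).
Local Notation tr w x y z := (in_tri (p w) (p x) (p y) (p z)).

(** The triangles of the fan at [x] have disjoint interiors, so their white points are distinct. *)
Lemma fan_whites c W x l ls : conf p c W -> uniq [:: x, l & ls] -> ccw p [:: x, l & ls] ->
  {subset [:: x, l & ls] <= c} ->
  exists ws, [/\ uniq ws, size ws = size ls & forall w, w \in ws ->
    w \in W /\ exists u v, [/\ u \in l :: ls, v \in l :: ls, 0 < D x u v & tr w x u v]].
Proof.
move=> hc; elim: ls l => [|m ls IH] l uc cc sc; first by exists [::].
have sub : subseq [:: x, m & ls] [:: x, l, m & ls].
  by rewrite -[[:: x, m & ls]]cat1s -[[:: x, l, m & ls]]cat1s cat_subseq // subseq_cons.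
have xmk k : k \in ls -> 0 < D x m k.
  by move=> kl; apply: (ccw_head (s := ls)) kl; apply: ccw_sub sub cc.
have [|||ws [uw sw hw]] := IH m.
- exact: subseq_uniq sub uc.
- exact: ccw_sub sub cc.
- by move=> k /(mem_subseq sub); apply: sc.
have xlm : 0 < D x l m by apply: (ccw_head cc); rewrite mem_head.
have [w wW t] : exists2 w, w \in W & tr w x l m.
  apply: (conf_ex hc); rewrite ?sc ?inE ?eqxx ?orbT //.
  apply/and3P; split; apply/eqP => e; move: xlm; rewrite e ?det3aa ?ltxx //.
    by rewrite det3_eq12 ltxx.
  by rewrite det3_eq02 ltxx.
exists (w :: ws); split=> /=; rewrite ?sw //.
  rewrite uw andbT; apply/negP => /hw[_ [u [v [um vm _ t']]]].
  have [_ _ mxw] := tr_pos xlm t.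
  have ge k : k \in [:: x, m & ls] -> 0 <= D x m k.
    rewrite !inE => /or3P[/eqP->|/eqP->|kl]; rewrite ?det3_eq02 ?det3_eq12 //.
    exact/ltW/xmk.
  have : 0 < D x m w.
    apply: (halfplane_in_tri (c := [:: x, m & ls]) (x := x) (y := m)) t' => //.
    - move=> k; rewrite !inE => /or3P[/eqP->|/eqP->|kl]; rewrite ?eqxx //.
      by move=> _ _; apply: xmk.
    - by rewrite mem_head.
    - by rewrite inE um orbT.
    - by rewrite inE vm orbT.
  by rewrite det3N oppr_gt0 ltNge (ltW mxw).
move=> k; rewrite inE => /predU1P[->|/hw[kW [u [v [um vm h t']]]]].
  by split=> //; exists l, m; rewrite !inE !eqxx orbT.
by split=> //; exists u, v; rewrite !(in_cons l) um vm !orbT.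
Qed.

Variables (d : nat) (bl : pred I) (c W : seq I).
Hypotheses (hc : conf p c W) (cb : c =i bl) (Wb : W =i predC bl) (sW : size W = d.+1).

(** If [A] has m black points, the rest of the polygon has d + 3 - m vertices and a fan of d + 1 - m
    triangles with distinct white points, while at most d - m white points are in [A]. *)
Lemma fan_triangle (A : {set I}) : (#|A| <= d)%N ->
  exists q x y z, [/\ q \notin A /\ ~~ bl q, [/\ x \notin A, y \notin A & z \notin A],
    [/\ bl x, bl y & bl z], 0 < D x y z & tr q x y z].
Proof.
move=> hA; pose c' := [seq x <- c | x \notin A].
pose Ab := [set i in A | bl i]; pose Aw := [set i in A | ~~ bl i].
have cA : (#|Ab| + #|Aw| = #|A|)%N.
  rewrite -cardsUI [Ab :&: Aw](_ : _ = finset.set0) ?cards0 ?addn0.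
    by apply: eq_card => i; rewrite !inE -andb_orr orbN andbT.
  by apply/setP => i; rewrite !inE; case: (bl i); rewrite ?andbF.
have sc' : size c' = (d.+3 - #|Ab|)%N.
  have : (size c' + #|Ab| = d.+3)%N.
    rewrite -sW -(conf_size hc) -(count_predC (fun x => x \notin A) c) size_filter.
    congr (_ + _)%N; rewrite -size_filter -(card_uniqP _) ?filter_uniq ?(conf_uniq hc) //.
    by apply: eq_card => i; rewrite inE mem_filter cb /= negbK.
  by lia.
have uc' : uniq c' by rewrite filter_uniq // (conf_uniq hc).
have cc' : ccw p c' by apply: ccw_sub (conf_ccw hc); apply: filter_subseq.
have sub : {subset c' <= c} by move=> k; rewrite mem_filter => /andP[].
have c'A k : k \in c' -> k \notin A /\ bl k.
  by rewrite mem_filter cb => /andP[].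
case: (c') sc' uc' cc' sub c'A => [|x [|l ls]] sc' uc' cc' sub c'A; try by move: sc' => /=; lia.
have [ws [uw sw hw]] := fan_whites hc uc' cc' sub.
have [q qw qA] : exists2 q, q \in ws & q \notin A.
  apply: contrapT => no.
  have h : {subset ws <= Aw}.
    move=> k kw; rewrite inE; have [kW _] := hw k kw; rewrite Wb /= in kW.
    by rewrite [~~ bl k]kW andbT; apply: contraT => kA; case: no; exists k.
  have := subset_leq_card (introT fintype.subsetP h).
  by rewrite (card_uniqP uw) sw; move: sc' => /=; lia.
have [qW [u [v [ul vl h t]]]] := hw q qw.
rewrite Wb in qW.
have [xA bx] := c'A x (mem_head _ _).
have [|uA bu] := c'A u; first by rewrite in_cons ul orbT.
have [|vA bv] := c'A v; first by rewrite in_cons vl orbT.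
by exists q, x, u, v.
Qed.

(* The relation of a white point inside a black triangle, taken with a large
   weight, absorbs the corrections needed to include all the other points. *)
Lemma conf_relation (A : {set I}) : (#|A| <= d)%N ->
  exists u : I -> R, [/\ forall i, i \in A -> u i = 0,
    forall i, i \notin A -> if bl i then 0 < u i else u i < 0,
    \sum_i u i = 0 & \sum_i u i *: p i = 0].
Proof.
move=> /fan_triangle[q [x [y [z [[qA nq] [xA yA zA] [bx yb bz] h t]]]]].
have [hxy hyz hzx] := tr_pos h t.
have /and3P[xy yz zx] := tr_uniq t.
set dt := D x y z in h.
pose al i := D y z i / dt; pose be i := D z x i / dt; pose ga i := D x y i / dt.
have sum1 i : al i + be i + ga i = 1.
  rewrite -!mulrDl (_ : _ + _ + _ = dt) ?divff ?gt_eqF //.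
  by rewrite /dt /det3; ring.
have bary i : p i = al i *: p x + be i *: p y + ga i *: p z.
  apply: (scalerI (lt0r_neq0 h)); rewrite !scalerDr !scalerA ![dt * _]mulrC !divfK ?gt_eqF //.
  exact: det3_baryE.
pose v0 i : R := if (i \in A) || (i \in [:: x; y; z]) then 0 else if bl i then 1 else -1.
pose C f : R := \sum_i v0 i * f i.
have aq : 0 < al q by rewrite divr_gt0.
have bq : 0 < be q by rewrite divr_gt0.
have gq : 0 < ga q by rewrite divr_gt0.
(* Large enough that the correcting coefficients [S al], [S be] and [S ga] at the vertices [x], [y],
   [z] come out positive. *)
pose M := 1 + `|C al| / al q + `|C be| / be q + `|C ga| / ga q.
have big f : 0 < f q -> `|C f| / f q < M -> C f < M * f q.
  by move=> fq; rewrite ltr_pdivrMr //; apply: le_lt_trans; apply: ler_norm.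
have pos1 : 0 <= `|C al| / al q by rewrite divr_ge0 // ltW.
have pos2 : 0 <= `|C be| / be q by rewrite divr_ge0 // ltW.
have pos3 : 0 <= `|C ga| / ga q by rewrite divr_ge0 // ltW.
have M0 : 0 < M by rewrite /M; lra.
have Ma : C al < M * al q by apply: big => //; rewrite /M; lra.
have Mb : C be < M * be q by apply: big => //; rewrite /M; lra.
have Mg : C ga < M * ga q by apply: big => //; rewrite /M; lra.
pose v i := v0 i - M * (i == q)%:R.
have sv f : \sum_i v i * f i = C f - M * f q.
  rewrite (eq_bigr (fun i => v0 i * f i - M * (i == q)%:R * f i)); last first.
    by move=> i _; rewrite /v mulrBl.
  rewrite sumrB; congr (_ - _); rewrite (bigD1 q) //= eqxx mulr1 big1 ?addr0 // => i /negbTE->.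
  by rewrite mulr0 mul0r.
pose S f := M * f q - C f.
pose u i := v i + (i == x)%:R * S al + (i == y)%:R * S be + (i == z)%:R * S ga.
have su (V : lmodType R) (f : I -> V) : \sum_i u i *: f i =
    \sum_i v i *: f i + S al *: f x + S be *: f y + S ga *: f z.
  have one a (r : R) : \sum_i ((i == a)%:R * r) *: f i = r *: f a.
    rewrite (bigD1 a) //= eqxx mul1r big1 ?addr0 // => i /negbTE->.
    by rewrite mul0r scale0r.
  rewrite -(one x (S al)) -(one y (S be)) -(one z (S ga)) -!big_split /=.
  by apply: eq_bigr => i _; rewrite !scalerDl.
have qx : q != x by apply: contraNneq nq => ->.
have qy : q != y by apply: contraNneq nq => ->.
have qz : q != z by apply: contraNneq nq => ->.
exists u; split.
- move=> i iA; have ix : i != x by apply: contraNneq xA => <-.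
  have iy : i != y by apply: contraNneq yA => <-.
  have iz : i != z by apply: contraNneq zA => <-.
  have iq : i != q by apply: contraNneq qA => <-.
  rewrite /u /v /v0 iA /= (negbTE ix) (negbTE iy) (negbTE iz) (negbTE iq).
  by rewrite !mul0r mulr0 subr0 !addr0.
- move=> i iA; rewrite /u /v /v0 (negbTE iA) /= !inE.
  case: (eqVneq i x) => [->|ix].
    by rewrite bx (negbTE xy) (eq_sym x z) (negbTE zx) (eq_sym x q) (negbTE qx) /= /S; lra.
  case: (eqVneq i y) => [->|iy].
    by rewrite yb (negbTE yz) (eq_sym y q) (negbTE qy) /= /S; lra.
  case: (eqVneq i z) => [->|iz].
    by rewrite bz (eq_sym z q) (negbTE qz) /= /S; lra.
  case: (eqVneq i q) => [->|iq]; first by rewrite (negbTE nq) /=; lra.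
  by case: (bl i) => /=; lra.
- have := su R^o (fun=> 1); rewrite (eq_bigr (fun i => u i)) => [->|i _]; last exact: mulr1.
  have -> : \sum_i v i *: (1 : R^o) = \sum_i v i * (al i + be i + ga i).
    by apply: eq_bigr => i _; rewrite sum1.
  rewrite (eq_bigr (fun i => v i * al i + v i * be i + v i * ga i)); last first.
    by move=> i _; rewrite !mulrDr.
  by rewrite !big_split /= !sv /S /GRing.scale /=; ring.
rewrite su.
have -> : \sum_i v i *: p i =
    \sum_i ((v i * al i) *: p x + (v i * be i) *: p y + (v i * ga i) *: p z).
  by apply: eq_bigr => i _; rewrite {1}bary !scalerDr !scalerA.
rewrite !big_split /= -!scaler_suml !sv /S.
by apply: row2P; rewrite !mxE; ring.
Qed.

End SignedRelation.

Lemma row_base_cast (F : fieldType) m n r (A : 'M[F]_(m, n)) : \rank A = r ->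
  exists2 Y : 'M[F]_(r, n), row_free Y & (Y :=: A)%MS.
Proof. by move=> <-; exists (row_base A); [exact: row_base_free | exact: eq_row_base]. Qed.

Lemma eqmx_of_rank (F : fieldType) m1 m2 n (A : 'M[F]_(m1, n)) (B : 'M[F]_(m2, n)) :
  (A <= B)%MS -> \rank A = \rank B -> (A :=: B)%MS.
Proof. by move=> AB e; apply/eqmxP; rewrite -(mxrank_leqif_eq AB) e. Qed.

Lemma kermx_tr_rank (F : fieldType) m n (A : 'M[F]_(m, n)) :
  \rank (kermx A^T) = (n - \rank A)%N.
Proof. by rewrite mxrank_ker mxrank_tr. Qed.

(** The row space of [A] is the annihilator of its annihilator: one inclusion is clear and the ranks
    agree. *)
Lemma submx_bikermx (F : fieldType) m n k (A : 'M[F]_(m, n)) (l : 'M[F]_(k, n)) :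
  (l <= A)%MS = (kermx A^T *m l^T == 0).
Proof.
have e : (A :=: kermx (kermx A^T)^T)%MS.
  apply: eqmx_of_rank; first by apply/sub_kermxP/trmx_inj; rewrite trmx_mul trmxK mulmx_ker trmx0.
  by rewrite kermx_tr_rank kermx_tr_rank subKn // rank_leq_col.
by rewrite e; apply/sub_kermxP/eqP => h; apply: trmx_inj; rewrite trmx_mul trmxK trmx0.
Qed.

Lemma row_free_row_mx1 (F : fieldType) m n (A : 'M[F]_(n, m)) : row_free (row_mx A 1%:M).
Proof.
by apply/row_freeP; exists (col_mx 0 1%:M); rewrite mul_row_col mulmx0 mulmx1 add0r.
Qed.

(** * From signed relations back to a neighborly polytope *)

Section GaleInverse.
Local Open Scope classical_set_scope.
Variables (R : realType) (d : nat) (X : diagram R (2 * d + 4) 2).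
Local Notation I := 'I_(2 * d + 4).
Local Notation p := (pt X).
Local Notation D x y z := (det3 (pt X x) (pt X y) (pt X z)).

(** Homogeneous coordinates: the plane of the diagram becomes the plane of first coordinate 1. *)
Definition lift_pt (q : 'rV[R]_2) : 'rV[R]_(1 + 2) := row_mx 1%:M q.

Lemma lift_pt_sum (u : I -> R) :
  \sum_i u i *: lift_pt (p i) = row_mx (\sum_i u i)%:M (\sum_i u i *: p i).
Proof.
rewrite -[LHS]hsubmxK; congr row_mx; rewrite linear_sum /=.
  apply/rowP => j; rewrite summxE !mxE ord1 /= mulr1n; apply: eq_bigr => i _.
  by rewrite linearZ /= row_mxKl !mxE mulr1.
by apply: eq_bigr => i _; rewrite linearZ /= row_mxKr.
Qed.

Lemma lift_ptE (q : 'rV[R]_2) : [/\ lift_pt q 0 ord0 = 1, lift_pt q 0 (lift ord0 ord0) = q 0 0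
  & lift_pt q 0 (lift ord0 (lift ord0 ord0)) = q 0 1].
Proof.
split.
- transitivity (lift_pt q 0 (lshift 2 0)); last by rewrite row_mxEl mxE.
  by congr (lift_pt q 0 _); apply: val_inj.
- transitivity (lift_pt q 0 (rshift 1 0)); last by rewrite row_mxEr.
  by congr (lift_pt q 0 _); apply: val_inj.
transitivity (lift_pt q 0 (rshift 1 1)); last by rewrite row_mxEr.
by congr (lift_pt q 0 _); apply: val_inj.
Qed.

Lemma lift_pt_dir (v : 'rV[R]_2) w :
  ~~ (row_mx w%:M v <= row_mx (0 : 'M[R]_(2, 1)) 1%:M)%MS = (w != 0).
Proof.
congr (~~ _); apply/submxP/eqP => [[a]|->].
  rewrite mul_mx_row mulmx0 => /eq_row_mx[/(congr1 (fun m : 'M_1 => m 0 0)) + _].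
  by rewrite !mxE mulr1n.
by exists v; rewrite mul_mx_row mulmx0 mulmx1 raddf0.
Qed.

Lemma lift_pt_coord (q : 'rV[R]_2) :
  row_mx 1%:M (0 : 'rV[R]_2) + q *m row_mx (0 : 'M[R]_(2, 1)) 1%:M = lift_pt q.
Proof. by rewrite mul_mx_row mulmx0 mulmx1 add_row_mx addr0 add0r. Qed.

Lemma conv_hull_set1 D (a v : 'rV[R]_D) : conv_hull [set a] v -> v = a.
Proof.
move=> [n [y [w [Ay _ w1 ->]]]]; rewrite (eq_bigr (fun i => w i *: a)) => [|i _].
  by rewrite -scaler_suml w1 scale1r.
by rewrite (Ay i).
Qed.

Hypothesis d1 : (1 <= d)%N.
Variables x0 y0 z0 : I.
Hypothesis nondeg : D x0 y0 z0 != 0.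
Hypothesis rel : forall A : {set I}, (#|A| <= d)%N ->
  exists u : I -> R, [/\ forall i, i \in A -> u i = 0,
    forall i, i \notin A -> if black X i then 0 < u i else u i < 0,
    \sum_i u i = 0 & \sum_i u i *: p i = 0].

(** The Gale vectors are [u i *: lift_pt (p i)] for a relation [u] without zero coefficient. That
    [u] is a relation says that the constant vector [one] lies in their kernel [K]. The points [x i]
    are the columns of a complement of [one] in [K], so [K] consists of the values at the [x i] of
    affine functions, and a relation vanishing exactly on [A] becomes a function that exposes the
    face on [A]. *)
Lemma affine_gale_of_relations : exists (P : set 'rV[R]_(2 * d)) (x : I -> 'rV[R]_(2 * d)),
  [/\ polytope P, neighborly P, injective x, range x = vertices P & affine_gale_diagram x X].
Proof.
have [|u [_ usg u0 up]] := rel (A := finset.set0); first by rewrite cards0.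
have un i : u i != 0.
  by have := usg i; rewrite inE => /(_ isT); case: ifP => _; [move/lt0r_neq0 | move/ltr0_neq0].
have ub i : black X i = (0 < (u i)^-1).
  rewrite invr_gt0; have := usg i; rewrite inE => /(_ isT); case: ifP => // _ h.
  by rewrite ltNge ltW.
pose G : 'M[R]_(3, 2 * d + 4) := \matrix_(k, i) (u i * lift_pt (p i) 0 k).
have colG i : (col i G)^T = u i *: lift_pt (p i) by apply/rowP => k; rewrite !mxE.
have mulG (v : 'rV[R]_(2 * d + 4)) : v *m G^T = \sum_i (v 0 i * u i) *: lift_pt (p i).
  by apply/rowP => k; rewrite summxE !mxE; apply: eq_bigr => i _; rewrite !mxE; ring.
have freeG : row_free G.
  apply: inj_row_free => v vG; set l : 'I_3 := lift ord0 ord0.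
  set m : 'I_3 := lift ord0 (lift ord0 ord0).
  have ha i : v 0 ord0 + v 0 l * p i 0 0 + v 0 m * p i 0 1 = 0.
    have : \sum_k v 0 k * (u i * lift_pt (p i) 0 k) = 0.
      transitivity ((v *m G) 0 i); last by rewrite vG mxE.
      by rewrite mxE; apply: eq_bigr => k _; rewrite [G k i]mxE.
    rewrite !big_ord_recl big_ord0; case: (lift_ptE (p i)) => -> -> -> e.
    by apply: (mulfI (un i)); rewrite mulr0 -e /l /m; ring.
  have [el em] := affine_zero3 (ha x0) (ha y0) (ha z0).
  have hl : v 0 l = 0 by apply: (mulIf nondeg); rewrite mul0r.
  have hm : v 0 m = 0 by apply: (mulIf nondeg); rewrite mul0r.
  have h0 : v 0 ord0 = 0 by have := ha x0; rewrite hl hm !mul0r !addr0.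
  apply/rowP => k; rewrite [RHS]mxE; case: (unliftP ord0 k) => [j ->|-> //].
  by case: (unliftP ord0 j) => [j' ->|-> //]; rewrite (ord1 j').
pose one : 'rV[R]_(2 * d + 4) := const_mx 1.
pose K := kermx G^T.
have subK (s : 'rV[R]_(2 * d + 4)) : (s <= K)%MS = (\sum_i (s 0 i * u i) *: lift_pt (p i) == 0).
  by apply/sub_kermxP/eqP; rewrite mulG.
have oneK : (one <= K)%MS.
  rewrite subK (eq_bigr (fun i => u i *: lift_pt (p i))) => [|i _]; last by rewrite mxE mul1r.
  by rewrite lift_pt_sum u0 up raddf0 row_mx0.
have rK : \rank K = (2 * d).+1.
  by rewrite kermx_tr_rank (eqP (freeG : _ == _)); lia.
have rone : \rank one = 1%N.
  rewrite rank_rV; apply/eqP; rewrite eqb1; apply/eqP => /rowP/(_ x0); rewrite !mxE.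
  by move/eqP; rewrite oner_eq0.
have rY : \rank (K :\: one)%MS = (2 * d)%N.
  have := mxrank_cap_compl K one; rewrite rK (capmx_idPr oneK) rone; lia.
have [Y freeY eY] := row_base_cast rY.
pose M := col_mx one Y.
have eM : (M :=: K)%MS.
  apply/eqmxP/andP; split.
    by rewrite col_mx_sub oneK eY diffmxSl.
  rewrite -(addsmx_diff_cap_eq K one) addsmx_sub -eY; apply/andP; split.
    by rewrite -addsmxE addsmxSr.
  by apply: submx_trans (capmxSr _ _) _; rewrite -addsmxE addsmxSl.
pose x i : 'rV[R]_(2 * d) := (col i Y)^T.
(* [t i / u i] is zero on [A] and positive elsewhere, because [t] and [u] have the same signs there;
   it lies in [K], so it is [b] minus a linear functional of [x i]. *)
have slack (A : {set I}) : (#|A| <= d)%N -> exists (c : 'cV[R]_(2 * d)) (b : R),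
    (forall i, (x i *m c) 0 0 <= b) /\ forall i, ((x i *m c) 0 0 == b) = (i \in A).
  move=> /rel[t [tA tsg t0 tp]].
  pose s : 'rV[R]_(2 * d + 4) := \row_i (t i / u i).
  have : (s <= M)%MS.
    rewrite eM subK (eq_bigr (fun i => t i *: lift_pt (p i))) => [|i _].
      by rewrite lift_pt_sum t0 tp raddf0 row_mx0.
    by rewrite mxE divfK.
  case/submxP => w; rewrite -[w]hsubmxK mul_row_col; set w1 := lsubmx w; set w2 := rsubmx w => es.
  exists (- w2^T), (w1 0 0).
  have xc i : (x i *m - w2^T) 0 0 = w1 0 0 - t i / u i.
    have := congr1 (fun m : 'rV[R]_(2 * d + 4) => m 0 i) es; rewrite !mxE big_ord1 !mxE mulr1 => ->.
    rewrite opprD addNKr -sumrN; apply: eq_bigr => j _; rewrite !mxE; ring.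
  have s0 i : i \notin A -> 0 < t i / u i.
    move=> iA; have := tsg i iA; have := usg i; rewrite inE => /(_ isT); case: ifP => _ h1 h2.
      by rewrite divr_gt0.
    by rewrite nmulr_lgt0 // invr_lt0.
  split=> i; rewrite xc; case: (boolP (i \in A)) => iA.
  - by rewrite tA // mul0r subr0.
  - by rewrite lerBlDr lerDl ltW // s0.
  - by rewrite tA // mul0r subr0 eqxx.
  by apply/negbTE; rewrite lt_eqF // ltrBlDr ltrDl s0.
have dep (l : 'rV[R]_(2 * d + 4)) : (l <= G)%MS <-> affine_dependency x l.
  have e : (l <= G)%MS = (M *m l^T == 0).
    by rewrite submx_bikermx; apply/eqP/eqP => /sub_kermxP h; apply/sub_kermxP; rewrite ?eM // -eM.
  rewrite e mul_col_mx col_mx_eq0 /affine_dependency.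
  have e1 : (one *m l^T == 0) = (\sum_i l 0 i == 0).
    have -> : \sum_i l 0 i = (one *m l^T) 0 0.
      by rewrite mxE; apply: eq_bigr => i _; rewrite !mxE mul1r.
    apply/eqP/eqP => [->|h]; first by rewrite mxE.
    by rewrite [LHS]mx11_scalar h raddf0.
  have e2 : (Y *m l^T)^T = \sum_i l 0 i *: x i.
    by apply/rowP => k; rewrite summxE !mxE; apply: eq_bigr => i _; rewrite !mxE mulrC.
  rewrite -e2 e1; split=> [/andP[/eqP h1 /eqP h2]|[h1 h2]]; first by rewrite h2 trmx0.
  by rewrite h2 eqxx -[Y *m _]trmxK h1 trmx0 eqxx.
have span : affinely_spans x.
  move=> q; have : (row_mx 1%:M q <= M^T)%MS.
    by apply: submx_full; rewrite /row_full mxrank_tr eM rK.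
  case/submxP => w; rewrite tr_col_mx mul_mx_row => /eq_row_mx[h1 h2].
  exists (fun i => w 0 i).
    have := congr1 (fun m : 'M[R]_1 => m 0 0) h1; rewrite !mxE mulr1n => ->.
    by apply: eq_bigr => i _; rewrite !mxE mulr1.
  by apply/rowP => k; rewrite h2 summxE !mxE; apply: eq_bigr => i _; rewrite !mxE.
(* Since d is at least 1, every single index is exposed; this gives injectivity here and vertices
   below. *)
have xinj : injective x.
  move=> i j e; have [|c [b [_ h]]] := slack [set i]%SET; first by rewrite cards1.
  by have := h i; rewrite inE eqxx e h inE eq_sym => /eqP.
set P := conv_hull (range x).
have faceA (A : {set I}) : (#|A| <= d)%N -> face P (conv_hull (x @` [set i | i \in A])).
  move=> /slack[c [b [h1 h2]]]; exists c, b.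
  have hx y : range x y -> (y *m c) 0 0 <= b by move=> [i _ <-].
  split=> [q|]; first exact: conv_hull_le.
  apply/seteqP; split=> [q hq|q [/= Pq hq]].
    split=> /=; first by apply: conv_hull_sub hq => _ [i _ <-]; exists i.
    by apply: conv_hull_eq hq => _ [i iA <-]; apply/eqP; rewrite h2.
  apply: conv_hull_sub (conv_hull_face hx Pq hq) => _ [[i _ <-] /= /eqP hi].
  by exists i => //=; rewrite -h2.
have vx i : vertices P (x i).
  have /faceA : (#|[set i]%SET| <= d)%N by rewrite cards1.
  rewrite (_ : conv_hull _ = [set x i]) //; apply/seteqP; split=> [q hq|_ ->].
    apply: conv_hull_set1; apply: conv_hull_sub hq => _ [j /= + <-].
    by rewrite inE => /eqP->.
  by apply: conv_hull1; exists i => //=; rewrite inE.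
have vP : range x = vertices P.
  by apply/seteqP; split=> [_ [i _ <-] //|v]; apply: vertices_conv_hull.
exists P, x; split => //.
- by exists (range x) => //; apply: finite_image; apply: finite_finset.
- move=> A AP cA; pose A0 := [set i | `[< A (x i) >]]%SET.
  have eA : x @` [set i | i \in A0] = A.
    apply/seteqP; split=> [_ [i /= + <-]|v Av]; first by rewrite inE => /asboolP.
    by have := AP v Av; rewrite -vP => -[i _ e]; exists i => //=; rewrite inE e; apply/asboolP.
  have c0 : #|A0| = d.
    apply/card_eq_II; apply: card_eq_trans cA; rewrite card_eq_sym -eA.
    exact: card_image_finset.
  have fA : face P (conv_hull (x @` [set i | i \in A0])) by apply: faceA; rewrite c0.
  exists (conv_hull (x @` [set i | i \in A0])) => //.
  apply/seteqP; split=> [v /vertices_conv_hull|v Av]; first by rewrite eA.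
  apply: vertices_face fA _ _; first exact: AP.
  by apply: conv_hull1; rewrite eA.
exists G, (row_mx 1%:M (0 : 'rV[R]_2)), (row_mx (0 : 'M[R]_(2, 1)) 1%:M); split.
- split=> // i; apply/eqP => /(congr1 trmx); rewrite colG trmx0 => /eqP.
  rewrite scaler_eq0 (negbTE (un i)) /= => /eqP/rowP/(_ ord0).
  by case: (lift_ptE (p i)) => -> _ _; rewrite mxE => /eqP; rewrite oner_eq0.
- exact (row_free_row_mx1 (0 : 'M[R]_(2, 1))).

- by rewrite lift_pt_dir oner_neq0.
- by move=> i; rewrite colG /lift_pt scale_row_mx scale_scalar_mx mulr1 lift_pt_dir.
move=> i; exists (u i)^-1; last exact: ub.
rewrite colG scalerA mulVf // scale1r.
exact: (lift_pt_coord (p i)).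
Qed.

End GaleInverse.

Lemma conf_T_diagram (R : realType) d (X : diagram R (2 * d + 4) 2) c W : (1 <= d)%N ->
  c =i black X -> W =i predC (black X) -> conf (pt X) c W -> T_diagram X.
Proof.
move=> d1 cb Wb hc.
have sc : #|black X| = size c.
  by rewrite -(card_uniqP (conf_uniq hc)); apply: eq_card => i; rewrite cb.
have sW : #|predC (black X)| = size W.
  by rewrite -(card_uniqP (conf_uniqW hc)); apply: eq_card => i; rewrite Wb.
have sz := conf_size hc; have := cardC (black X); rewrite sc sW sz card_ord => tot.
have {}sW : size W = d.+1 by lia.
have {}sz : size c = d.+3 by lia.
split; last first.
  split; first by rewrite sc sz addn3.
  by apply: (ccw_convex_position (conf_uniq hc) cb (conf_ccw hc)); rewrite sz.
have c0 : (#|finset.set0 : {set 'I_(2 * d + 4)}| <= d)%N by rewrite cards0.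
have [q [x [y [z [_ _ _ h _]]]]] := fan_triangle hc cb Wb sW c0.
apply: (affine_gale_of_relations d1 (lt0r_neq0 h)) => A hA.
exact: (conf_relation hc cb Wb sW hA).
Qed.

(** * Characteristic trees *)

Lemma bt_map_id (T : eqType) (t : bt T) : bt_map id t = t.
Proof. by elim: t => //= v L -> M ->. Qed.

Lemma bt_map_cancel (T T' : eqType) (f : T -> T') (g : T' -> T) t :
  cancel g f -> bt_map f (bt_map g t) = t.
Proof. by move=> fg; elim: t => /= [v|v L -> M ->]; rewrite fg. Qed.

Section CharTree.
Variables (R : realType) (d : nat) (X : diagram R (2 * d + 4) 2).
Hypotheses (TX : T_diagram X) (d1 : (1 <= d)%N).
Local Notation I := 'I_(2 * d + 4).
Local Notation p := (pt X).

Let big : (2 < #|black X|)%N.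
Proof. by rewrite (T_black TX); lia. Qed.

(** The leaves may follow the polygon in either direction, because [boundary_order] is
    unoriented. *)
Definition tree_data (r : I) (t : bt I) :=
  [/\ realizes p r t, r :: leaves t =i black X, nodes t =i [pred i | ~~ black X i]
    & ccw p (r :: leaves t) \/ ccw p (rev (r :: leaves t))].

Lemma data_characteristic (G : tree3) (phi : I -> G) r t : bijective phi ->
  rooted (phi r) (bt_map phi t) -> realizes p r t -> r :: leaves t =i black X ->
  nodes t =i [pred i | ~~ black X i] -> ccw p (r :: leaves t) -> characteristic_tree X phi.
Proof.
move=> bij hr rl hb hw hcc; have inj := bij_inj bij.
have lf i : black X i -> leaf (phi i).
  move=> bi; rewrite (rooted_leaf hr) leaves_map -map_cons mem_map // hb; exact: bi.
have tv i : ~~ black X i -> trivalent (phi i).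
  by move=> nb; rewrite (rooted_trivalent hr) nodes_map mem_map // hw.
split=> //; split.
- by move=> i; case: ifPn => [/lf|/tv].
- exists (r :: leaves t); last by rewrite map_cons -leaves_map; apply: leaf_order_leaves.
  apply: ccw_boundary_order => //.
  apply: uniq_root_leaves; have := rooted_uniq hr.
  by rewrite labels_map -map_cons map_inj_uniq.
move=> b i j k nb bi bj bk u3.
have u3' : [&& i != j, j != k & k != i].
  by move: u3; rewrite /= !inE negb_or andbT (eq_sym k) => /andP[/andP[-> ->] ->].
rewrite in_triangleP; last exact: T_generic.
rewrite rl ?hb ?hw // (tripod_tri hr) ?lf ?tv //.
by rewrite (tri_map inj).
Qed.

Lemma characteristic_exists : exists (G : tree3) (phi : I -> G), characteristic_tree X phi.
Proof.
have [c [uc hc cc]] := exists_ccw (T_cvx TX) (T_gen TX) big.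
have hcf := T_conf TX d1 uc hc cc; set W := enum _ in hcf.
case: c uc hc cc hcf => [|r ls] uc hc cc hcf; first by have := conf_size hcf.
have [t [lt pn rt]] := conf_tree hcf.
have u : uniq (r :: labels t) by apply: conf_uniq_labels pn; rewrite lt; exact: hcf.
have nW : nodes t =i [pred i | ~~ black X i] by move=> i; rewrite (perm_mem pn) mem_enum.
have all_in x : x \in r :: labels t.
  rewrite inE mem_labels mem_cat orbA -in_cons lt hc nW inE; exact: orbN.
pose G := tree_of_bt u all_in; pose phi : I -> G := fun i => i.
exists G, phi; apply: (@data_characteristic G phi r t).
- by exists (fun i : G => i : I).
- have -> : bt_map phi t = t by apply: bt_map_id.
  exact: tree_of_bt_rooted.
- exact: rt.
- by rewrite lt.
- exact: nW.
by rewrite lt.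
Qed.

(** The unfolding of [G] at the leaf of [r] is pulled back to indices along [phi]. The boundary
    order agrees with its leaves up to a rotation, which [rotr] undoes. *)
Lemma characteristic_data (G : tree3) (phi : I -> G) r T :
  characteristic_tree X phi -> black X r -> rooted (phi r) T ->
  exists t, [/\ T = bt_map phi t & tree_data r t].
Proof.
move=> [bij [col [c0 bo lo] tri_iff]] br hr; have inj := bij_inj bij.
have [g gK Kg] := bij; have [k ek] := leaf_order_rot hr lo.
exists (bt_map g T); split; first by rewrite bt_map_cancel.
have [uc hc _] := bo.
pose c := rotr k c0.
have ec : r :: leaves (bt_map g T) = c.
  apply: (inj_map inj); rewrite /c map_rotr ek rotK map_cons leaves_map mapK //.
have cb : c =i black X by move=> i; rewrite /c mem_rotr hc.
have nT i : (i \in nodes (bt_map g T)) = ~~ black X i.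
  rewrite nodes_map -(mem_map inj) mapK // -(rooted_trivalent hr).
  have := col i; case: ifP => bi //= h; rewrite /trivalent (eqP (h : #|adj (phi i)| == 1%N)) //.
split; rewrite ?ec //.
- move=> w x y z wN xc yc zc; rewrite ec !cb in xc yc zc.
  rewrite nT in wN; rewrite -(tri_map inj) bt_map_cancel //.
  have lf i : i \in black X -> leaf (phi i) by move=> bi; have := col i; rewrite [black X i]bi.
  have tw : trivalent (phi w) by have := col w; rewrite (negbTE wN).
  case: (boolP (uniq [:: x; y; z])) => [u3|]; last first.
    rewrite /= !inE andbT negb_and !negbK => h.
    transitivity false.
      apply/negP => /tr_uniq/and3P[h1 h2 h3]; move: h.
      by rewrite (negbTE h1) (negbTE h2) (eq_sym x) (negbTE h3).
    apply/esym/negbTE; rewrite /tri /= !inE andbT negb_and !negbK.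
    by case/orP: h => [/orP[]|] /eqP->; rewrite eqxx ?orbT.
  have u3' : [&& x != y, y != z & z != x].
    by move: u3; rewrite /= !inE negb_or andbT (eq_sym z) => /andP[/andP[-> ->] ->].
  apply/idP/idP.
    move/in_tri_in_triangle/(tri_iff w x y z wN xc yc zc u3)/(tripod_tri hr) => h.
    by apply: h; rewrite // lf.
  move=> h; apply/in_triangleP; first exact: T_generic.
  apply/tri_iff => //; apply/(tripod_tri hr) => //; exact: lf.
have [h|h] := boundary_order_ccw (T_cvx TX) (T_gen TX) big bo; [left | right].
  exact: ccw_rot.
rewrite /c /rotr rev_rot; exact: ccw_rot.
Qed.

End CharTree.

(** * Isomorphisms between 3-trees with the same or mirrored binary tree *)

Section TreeIso.
Variables (I : finType) (G G' : tree3) (phi : I -> G) (phi' : I -> G') (r : I) (t : bt I).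
Hypotheses (bij : bijective phi) (bij' : bijective phi').
Hypothesis hr : rooted (phi r) (bt_map phi t).

Lemma iso_of_nbr t' : rooted (phi' r) (bt_map phi' t') ->
  (forall x, nbr r t' x =i nbr r t x) ->
  exists psi : G -> G', graph_iso psi /\ forall i, psi (phi i) = phi' i.
Proof.
move=> hr' hn; have [g gK Kg] := bij; have [g' gK' Kg'] := bij'.
exists (phi' \o g); split=> [|i]; rewrite /= ?gK //.
split; first by exists (phi \o g') => [x|x] /=; rewrite ?gK' ?Kg ?gK ?Kg'.
move=> u v; rewrite -(Kg u) -(Kg v) /= !gK (rooted_adj hr) (rooted_adj hr').
by rewrite (nbr_map (bij_inj bij)) (nbr_map (bij_inj bij')) !mem_map ?hn //; apply: bij_inj.
Qed.

Lemma data_uniq : uniq (r :: labels t).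
Proof.
have := rooted_uniq hr; rewrite labels_map -map_cons map_inj_uniq //; exact: bij_inj.
Qed.

Lemma trivalent_nbr x : trivalent (phi x) ->
  exists a b c, [/\ x \in nodes t, nbr r t x = [:: a; b; c] & [&& a != b, b != c & c != a]].
Proof.
move=> tv; have xn : x \in nodes t.
  by move: tv; rewrite (rooted_trivalent hr) nodes_map mem_map //; apply: bij_inj.
have xr : x != r.
  by apply: contraTneq data_uniq => <-; rewrite cons_uniq nodes_sub.
have [a [b [c [en [sa sb sc]]]]] := nb_node data_uniq xn.
exists a, b, c; split=> //; first by rewrite /nbr (negbTE xr).
apply/and3P; split; apply/eqP => e.
- by rewrite e sb in sa.
- by rewrite e sc in sb.
by rewrite e sa in sc.
Qed.

Lemma preserving_iso : rooted (phi' r) (bt_map phi' t) ->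
  exists psi : G -> G', [/\ graph_iso psi, forall i, psi (phi i) = phi' i &
    preserves_cyclic_orders psi].
Proof.
move=> hr'; have [//|psi [hpsi e]] := iso_of_nbr hr'.
exists psi; split=> // v w; have [g gK Kg] := bij; rewrite -(Kg v) -(Kg w) !e => tv aw.
rewrite (rooted_succ hr tv aw); have := hpsi.2 (phi (g v)) (phi (g w)); rewrite !e aw => aw'.
have tv' : trivalent (phi' (g v)).
  rewrite (rooted_trivalent hr') nodes_map mem_map; last exact: bij_inj.
  by move: tv; rewrite (rooted_trivalent hr) nodes_map mem_map //; apply: bij_inj.
rewrite (rooted_succ hr' tv' aw') (nbr_map (bij_inj bij)) (nbr_map (bij_inj bij')).
have [a [b [c [_ -> /and3P[ab bc ca]]]]] := trivalent_nbr tv.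
have u3 : uniq [:: a; b; c] by rewrite /= !inE negb_or ab bc eq_sym ca.
by rewrite (next_map (bij_inj bij) u3) (next_map (bij_inj bij') u3) e.
Qed.

Lemma swap_tail_mem (T : eqType) (s : seq T) : swap_tail s =i s.
Proof. by case: s => [|a [|b [|c [|d s]]]] // x; rewrite /= !inE [(x == c) || _]orbC. Qed.

(** In the mirrored tree the neighbour list of a node is [a], [c], [b] instead of [a], [b], [c], so
    the new [next] undoes the old one. *)
Lemma reversing_iso : rooted (phi' r) (bt_map phi' (mirror t)) ->
  exists psi : G -> G', [/\ graph_iso psi, forall i, psi (phi i) = phi' i &
    reverses_cyclic_orders psi].
Proof.
move=> hr'.
have hn x : nbr r (mirror t) x = if x == r then [:: bt_root t] else swap_tail (nb r t x).
  by rewrite /nbr bt_root_mirror nb_mirror // data_uniq.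
have [x|psi [hpsi e]] := iso_of_nbr hr'.
  by rewrite hn /nbr; case: ifP => // _; apply: swap_tail_mem.
exists psi; split=> // v w; have [g gK Kg] := bij; rewrite -(Kg v) -(Kg w) => tv aw.
have [a [b [c [vn n1 /and3P[ab bc ca]]]]] := trivalent_nbr tv.
have tv' : trivalent (phi' (g v)).
  rewrite (rooted_trivalent hr') nodes_map mem_map; last exact: bij_inj.
  by rewrite nodes_mirror.
have n2 : nbr r (mirror t) (g v) = [:: a; c; b].
  by have := n1; rewrite hn /nbr; case: ifP => // _ ->.
have u3 : uniq [:: a; b; c] by rewrite /= !inE negb_or ab bc eq_sym ca.
have u3' : uniq [:: a; c; b] by rewrite /= !inE negb_or ab (eq_sym a) ca eq_sym bc.
have wn : g w \in [:: a; b; c].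
  by move: aw; rewrite (rooted_adj hr) (nbr_map (bij_inj bij)) mem_map ?n1 //; apply: bij_inj.
rewrite (rooted_succ hr tv aw) (nbr_map (bij_inj bij)) n1 (next_map (bij_inj bij) u3) !e.
set y := next _ _.
have yn : y \in [:: a; c; b].
  by rewrite -(swap_tail_mem [:: a; c; b]) mem_next.
have aw' : adj (phi' (g v)) (phi' y).
  by rewrite (rooted_adj hr') (nbr_map (bij_inj bij')) mem_map ?n2 //; apply: bij_inj.
rewrite (rooted_succ hr' tv' aw') (nbr_map (bij_inj bij')) n2 (next_map (bij_inj bij') u3').
have ne := (eqxx, negbTE ab, negbTE bc, negbTE ca).
have {}ne := (ne, eq_sym b a, eq_sym c b, eq_sym a c).
congr phi'; rewrite /y; move: wn; rewrite !inE => /or3P[]/eqP->; by rewrite /= !ne.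
Qed.

End TreeIso.

(** Both trees record the same containments, so their triples agree. If the leaf lists run in the
    same direction they are equal, since the polygon has one counterclockwise enumeration from [r];
    otherwise one is the reverse of the other and [mirror] restores equality. *)
Lemma tree_data_unique (R : realType) d (X : diagram R (2 * d + 4) 2) r t t' :
  uniq (r :: labels t) -> uniq (r :: labels t') -> tree_data X r t -> tree_data X r t' ->
  t = t' \/ mirror t = t'.
Proof.
move=> u u' [rl hb hw hc] [rl' hb' hw' hc'].
have ut : uniq (labels t) by move: u; rewrite cons_uniq => /andP[].
have ul := uniq_root_leaves u; have ul' := uniq_root_leaves u'.
have pl : perm_eq (leaves t) (leaves t').
  by rewrite -(perm_cons r); apply: uniq_perm => // i; rewrite hb hb'.
have rc (s : seq 'I_(2 * d + 4)) : ccw (pt X) (rev (r :: s)) -> ccw (pt X) (r :: rev s).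
  by move=> h; rewrite -[r :: rev s]cat1s -rot_size_cat; apply: ccw_rot; rewrite cats1 -rev_cons.
have same (s : bt 'I_(2 * d + 4)) : (forall x i j k, tri s x i j k = tri t x i j k) ->
    forall x i j k, i \in r :: leaves t' -> j \in r :: leaves t' -> k \in r :: leaves t' ->
    tri s x i j k = tri t' x i j k.
  move=> e x i j k ic jc kc; rewrite e; case: (boolP (x \in nodes t')) => xn; last first.
    have xn' : x \notin nodes t by rewrite hw -hw'.
    by rewrite /tri !side_notin.
  have xn' : x \in nodes t by rewrite hw -hw'.
  by rewrite -rl' // -rl // ?hb -?hb'.
have straight : leaves t = leaves t' -> t = t'.
  move=> e; apply: (bt_unique u u' e) => x i j k ic jc kc.
  by apply: same => //; rewrite -e.
have flipped : rev (leaves t) = leaves t' -> mirror t = t'.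
  move=> e; apply: (@bt_unique _ r _ _ _ u').
  - rewrite cons_uniq (perm_mem (perm_labels_mirror t)) (perm_uniq (perm_labels_mirror t)).
    exact: u.
  - by rewrite leaves_mirror.
  move=> x i j k; rewrite leaves_mirror e => ic jc kc; apply: same => // *; exact: tri_mirror.
have rp : perm_eq (rev (leaves t)) (leaves t') by rewrite perm_rev.
have pr : perm_eq (leaves t) (rev (leaves t')) by rewrite perm_sym perm_rev perm_sym.
have rpr : perm_eq (rev (leaves t)) (rev (leaves t')) by rewrite perm_rev.
case: hc hc' => hc [] hc'.
- by left; apply/straight/(ccw_unique pl hc hc').
- by right; apply: flipped; rewrite (ccw_unique pr hc (rc _ hc')) revK.
- by right; apply/flipped/(ccw_unique rp (rc _ hc) hc').
by left; apply/straight/(can_inj revK)/(ccw_unique rpr (rc _ hc) (rc _ hc')).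
Qed.

Section PartOne.
Variables (R : realType) (d : nat) (X : diagram R (2 * d + 4) 2).
Hypotheses (TX : T_diagram X) (d1 : (1 <= d)%N).

Lemma characteristic_unique (G G' : tree3)
    (phi : 'I_(2 * d + 4) -> G) (phi' : 'I_(2 * d + 4) -> G') :
  characteristic_tree X phi -> characteristic_tree X phi' ->
  exists psi : G -> G', [/\ graph_iso psi, forall i, psi (phi i) = phi' i &
    preserves_cyclic_orders psi \/ reverses_cyclic_orders psi].
Proof.
move=> hX hX'; have [r br] : exists r, black X r.
  have : (0 < #|black X|)%N by rewrite (T_black TX); lia.
  by case/card_gt0P => r; exists r.
have lf (H : tree3) (f : 'I_(2 * d + 4) -> H) : characteristic_tree X f -> leaf (f r).
  by case=> _ [/(_ r)]; rewrite br.
have [T hr] := rooted_exists (lf _ _ hX); have [T' hr'] := rooted_exists (lf _ _ hX').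
have [t [eT dt]] := characteristic_data TX d1 hX br hr.
have [t' [eT' dt']] := characteristic_data TX d1 hX' br hr'.
have bij := hX.1; have bij' := hX'.1.
rewrite eT in hr; rewrite eT' in hr'.
have [e|e] := tree_data_unique (data_uniq bij hr) (data_uniq bij' hr') dt dt'; rewrite -e in hr'.
  have [psi [h1 h2 h3]] := preserving_iso bij bij' hr hr'; exists psi; split=> //; by left.
have [psi [h1 h2 h3]] := reversing_iso bij bij' hr hr'; exists psi; split=> //; by right.
Qed.

(** In general position no point lies strictly between two others, so this relation only tests
    equality of indices, and orientations carry the whole equivalence. *)
Lemma T_between i j k : between (pt X i) (pt X j) (pt X k) <-> (j == i) || (j == k).
Proof.
have inj := T_inj TX; split=> [h|/orP[/eqP->|/eqP->]].
- apply: contraT; rewrite negb_or => /andP[ji jk].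
  case: (eqVneq i k) => [e|ik].
    have : pt X j = pt X i by apply: conv_hull_set1; move: h; rewrite /between -e setUid.
    by move/inj/eqP; rewrite (negbTE ji).
  have := T_generic TX (x := i) (y := k) (z := j).
  by rewrite ik eq_sym jk ji (between_det3 h) eqxx => /(_ isT).
- by apply: conv_hull1; left.
by apply: conv_hull1; right.
Qed.

End PartOne.

Lemma diagram_exists (R : realType) d (G : tree3) : (1 <= d)%N -> #|G| = (2 * d + 4)%N ->
  exists X : diagram R (2 * d + 4) 2, T_diagram X /\
    exists phi : 'I_(2 * d + 4) -> G, characteristic_tree X phi.
Proof.
move=> d1 e; pose phi (i : 'I_(2 * d + 4)) : G := enum_val (cast_ord (esym e) i).
have bij : bijective phi.
  exists (fun v => cast_ord e (enum_rank v)) => [i|v]; rewrite /phi.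
    by rewrite enum_valK cast_ordKV.
  by rewrite cast_ordK enum_rankK.
have [g gK Kg] := bij; have [r0 lr] := leaf_exists G; have [T hr] := rooted_exists lr.
pose r := g r0; pose t := bt_map g T.
have eT : bt_map phi t = T by apply: bt_map_cancel.
have er : phi r = r0 by rewrite /r Kg.
have hr' : rooted (phi r) (bt_map phi t) by rewrite er eT.
have u : uniq (r :: labels t) := data_uniq bij hr'.
have [p [hc rl _]] := bt_realization R u.
pose X := Diagram p (fun i => i \in r :: leaves t).
have Wb : nodes t =i predC (black X).
  move=> i; rewrite [RHS]/=; have := rooted_all hr' (phi i).
  rewrite labels_map -map_cons mem_map ?inE ?mem_labels ?mem_cat; last exact: bij_inj.
  rewrite orbA; case: (boolP (i \in nodes t)) => [iN _|_]; last by rewrite orbF => ->.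
  rewrite negb_or; apply/esym/andP; split.
    by apply: contraTneq u => <-; rewrite cons_uniq nodes_sub.
  by apply: contraTN iN; apply: leaf_notin_nodes; move: u; rewrite cons_uniq => /andP[].
have TX : T_diagram X by apply: (conf_T_diagram d1 (c := r :: leaves t) (W := nodes t)).
exists X; split=> //; exists phi; apply: (data_characteristic TX d1 bij hr' rl) => //.
exact: conf_ccw hc.
Qed.

(** [f] matches the points attached to the same vertex of [G], so both diagrams have the same tree
    on their indices and the same containments. If the polygons run in opposite directions along its
    leaves, one diagram is reflected before rigidity is applied, which gives the minus sign. *)
Lemma characteristic_comb_equiv (R : realType) d (X Y : diagram R (2 * d + 4) 2) (G : tree3)
    (phi psi : 'I_(2 * d + 4) -> G) : (1 <= d)%N -> T_diagram X -> T_diagram Y ->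
  characteristic_tree X phi -> characteristic_tree Y psi -> comb_equiv X Y.
Proof.
move=> d1 TX TY hX hY; have [g gK Kg] := hX.1; have [h hK Kh] := hY.1.
have [r0 lr] := leaf_exists G; have [T hr] := rooted_exists lr.
have blX i : black X i = leaf (phi i).
  have [/(_ i) + _ _] := hX.2; case: ifP => // _; rewrite /trivalent /leaf => /eqP->; by [].
have blY i : black Y i = leaf (psi i).
  have [/(_ i) + _ _] := hY.2; case: ifP => // _; rewrite /trivalent /leaf => /eqP->; by [].
have brX : black X (g r0) by rewrite blX Kg.
have brY : black Y (h r0) by rewrite blY Kh.
have hrX : rooted (phi (g r0)) T by rewrite Kg.
have hrY : rooted (psi (h r0)) T by rewrite Kh.
have [tX [eX [rX bX wX cX]]] := characteristic_data TX d1 hX brX hrX.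
have [tY [eY [rY bY wY cY]]] := characteristic_data TY d1 hY brY hrY.
pose f := h \o phi; have fb : bijective f.
  by exists (g \o psi) => i; rewrite /f /= ?Kh ?gK ?Kg ?hK.
have fi := bij_inj fb.
have fr : f (g r0) = h r0 by rewrite /f /= Kg.
have ft : bt_map f tX = tY.
  have <- : bt_map h (bt_map psi tY) = tY by apply: bt_map_cancel.
  by rewrite -eY eX; elim: (tX) => //= v L -> M ->.
have bf i : black Y (f i) = black X i by rewrite blX blY /f /= Kh.
set r := g r0 in rX bX cX fr; set c := r :: leaves tX in bX cX.
have fc : map f c = h r0 :: leaves tY by rewrite /c /= fr -ft leaves_map.
rewrite -fc in cY bY.
have uX : uniq (r :: labels tX) by apply: (data_uniq hX.1); rewrite -eX.
have uc : uniq c := uniq_root_leaves uX.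
pose p' i := pt Y (f i); pose W := enum [pred i | ~~ black X i].
have trE w x y z : w \in W -> x \in c -> y \in c -> z \in c ->
    in_tri (pt X w) (pt X x) (pt X y) (pt X z) = in_tri (p' w) (p' x) (p' y) (p' z).
  rewrite mem_enum => wW xc yc zc; rewrite rX ?wX // /p' rY -?fc ?map_f //.
    by rewrite -ft tri_map.
  by rewrite -ft nodes_map map_f // wX.
have confX s : s =i c -> uniq s -> ccw (pt X) s -> conf (pt X) s W.
  by move=> sc us cs; apply: T_conf => // i; rewrite sc bX.
have [f' fK Kf] := fb.
have confY s : s =i c -> uniq s -> ccw (pt Y) (map f s) -> conf p' s W.
  move=> sc us cs; apply: (conf_map fi (p := pt Y)).
  apply: (conf_perm (W := enum [pred i | ~~ black Y i])).
    apply: uniq_perm => [||i]; rewrite ?map_inj_uniq ?enum_uniq //.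
    by rewrite -(Kf i) mem_map // !mem_enum !inE bf.
  apply: T_conf => //; first by rewrite map_inj_uniq.
  by move=> i; rewrite -bY -(Kf i) !mem_map.
have cW s i : s =i c -> (i \in s) || (i \in W).
  by move=> sc; rewrite sc bX mem_enum; apply: orbN.
have genX := T_generic TX.
have genY x y z : [&& x != y, y != z & z != x] -> det3 (p' x) (p' y) (p' z) != 0.
  by move=> u; apply: (T_generic TY); rewrite !(inj_eq fi).
have crc : rev c =i c by move=> i; rewrite mem_rev.
have urc : uniq (rev c) by rewrite rev_uniq.
have same s : s =i c -> conf (pt X) s W -> conf p' s W -> forall i j k,
    orientation (p' i) (p' j) (p' k) = orientation (pt X i) (pt X j) (pt X k).
  move=> sc h1 h2 i j k; rewrite !orientationE; apply/esym.
  apply: (same_orientations h1 h2) => // [w x y z wW|i']; last exact: cW.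
  by rewrite !sc => xs ys zs; apply: trE.
have opposite s : s =i c -> conf (pt X) s W -> conf p' (rev s) W -> forall i j k,
    orientation (p' i) (p' j) (p' k) = - orientation (pt X i) (pt X j) (pt X k).
  move=> sc h1 /conf_reflect h2 i j k; rewrite !orientationE.
  rewrite (same_orientations h1 h2) //= ?det3_reflect ?sgrN ?opprK //.
  - by move=> w x y z wW; rewrite !sc /= in_tri_reflect => xs ys zs; apply: trE.
  - by move=> i'; apply: cW.
  by move=> x y z u; rewrite det3_reflect oppr_eq0 genY.
exists f; split=> //.
  by move=> i j k; rewrite (T_between TY) (T_between TX) !(inj_eq fi).
have revK' : rev (rev c) = c := revK c.
case: cX => hcX; case: cY => hcY.
- by left; apply: (same c) => //; [apply: confX | apply: confY].
- right; apply: (opposite c) => //; first exact: confX.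
  by apply: confY => //; rewrite map_rev.
- right; apply: (opposite (rev c)) => //; first exact: confX.
  by rewrite revK; apply: confY.
left; apply: (same (rev c)) => //; first exact: confX.
by apply: confY => //; rewrite map_rev.
Qed.

Theorem theorem1p13 (R : realType) (d : nat) (hd : (1 <= d)%N) :
  ((forall X : diagram R (2 * d + 4) 2, T_diagram X ->
      (exists (G : tree3) (phi : 'I_(2 * d + 4) -> G),
         characteristic_tree X phi) /\
      (forall (G G' : tree3)
              (phi : 'I_(2 * d + 4) -> G) (phi' : 'I_(2 * d + 4) -> G'),
         characteristic_tree X phi -> characteristic_tree X phi' ->
         exists psi : G -> G',
           [/\ graph_iso psi,
               forall i, psi (phi i) = phi' i
             & preserves_cyclic_orders psi \/ reverses_cyclic_orders psi])))
  /\
  ((4 <= 2 * d)%N ->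
   forall G : tree3, #|G| = (2 * d + 4)%N ->
     (exists X : diagram R (2 * d + 4) 2,
        T_diagram X /\
        exists phi : 'I_(2 * d + 4) -> G, characteristic_tree X phi) /\
     (forall X Y : diagram R (2 * d + 4) 2,
        T_diagram X ->
        (exists phi : 'I_(2 * d + 4) -> G, characteristic_tree X phi) ->
        T_diagram Y ->
        (exists phi : 'I_(2 * d + 4) -> G, characteristic_tree Y phi) ->
        comb_equiv X Y)).
Proof.
split=> [X TX|_ G cG]; split.
- exact: characteristic_exists.
- by move=> G G' phi phi'; apply: characteristic_unique.
- exact: diagram_exists.
by move=> X Y TX [phi hX] TY [psi hY]; apply: characteristic_comb_equiv hX hY.
Qed.
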